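(* Let $\mathbb{K}$ be a field of characteristic $0$. For every morphism $\chi\colon L\to M$ of differential graded Lie algebras over $\mathbb{K}$, there is an isomorphism of functors $\mathbf{Art}\to\mathbf{Set}$ $$\operatorname{Def}_{\widetilde{C}(\chi)}\simeq\operatorname{Def}_{\chi},$$ where $\widetilde C(\chi)$ is the $L_\infty$-algebra on the suspended mapping cone $C_\chi$ and $\operatorname{Def}_{\widetilde C(\chi)}$, $\operatorname{Def}_\chi$ are the functors described in the context.
   Context: $\mathbf{Art}$ is the category of local Artinian $\mathbb{K}$-algebras $A$ with residue field $\mathbb{K}$ and maximal ideal $\mathfrak{m}_A$. Graded vector spaces are $\mathbb{Z}$-graded, $(V[k])^i=V^{i+k}$, $\bigodot^n$ is the graded symmetric power, and the Koszul sign $\varepsilon(\sigma)$ is defined by $v_{\sigma(1)}\odot\cdots\odot v_{\sigma(n)}=\varepsilon(\sigma)v_1\odot\cdots\odot v_n$. An $L_\infty$ structure on $V$ is a sequence of degree $1$ maps $q_k\colon\bigodot^kV[1]\to V[1]$, $k\geq 1$, whose induced coderivation $Q$ of the reduced symmetric coalgebra $\bigoplus_{n\ge1}\bigodot^nV[1]$ satisfies $QQ=0$. The $L_\infty$-algebra $\widetilde C(\chi)$: its underlying graded space is $C_\chi$, $C^i_\chi=L^i\oplus M^{i-1}$, so $C_\chi[1]=L[1]\oplus M$, and its structure maps $\langle\,\rangle_n\colon\bigodot^nC_\chi[1]\to C_\chi[1]$ are, on homogeneous elements $l,l_i\in L$, $m,m_i\in M$: $\langle(l,m)\rangle_1=(-dl,-\chi(l)+dm)$;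 $\langle l_1\odot l_2\rangle_2=(-1)^{\deg_L(l_1)}[l_1,l_2]\in L$; $\langle m\otimes l\rangle_2=\frac{(-1)^{\deg_M(m)+1}}2[m,\chi(l)]\in M$; $\langle m_1\odot m_2\rangle_2=0$; $\langle m_1\odot\cdots\odot m_n\otimes l_1\odot\cdots\odot l_k\rangle_{n+k}=0$ if $n+k\ge3$ and $k\ne1$; and for $n\ge2$ $$\langle m_1\odot\cdots\odot m_n\otimes l\rangle_{n+1}=-(-1)^{\sum_{i=1}^n\deg_M(m_i)}\frac{B_n}{n!}\sum_{\sigma\in S_n}\varepsilon(\sigma)[m_{\sigma(1)},[m_{\sigma(2)},\cdots,[m_{\sigma(n)},\chi(l)]\cdots]]\in M,$$ where the Bernoulli numbers are defined by $\sum_{n\ge0}B_nx^n/n!=x/(e^x-1)$. For an $L_\infty$-algebra $(\mathfrak g,q_1,q_2,\dots)$ and $A\in\mathbf{Art}$, $$\operatorname{MC}_{\mathfrak g}(A)=\Big\{\gamma\in\mathfrak g[1]^0\otimes\mathfrak m_A\ \Big|\ \sum_{n\ge1}\frac{q_n(\gamma^{\odot n})}{n!}=0\Big\}.$$ $\mathfrak g[t,dt]=\mathfrak g\otimes\mathbb{K}[t,dt]$ with the $L_\infty$ structure obtained by extension of scalars to the commutative DG algebra $\mathbb{K}[t,dt]$ ($\deg t=0$, $\deg dt=1$), i.e. (on $\mathfrak g[1]\otimes \mathbb{K}[t,dt]$) $q_1(v\otimes r)=q_1(v)\otimes r+(-1)^{\deg_{\mathfrak g[1]}(v)}v\otimes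 dr$ and, for $n\ge2$, $q_n$ is extended multilinearly with Koszul signs. Two elements $\gamma_0,\gamma_1\in\operatorname{MC}_{\mathfrak g}(A)$ are homotopy equivalent if there is $\gamma(t,dt)\in\operatorname{MC}_{\mathfrak g[t,dt]}(A)$ with $\gamma(0)=\gamma_0$, $\gamma(1)=\gamma_1$ (evaluation at $t=a$, $dt=0$). $\operatorname{Def}_{\mathfrak g}(A)$ is the quotient of $\operatorname{MC}_{\mathfrak g}(A)$ by homotopy equivalence (which is an equivalence relation). The functor $\operatorname{Def}_\chi$ is $$\operatorname{Def}_\chi(A)=\frac{\{(x,e^a)\in(L^1\otimes\mathfrak m_A)\times\exp(M^0\otimes\mathfrak m_A)\mid dx+\frac12[x,x]=0,\ e^a\ast\chi(x)=0\}}{\text{gauge equivalence}},$$ where $\ast$ is the gauge action, given in any DGLA by $e^a\ast y=y+\sum_{n\ge0}\frac{\operatorname{ad}_a^n}{(n+1)!}([a,y]-da)$, and $(l_0,e^{m_0})$ is gauge equivalent to $(l_1,e^{m_1})$ if there exists $(a,b)\in(L^0\oplus M^{-1})\otimes\mathfrak m_A$ with $l_1=e^a\ast l_0$ and $e^{m_1}=e^{db}e^{m_0}e^{-\chi(a)}$ (product in the group $\exp(M^0\otimes\mathfrak m_A)$ of the nilpotent Lie algebra $M^0\otimes\mathfrak m_A$). *)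

(* Defs.v *)
From HB Require Import structures.
From Stdlib Require Import Relation_Operators.
From mathcomp Require Import all_boot all_order perm all_algebra.
From mathcomp Require Import boolp classical_sets cardinality fsbigop.

Set Implicit Arguments.
Unset Strict Implicit.
Unset Printing Implicit Defensive.

Import GRing.Theory.
Local Open Scope ring_scope.
Local Open Scope quotient_scope.

(* A sum over nat all of whose late partial sums are equal to s. *)
Definition sums_to (V : nmodType) (u : nat -> V) (s : V) : Prop :=
  exists N, forall n, (N <= n)%N -> \sum_(k < n) u k = s.

Section Bilinear.
Variables (K : fieldType) (V W U : lmodType K).
Definition bilinear_map (f : V -> W -> U) : Prop :=
  (forall v, linear (f v)) /\ (forall w, linear (f^~ w)).
End Bilinear.

(* V (x) W, as the formal sums of pairs (v, w), two of them being identified when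
   every bilinear map on V x W takes the same value on both. *)
Section Tensor.
Variables (K : fieldType) (V W : lmodType K).
Implicit Types (U : lmodType K) (s : seq (V * W)).

Definition tsum U (f : V -> W -> U) s : U := \sum_(p <- s) f p.1 p.2.

Definition teq s s' : bool :=
  `[< forall U (f : V -> W -> U), bilinear_map f -> tsum f s = tsum f s' >].

Fact teq_equiv : equiv_class_of teq.
Proof.
split=> [s|s s'|s s' s''].
- exact/asboolP.
- by apply/asboolP/asboolP => h U f bf; rewrite h.
- by move=> /asboolP h /asboolP h'; apply/asboolP => U f bf; rewrite h ?h'.
Qed.
Canonical teq_equiv_rel := EquivRelPack teq_equiv.

Definition tensor : Type := {eq_quot teq_equiv_rel}.
HB.instance Definition _ := EqQuotient.on tensor.
HB.instance Definition _ := Choice.on tensor.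

Definition tlift U (f : V -> W -> U) (x : tensor) : U := tsum f (repr x).

Lemma tlift_pi U (f : V -> W -> U) s :
  bilinear_map f -> tlift f (\pi_tensor s) = tsum f s.
Proof.
move=> bf; rewrite /tlift.
have : repr (\pi_tensor s) = s %[mod tensor] by rewrite reprK.
by move/eqmodP => /asboolP; apply.
Qed.

Lemma tensor_ext (x y : tensor) :
  (forall U (f : V -> W -> U), bilinear_map f -> tlift f x = tlift f y) -> x = y.
Proof.
by move=> h; rewrite -[x]reprK -[y]reprK; apply/eqmodP/asboolP.
Qed.


Lemma tsum_cat U (f : V -> W -> U) s s' : tsum f (s ++ s') = tsum f s + tsum f s'.
Proof. exact: big_cat. Qed.

Definition tscale_seq (c : K) s := [seq (c *: p.1, p.2) | p <- s].

Lemma tsum_scale U (f : V -> W -> U) c s :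
  bilinear_map f -> tsum f (tscale_seq c s) = c *: tsum f s.
Proof.
move=> [_ fl]; rewrite /tsum big_map scaler_sumr; apply: eq_bigr => p _ /=.
have f0 : f 0 p.2 = 0 by have := fl p.2 1 0 0; rewrite scaler0 scale1r addr0 => /esym/eqP; rewrite -subr_eq0 addrK => /eqP.
by have := fl p.2 c p.1 0; rewrite addr0 f0 addr0.
Qed.

Definition tzero : tensor := \pi_tensor [::].
Definition tadd (x y : tensor) : tensor := \pi_tensor (repr x ++ repr y).
Definition tscale (c : K) (x : tensor) : tensor :=
  \pi_tensor (tscale_seq c (repr x)).
Definition topp (x : tensor) : tensor := tscale (-1) x.

Section Ops.
Variables (U : lmodType K) (f : V -> W -> U) (bf : bilinear_map f).
Lemma tlift0 : tlift f tzero = 0.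
Proof. by rewrite tlift_pi // /tsum big_nil. Qed.
Lemma tliftD x y : tlift f (tadd x y) = tlift f x + tlift f y.
Proof. by rewrite tlift_pi // tsum_cat. Qed.
Lemma tliftZ c x : tlift f (tscale c x) = c *: tlift f x.
Proof. by rewrite tlift_pi // tsum_scale. Qed.
End Ops.

Fact taddA : associative tadd.
Proof. by move=> x y z; apply: tensor_ext => U f bf; rewrite !tliftD // addrA. Qed.
Fact taddC : commutative tadd.
Proof. by move=> x y; apply: tensor_ext => U f bf; rewrite !tliftD // addrC. Qed.
Fact tadd0 : left_id tzero tadd.
Proof.
by move=> x; apply: tensor_ext => U f bf; rewrite tliftD // tlift0 // add0r.
Qed.
Fact taddN : left_inverse tzero topp tadd.
Proof.
move=> x; apply: tensor_ext => U f bf.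
by rewrite tliftD // tliftZ // tlift0 // scaleN1r addNr.
Qed.
HB.instance Definition _ := GRing.isZmodule.Build tensor taddA taddC tadd0 taddN.

Fact tscaleA a b (x : tensor) : tscale a (tscale b x) = tscale (a * b) x.
Proof. by apply: tensor_ext => U f bf; rewrite !tliftZ // scalerA. Qed.
Fact tscale1 : left_id 1 tscale.
Proof. by move=> x; apply: tensor_ext => U f bf; rewrite tliftZ // scale1r. Qed.
Fact tscaleDr : right_distributive tscale +%R.
Proof.
move=> c x y; apply: tensor_ext => U f bf.
by rewrite tliftZ // !tliftD // !tliftZ // scalerDr.
Qed.
Fact tscaleDl (x : tensor) : {morph tscale^~ x : a b / a + b >-> tadd a b}.
Proof.
move=> a b; apply: tensor_ext => U f bf.
by rewrite tliftD // !tliftZ // scalerDl.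
Qed.
HB.instance Definition _ :=
  GRing.Zmodule_isLmodule.Build K tensor tscaleA tscale1 tscaleDr tscaleDl.

Definition tens (v : V) (w : W) : tensor := \pi_tensor [:: (v, w)].

Lemma tlift_linear U (f : V -> W -> U) : bilinear_map f -> linear (tlift f).
Proof. by move=> bf c x y; rewrite tliftD // tliftZ. Qed.

Lemma tlift_tens U (f : V -> W -> U) v w : bilinear_map f -> tlift f (tens v w) = f v w.
Proof. by move=> bf; rewrite tlift_pi // /tsum big_seq1. Qed.

Lemma tens_bilinear : bilinear_map tens.
Proof.
split=> [v|w] c x y; apply: tensor_ext => U f bf;
  rewrite tliftD // tliftZ // !tlift_tens //.
  exact: (bf.1 v).
exact: (bf.2 w).
Qed.

Lemma tensorE (x : tensor) : exists s : seq (V * W), x = \sum_(p <- s) tens p.1 p.2.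
Proof.
exists (repr x); apply: tensor_ext => U f bf.
rewrite {1}/tlift; elim: (repr x) => [|p s IH].
  by rewrite big_nil (tlift0 bf) /tsum big_nil.
rewrite big_cons (tliftD bf) tlift_tens // /tsum big_cons.
by congr (_ + _); rewrite -IH.
Qed.

End Tensor.

Definition tmap (K : fieldType) (V W V' W' : lmodType K) (g : V -> V')
    (h : W -> W') : tensor V W -> tensor V' W' :=
  tlift (fun v w => tens (g v) (h w)).

(* For subspaces P of V and I of W, the image of P (x) I in V (x) W; over a
   field P (x) I -> V (x) W is injective. *)
Definition tmem (K : fieldType) (V W : lmodType K) (P : set V) (I : set W) :
    set (tensor V W) :=
  [set x | exists s : seq (V * W),
     (forall p, p \in s -> P p.1 /\ I p.2) /\ x = \sum_(p <- s) tens p.1 p.2].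

Section Multilinear.
Variables (K : fieldType) (V W U : lmodType K).

Definition multilinear (F : seq V -> U) : Prop :=
  forall s1 s2, linear (fun v => F (s1 ++ v :: s2)).

Definition multibilinear (F : seq (V * W) -> U) : Prop :=
  forall s1 s2, bilinear_map (fun v w => F (s1 ++ (v, w) :: s2)).

Fixpoint mlift (F : seq (V * W) -> U) (xs : seq (tensor V W)) : U :=
  if xs is x :: xs' then
    tlift (fun v w => mlift (fun c => F ((v, w) :: c)) xs') x
  else F [::].

End Multilinear.

Lemma linear_comp (K : fieldType) (V W U : lmodType K) (g : W -> U) (f : V -> W) :
  linear g -> linear f -> linear (g \o f).
Proof. by move=> gl fl a x y; rewrite /= fl gl. Qed.

Lemma linear_ext (K : fieldType) (V U : lmodType K) (f g : V -> U) :
  f =1 g -> linear f -> linear g.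
Proof. by move=> fg fl a x y; rewrite -!fg fl. Qed.

Lemma linear_add (K : fieldType) (V U : lmodType K) (f g : V -> U) :
  linear f -> linear g -> linear (fun v => f v + g v).
Proof. by move=> fl gl a x y; rewrite fl gl scalerDr addrACA. Qed.

Lemma linear_scale (K : fieldType) (V U : lmodType K) (f : V -> U) c :
  linear f -> linear (fun v => c *: f v).
Proof. by move=> fl a x y; rewrite fl scalerDr !scalerA mulrC. Qed.

Lemma linear_cst0 (K : fieldType) (V U : lmodType K) :
  linear (fun _ : V => 0 : U).
Proof. by move=> a x y; rewrite scaler0 addr0. Qed.

Lemma linear_sum (K : fieldType) (V U : lmodType K) I (r : seq I) (P : pred I)
    (f : I -> V -> U) :
  (forall i, P i -> linear (f i)) -> linear (fun v => \sum_(i <- r | P i) f i v).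
Proof.
move=> fl a x y; rewrite scaler_sumr -big_split /=.
by apply: eq_bigr => i Pi; rewrite fl.
Qed.

Lemma linear_map0 (K : fieldType) (V U : lmodType K) (f : V -> U) :
  linear f -> f 0 = 0.
Proof.
by move=> fl; have := fl (-1) 0 0; rewrite scaleN1r oppr0 addr0 scaleN1r addNr.
Qed.

Lemma linear_mapD (K : fieldType) (V U : lmodType K) (f : V -> U) :
  linear f -> {morph f : x y / x + y}.
Proof. by move=> fl x y; have := fl 1 x y; rewrite !scale1r. Qed.

Lemma linear_mapZ (K : fieldType) (V U : lmodType K) (f : V -> U) :
  linear f -> forall c, {morph f : x / c *: x}.
Proof.
by move=> fl c x; have := fl c x 0; rewrite (linear_map0 fl) !addr0.
Qed.

Lemma linear_map_sum (K : fieldType) (V U : lmodType K) (f : V -> U) I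
    (r : seq I) (P : pred I) (F : I -> V) :
  linear f -> f (\sum_(i <- r | P i) F i) = \sum_(i <- r | P i) f (F i).
Proof.
by move=> fl; apply: big_morph; [exact: linear_mapD | exact: linear_map0].
Qed.

Section TensorMaps.
Variables (K : fieldType).
Implicit Types V W U : lmodType K.

Lemma tlift_sum V W U (f : V -> W -> U) I (r : seq I) (P : pred I) F :
  bilinear_map f ->
  tlift f (\sum_(i <- r | P i) F i) = \sum_(i <- r | P i) tlift f (F i).
Proof. by move=> bf; rewrite (linear_map_sum _ _ _ (tlift_linear bf)). Qed.

Lemma linear_tensor_eq V W U (f g : tensor V W -> U) :
  linear f -> linear g -> (forall v w, f (tens v w) = g (tens v w)) -> f =1 g.
Proof.
move=> fl gl fg x; have [s ->] := tensorE x.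
by rewrite !linear_map_sum //; apply: eq_bigr => p _.
Qed.

Lemma tlift_comp V W U U' (f : V -> W -> U) (g : U -> U') x :
  bilinear_map f -> linear g -> g (tlift f x) = tlift (fun v w => g (f v w)) x.
Proof.
move=> bf gl; have bgf : bilinear_map (fun v w => g (f v w)).
  by split=> [v|w] a y z; rewrite ?(bf.1 v) ?(bf.2 w) gl.
have [s ->] := tensorE x; rewrite !tlift_sum // linear_map_sum //.
by apply: eq_bigr => p _; rewrite !tlift_tens.
Qed.

Lemma eq_tlift V W U (f g : V -> W -> U) x :
  (forall v w, f v w = g v w) -> tlift f x = tlift g x.
Proof. by move=> fg; apply: eq_bigr => p _. Qed.

Lemma tmap_bilinear V W V' W' (g : V -> V') (h : W -> W') :
  linear g -> linear h -> bilinear_map (fun v w => tens (g v) (h w)).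
Proof.
by move=> gl hl; split=> [v|w] a y z; rewrite ?gl ?hl ?(tens_bilinear _ _).1 ?(tens_bilinear _ _).2.
Qed.

Lemma tmap_linear V W V' W' (g : V -> V') (h : W -> W') :
  linear g -> linear h -> linear (tmap g h).
Proof. by move=> gl hl; apply: tlift_linear; exact: tmap_bilinear. Qed.

Lemma tmap_tens V W V' W' (g : V -> V') (h : W -> W') v w :
  linear g -> linear h -> tmap g h (tens v w) = tens (g v) (h w).
Proof. by move=> gl hl; rewrite /tmap tlift_tens //; exact: tmap_bilinear. Qed.

Lemma tlift_tmap V W V' W' U (f : V' -> W' -> U) (g : V -> V') (h : W -> W') x :
  linear g -> linear h -> bilinear_map f ->
  tlift f (tmap g h x) = tlift (fun v w => f (g v) (h w)) x.
Proof.
move=> gl hl bf; rewrite /tmap tlift_comp //; last exact: tlift_linear.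
  by apply: eq_tlift => v w; rewrite tlift_tens.
exact: tmap_bilinear.
Qed.

Lemma tmap_id V W (x : tensor V W) : tmap id id x = x.
Proof.
apply: linear_tensor_eq x; [exact: tmap_linear | by [] |].
by move=> v w; rewrite tmap_tens.
Qed.

Lemma tmap_comp V W V' W' V'' W'' (g : V -> V') (h : W -> W') (g' : V' -> V'')
    (h' : W' -> W'') x :
  linear g -> linear h -> linear g' -> linear h' ->
  tmap g' h' (tmap g h x) = tmap (g' \o g) (h' \o h) x.
Proof.
by move=> gl hl gl' hl'; rewrite {1}/tmap tlift_tmap //; exact: tmap_bilinear.
Qed.

Lemma eq_mlift V W U (F G : seq (V * W) -> U) xs : F =1 G -> mlift F xs = mlift G xs.
Proof.
elim: xs F G => [|x xs IH] F G FG /=; first exact: FG.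
by apply: eq_tlift => v w; apply: IH.
Qed.

Lemma multibilinear_cons V W U (F : seq (V * W) -> U) v w :
  multibilinear F -> multibilinear (fun c => F ((v, w) :: c)).
Proof. by move=> bF s1 s2; exact: (bF ((v, w) :: s1) s2). Qed.

Lemma mlift_addF V W U (F G : seq (V * W) -> U) a xs :
  mlift (fun c => a *: F c + G c) xs = a *: mlift F xs + mlift G xs.
Proof.
elim: xs F G => [|x xs IH] F G //=.
rewrite /tlift /tsum scaler_sumr -big_split; apply: eq_bigr => p _ /=.
by rewrite IH.
Qed.

Lemma mlift_cons_bilinear V W U (F : seq (V * W) -> U) xs :
  multibilinear F ->
  bilinear_map (fun v w => mlift (fun c => F ((v, w) :: c)) xs).
Proof.
move=> bF; split=> [v|w] a y z; rewrite -mlift_addF; apply: eq_mlift => c.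
  exact: (bF [::] c).1.
exact: (bF [::] c).2.
Qed.

Lemma mlift_multilinear V W U (F : seq (V * W) -> U) :
  multibilinear F -> multilinear (mlift F).
Proof.
move=> bF s1; elim: s1 F bF => [|x s1 IH] F bF s2 /=.
  by apply: tlift_linear; exact: mlift_cons_bilinear.
move=> a y z; rewrite /tlift /tsum scaler_sumr -big_split; apply: eq_bigr => p _ /=.
by rewrite (IH _ (multibilinear_cons _ _ bF) s2).
Qed.

Lemma mlift_comp V W U U' (F : seq (V * W) -> U) (g : U -> U') xs :
  multibilinear F -> linear g -> g (mlift F xs) = mlift (g \o F) xs.
Proof.
move=> bF gl; elim: xs F bF => [|x xs IH] F bF //=.
rewrite tlift_comp //; last exact: mlift_cons_bilinear.
by apply: eq_tlift => v w; rewrite IH //; exact: multibilinear_cons.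
Qed.

Lemma mlift_tmap V W V' W' U (F : seq (V' * W') -> U) (g : V -> V') (h : W -> W') xs :
  multibilinear F -> linear g -> linear h ->
  mlift F (map (tmap g h) xs) = mlift (fun c => F [seq (g p.1, h p.2) | p <- c]) xs.
Proof.
move=> bF gl hl; elim: xs F bF => [|x xs IH] F bF //=.
rewrite tlift_tmap //; last exact: mlift_cons_bilinear.
by apply: eq_tlift => v w; rewrite IH //; exact: multibilinear_cons.
Qed.

Lemma mlift_tens V W U (F : seq (V * W) -> U) (s : seq (V * W)) :
  multibilinear F -> mlift F [seq tens p.1 p.2 | p <- s] = F s.
Proof.
elim: s F => [|[v w] s IH] F bF //=.
rewrite tlift_tens; last exact: mlift_cons_bilinear.
by rewrite IH //; exact: multibilinear_cons.
Qed.

End TensorMaps.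

(* A Z-grading, given by the projections onto the homogeneous components. *)
Record grading (K : fieldType) (V : lmodType K) := Grading {
  gproj : int -> V -> V;
  gproj_linear : forall i, linear (gproj i);
  gproj_proj : forall i j v, gproj i (gproj j v) = if i == j then gproj j v else 0;
  gproj_sum : forall v, exists2 s : seq int, uniq s & v = \sum_(i <- s) gproj i v
}.

Section Grading.
Variables (K : fieldType) (V : lmodType K) (G : grading V).

Definition homog (i : int) : set V := [set v | gproj G i v = v].

(* The sum of the components of even (b = false) or odd (b = true) degree. *)
Definition parity (b : bool) (v : V) : V :=
  \sum_(i \in [set i : int | odd `|i|%N = b]) gproj G i v.

Lemma gproj_supp v : exists s : seq int, [/\ uniq s,
  (forall i, i \notin s -> gproj G i v = 0) & v = \sum_(i <- s) gproj G i v].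
Proof.
have [s us vE] := gproj_sum G v; exists s; split=> // i ins.
rewrite vE linear_map_sum; last exact: gproj_linear.
rewrite big_seq big1 // => j js; rewrite gproj_proj.
by case: eqP ins js => // -> /negP.
Qed.

Lemma gproj_fin v : exists2 s : seq int, uniq s &
  (forall i, i \notin s -> gproj G i v = 0).
Proof. by have [s [? ? _]] := gproj_supp v; exists s. Qed.

Lemma gproj_sumE v r : uniq r -> (forall i, i \notin r -> gproj G i v = 0) ->
  v = \sum_(i <- r) gproj G i v.
Proof.
move=> ur vr; have [s [us vs {1}->]] := gproj_supp v.
rewrite (bigfs _ us (P := predT)) ?(bigfs _ ur (P := predT)) // => i _.
  exact: vr.
exact: vs.
Qed.

Lemma parityE b v s : uniq s -> (forall i, i \notin s -> gproj G i v = 0) ->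
  parity b v = \sum_(i <- s | odd `|i|%N == b) gproj G i v.
Proof.
move=> us vs; rewrite /parity [RHS](bigfs _ us); last by move=> i _; exact: vs.
by apply: eq_fsbigl; apply/seteqP; split=> i /= /eqP.
Qed.

Lemma parity_linear b : linear (parity b).
Proof.
move=> a x y; have [s us xs] := gproj_fin x; have [s' us' ys] := gproj_fin y.
have H i : i \notin undup (s ++ s') -> gproj G i x = 0 /\ gproj G i y = 0.
  by rewrite mem_undup mem_cat negb_or => /andP[/xs ? /ys].
rewrite !(parityE b (undup_uniq (s ++ s'))).
- by apply: linear_sum => i _; exact: gproj_linear.
- by move=> i /H[].
- by move=> i /H[].
- by move=> i /H[h1 h2]; rewrite gproj_linear h1 h2 scaler0 addr0.
Qed.

(* Extends to arbitrary arguments, by multilinearity, an operation given on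
   homogeneous ones; its sign rules see only the parities of the degrees. *)
Fixpoint hlift (U : lmodType K) (F : seq (bool * V) -> U) (vs : seq V) : U :=
  if vs is v :: vs' then
    \sum_(b : bool) hlift (fun c => F ((b, parity b v) :: c)) vs'
  else F [::].

Lemma hlift_addF (U : lmodType K) (F F' : seq (bool * V) -> U) a vs :
  hlift (fun c => a *: F c + F' c) vs = a *: hlift F vs + hlift F' vs.
Proof.
elim: vs F F' => [|x vs IH] F F' //=.
by rewrite scaler_sumr -big_split; apply: eq_bigr => p _ /=; rewrite IH.
Qed.

Lemma eq_hlift (U : lmodType K) (F F' : seq (bool * V) -> U) vs :
  F =1 F' -> hlift F vs = hlift F' vs.
Proof.
elim: vs F F' => [|x vs IH] F F' e /=; first exact: e.
by apply: eq_bigr => b _; apply: IH.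
Qed.

Lemma hlift_multilinear (U : lmodType K) (F : seq (bool * V) -> U) :
  (forall b s1 s2, linear (fun v => F (s1 ++ (b, v) :: s2))) ->
  multilinear (hlift F).
Proof.
move=> bF s1; elim: s1 F bF => [|x s1 IH] F bF s2 /=.
  apply: linear_sum => b _ a y z; rewrite -hlift_addF; apply: eq_hlift => c.
  by rewrite parity_linear (bF b [::] c).
apply: linear_sum => b _; apply: IH => b' s1' s2'.
exact: (bF b' ((b, parity b x) :: s1')).
Qed.

Lemma parity_homog b i v : homog i v ->
  parity b v = if odd `|i|%N == b then v else 0.
Proof.
move=> hv; rewrite (@parityE b v [:: i]) // ?big_mkcond ?big_seq1 ?hv //.
by move=> j; rewrite inE -hv gproj_proj => /negPf->.
Qed.

Lemma hlift_homog (U : lmodType K) (F : seq (bool * V) -> U) (c : seq (int * V)) :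
  (forall b s1 s2, linear (fun v => F (s1 ++ (b, v) :: s2))) ->
  (forall p, p \in c -> homog p.1 p.2) ->
  hlift F [seq p.2 | p <- c] = F [seq (odd `|p.1|%N, p.2) | p <- c].
Proof.
elim: c F => [|[i v] c IH] F Fl hc //=.
have hi : homog i v by exact: (hc (i, v) (mem_head _ _)).
rewrite (bigD1 (odd `|i|%N)) //= [X in _ + X]big1 ?addr0 => [|b /negPf ib].
  rewrite IH => [|b s1 s2|p pc]; last by apply: hc; rewrite inE pc orbT.
    by rewrite (parity_homog _ hi) eqxx.
  exact: (Fl b (_ :: s1) s2).
rewrite (parity_homog _ hi) eq_sym ib IH => [|b' s1 s2|p pc].
- exact: (linear_map0 (Fl b [::] _)).
- exact: (Fl b' (_ :: s1) s2).
- by apply: hc; rewrite inE pc orbT.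
Qed.

End Grading.

Record dgla (K : fieldType) := Dgla {
  dgl_sort :> lmodType K;
  dgl_gr : grading dgl_sort;
  dgl_d : dgl_sort -> dgl_sort;
  dgl_br : dgl_sort -> dgl_sort -> dgl_sort;
  dgl_d_linear : linear dgl_d;
  dgl_br_bilinear : bilinear_map dgl_br;
  dgl_d_deg : forall i x, homog dgl_gr i x -> homog dgl_gr (i + 1) (dgl_d x);
  dgl_br_deg : forall i j x y, homog dgl_gr i x -> homog dgl_gr j y ->
    homog dgl_gr (i + j) (dgl_br x y);
  dgl_dd : forall x, dgl_d (dgl_d x) = 0;
  dgl_antisym : forall i j x y, homog dgl_gr i x -> homog dgl_gr j y ->
    dgl_br x y = - ((-1) ^ (i * j)) *: dgl_br y x;
  dgl_leibniz : forall i x y, homog dgl_gr i x ->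
    dgl_d (dgl_br x y) = dgl_br (dgl_d x) y + ((-1) ^ i) *: dgl_br x (dgl_d y);
  dgl_jacobi : forall i j x y z, homog dgl_gr i x -> homog dgl_gr j y ->
    dgl_br x (dgl_br y z) =
    dgl_br (dgl_br x y) z + ((-1) ^ (i * j)) *: dgl_br y (dgl_br x z)
}.

Record dgla_mor (K : fieldType) (L M : dgla K) := DglaMor {
  dgm_fun :> L -> M;
  dgm_linear : linear dgm_fun;
  dgm_deg : forall i x, homog (dgl_gr L) i x -> homog (dgl_gr M) i (dgm_fun x);
  dgm_d : forall x, dgm_fun (dgl_d x) = dgl_d (dgm_fun x);
  dgm_br : forall x y, dgm_fun (dgl_br x y) = dgl_br (dgm_fun x) (dgm_fun y)
}.

Definition is_ideal (R : comNzRingType) (I : set R) : Prop :=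
  [/\ I 0, (forall x y, I x -> I y -> I (x + y)) & (forall a x, I x -> I (a * x))].

Definition nonunits (R : comNzRingType) : set R :=
  [set x | ~ exists y, x * y = 1].

Record art (K : fieldType) := Art {
  art_sort :> comAlgType K;
  (* art_sort is a local ring, whose maximal ideal consists of the nonunits *)
  art_local : is_ideal (@nonunits art_sort);
  (* K -> A / m_A is onto *)
  art_residue : forall a : art_sort, exists c : K, nonunits (a - c%:A);
  art_artinian : forall I : nat -> set art_sort,
    (forall n, is_ideal (I n)) -> (forall n, I n.+1 `<=` I n)%classic ->
    exists N, forall n, (N <= n)%N -> I n = I N
}.

Definition maxid (K : fieldType) (A : art K) : set A := @nonunits A.

Lemma lrmorphism_maxid (K : fieldType) (A B : art K) (f : {lrmorphism A -> B}) a :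
  maxid a -> maxid (f a).
Proof.
move=> ma [b fab]; have [c mc] := art_residue (f a).
have c0 : c != 0.
  apply/eqP => c0; apply: mc; exists b.
  by rewrite c0 scale0r subr0.
have : ~ nonunits (a - c%:A).
  move=> h; have [_ hD hM] := art_local A.
  have : nonunits (c%:A : A).
    rewrite -[c%:A](subrK a) addrC; apply: hD ma _.
    by rewrite -opprB -mulN1r; exact: hM.
  by apply; exists (c^-1%:A); rewrite -scalerAl mul1r scalerA divff ?scale1r.
move=> /contrapT[y ay]; apply: mc; exists (f y).
have -> : c%:A = f c%:A by rewrite linearZ_LR /= rmorph1.
by rewrite -rmorphB -rmorphM ay rmorph1.
Qed.

(* The operations underlying an L-infinity structure: lf_sort carries the
   grading of the shifted space g[1], and lf_op [:: v_1; ..; v_n] is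
   q_n(v_1, .., v_n) for n >= 1.  Maurer-Cartan elements and their homotopies
   are defined from these data alone. *)
Record linf (K : fieldType) := Linf {
  lf_sort :> lmodType K;
  lf_gr : grading lf_sort;
  lf_op : seq lf_sort -> lf_sort;
  lf_multilinear : multilinear lf_op
}.

Section ScalarExtension.
Variables (K : fieldType) (A : art K).

(* A is in degree 0, so no sign arises. *)
Definition opA (g : linf K) : seq (tensor g A) -> tensor g A :=
  mlift (fun c => tens (lf_op [seq p.1 | p <- c]) (\prod_(p <- c) p.2)).

Definition MC_set (g : linf K) : set (tensor g A) :=
  [set x | tmem (homog (lf_gr g) 0) (@maxid K A) x /\
    sums_to (fun n => ((n.+1)`!%:R)^-1 *: opA (nseq n.+1 x)) 0].

Definition dA (N : dgla K) : tensor N A -> tensor N A := tmap (@dgl_d K N) id.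

Definition brA (N : dgla K) (x y : tensor N A) : tensor N A :=
  tlift (fun u a => tlift (fun v b => tens (dgl_br u v) (a * b)) y) x.

End ScalarExtension.

(* Polynomial forms K[t,dt]: (p, q) stands for p + q dt. *)
Section Forms.
Variable K : fieldType.

Definition forms : lmodType K := ({poly K} * {poly K})%type.
Implicit Types r s : forms.

Definition fone : forms := (1, 0).
Definition fmul r s : forms := (r.1 * s.1, r.1 * s.2 + r.2 * s.1).
Definition fdiff r : forms := (0, r.1^`()).
Definition fpart (b : bool) r : forms := if b then (0, r.2) else (r.1, 0).
Definition feval (a : K) r : K := r.1.[a].

Lemma fmul_bilinear : bilinear_map (fmul : forms -> forms -> forms).
Proof.
split=> [r|r] a s s'; rewrite /fmul; congr pair => /=.
- by rewrite mulrDr -scalerAr.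
- by rewrite !mulrDr -!scalerAr scalerDr addrACA.
- by rewrite mulrDl -scalerAl.
- by rewrite !mulrDl -!scalerAl scalerDr addrACA.
Qed.

Lemma fdiff_linear : linear (fdiff : forms -> forms).
Proof.
by move=> a r s; rewrite /fdiff; congr pair => /=; rewrite ?scaler0 ?addr0 // linearP.
Qed.

Lemma fpart_linear b : linear (fpart b : forms -> forms).
Proof. by case: b => a r s; congr pair => /=; rewrite ?scaler0 ?addr0. Qed.

Lemma feval_linear a : linear (feval a : forms -> K^o).
Proof. by move=> c r s; rewrite /feval /= hornerD hornerZ. Qed.

End Forms.

Section PolynomialExtension.
Variables (K : fieldType) (V : lmodType K) (G : grading V).
Local Notation VF := (tensor V (forms K)).

Definition form_proj (k : int) : VF -> VF := tlift (fun v r =>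
  tens (gproj G k v) (fpart false r) + tens (gproj G (k - 1) v) (fpart true r)).

(* Each factor is decomposed into its even and odd parts. *)
Fixpoint bihlift (U : lmodType K)
    (F : seq ((bool * V) * (bool * forms K)) -> U) (c : seq (V * forms K)) : U :=
  if c is (v, r) :: c' then
    \sum_(b : bool) \sum_(e : bool)
      bihlift (fun c => F (((b, parity G b v), (e, fpart e r)) :: c)) c'
  else F [::].

(* The exponent of the sign of v_1 r_1 .. v_n r_n -> v_1 .. v_n r_1 .. r_n,
   each r_i being moved past the v_j with i < j. *)
Definition koszul_exp (vs rs : seq bool) : nat :=
  \sum_(j < size vs) \sum_(i < j) (nth false rs i && nth false vs j).

Definition form_op (q : seq V -> V) (xs : seq VF) : VF :=
  mlift (bihlift (fun c =>
    (-1) ^+ koszul_exp [seq p.1.1 | p <- c] [seq p.2.1 | p <- c] *: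
    tens (q [seq p.1.2 | p <- c])
         (foldr (@fmul K) (fone K) [seq p.2.2 | p <- c]))) xs
  + (if xs is [:: x] then
       tlift (fun v r => \sum_(b : bool)
         (-1) ^+ b *: tens (parity G b v) (fdiff r)) x
     else 0).

Definition form_eval (a : K) : VF -> V := tlift (fun v r => feval a r *: v).

End PolynomialExtension.

Section PolynomialExtensionTheory.
Variables (K : fieldType) (V : lmodType K) (G : grading V).
Local Notation VF := (tensor V (forms K)).

Lemma form_proj_bilinear k : bilinear_map (fun (v : V) (r : forms K) =>
  tens (gproj G k v) (fpart false r) + tens (gproj G (k - 1) v) (fpart true r)).
Proof.
split=> [v|r]; apply: linear_add.
- exact: linear_comp ((tens_bilinear _ _).1 _) (fpart_linear false).
- exact: linear_comp ((tens_bilinear _ _).1 _) (fpart_linear true).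
- exact: linear_comp ((tens_bilinear _ _).2 _) (gproj_linear G k).
- exact: linear_comp ((tens_bilinear _ _).2 _) (gproj_linear G (k - 1)).
Qed.

Lemma form_proj_linear k : linear (form_proj G k).
Proof. exact: tlift_linear (form_proj_bilinear k). Qed.

Lemma tens0r (W : lmodType K) (v : V) : tens v (0 : W) = 0.
Proof. exact: linear_map0 ((tens_bilinear V W).1 v). Qed.

Lemma tens0l (W : lmodType K) (w : W) : tens (0 : V) w = 0.
Proof. exact: linear_map0 ((tens_bilinear V W).2 w). Qed.

Lemma form_proj_tens k v r : form_proj G k (tens v r) =
  tens (gproj G k v) (fpart false r) + tens (gproj G (k - 1) v) (fpart true r).
Proof. by rewrite /form_proj tlift_tens //; exact: form_proj_bilinear. Qed.

Lemma fpart_fpart b b' (r : forms K) :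
  fpart b (fpart b' r) = if b == b' then fpart b r else 0.
Proof. by case: b b' => -[] //=. Qed.

Fact form_proj_proj i j x :
  form_proj G i (form_proj G j x) = if i == j then form_proj G j x else 0.
Proof.
have il := form_proj_linear i; have jl := form_proj_linear j.
have gl : linear (fun x => if i == j then form_proj G j x else 0).
  by case: eqP => _ //; exact: linear_cst0.
apply: (linear_tensor_eq (linear_comp il jl) gl) => v r /=.
rewrite form_proj_tens (linear_mapD il) !form_proj_tens !fpart_fpart /=.
rewrite !tens0r addr0 add0r !gproj_proj (inj_eq (addIr _)).
by case: (i == j); rewrite ?tens0l ?addr0.
Qed.

Let good (x : VF) := exists2 s : seq int, uniq s &
  (forall i, i \notin s -> form_proj G i x = 0) /\ x = \sum_(i <- s) form_proj G i x.

Let goodP (x : VF) (s : seq int) : (forall i, i \notin s -> form_proj G i x = 0) ->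
  uniq s -> x = \sum_(i <- s) form_proj G i x ->
  forall t, uniq t -> {subset s <= t} -> x = \sum_(i <- t) form_proj G i x.
Proof.
move=> xs us {1}-> t ut st; rewrite (bigfs _ us (P := predT)); last first.
  by move=> i _; exact: xs.
rewrite (bigfs _ ut (P := predT)) // => i _ it; apply: xs.
by apply: contra it => /st.
Qed.

Let good_form x : good x.
Proof.
have goodD y z : good y -> good z -> good (y + z).
  move=> [s us [ys ysum]] [t ut [zt zsum]].
  exists (undup (s ++ t)); first exact: undup_uniq.
  split=> [i|].
    rewrite mem_undup mem_cat negb_or (linear_mapD (form_proj_linear i)).
    by move=> /andP[/ys -> /zt ->]; rewrite addr0.
  under eq_bigr do rewrite (linear_mapD (form_proj_linear _)).
  rewrite big_split /=; congr (_ + _).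
    apply: (goodP ys us ysum); first exact: undup_uniq.
    by move=> i; rewrite mem_undup mem_cat => ->.
  apply: (goodP zt ut zsum); first exact: undup_uniq.
  by move=> i; rewrite mem_undup mem_cat => ->; rewrite orbT.
have good0 : good 0.
  exists [::] => //; split=> [i _|]; last by rewrite big_nil.
  exact: linear_map0 (form_proj_linear i).
have good1 i v w b : good (tens (gproj G i v) (fpart b w)).
  exists [:: i + b%:Z] => //; rewrite ?big_seq1.
  have E k : form_proj G k (tens (gproj G i v) (fpart b w)) =
      if k == i + b%:Z then tens (gproj G i v) (fpart b w) else 0.
    rewrite form_proj_tens !fpart_fpart !gproj_proj.
    case: b => /=; rewrite tens0r ?addr0 ?add0r -?subr_eq ?subr0.
      by case: eqP => // _; rewrite tens0l.
    by case: eqP => // _; rewrite tens0l.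
  split=> [k|]; last by rewrite E eqxx.
  by rewrite inE E => /negPf->.
have [s ->] := tensorE x; apply: big_ind => // -[v w] _ /=.
have [t ut ->] := gproj_sum G v.
rewrite (linear_map_sum _ _ _ ((tens_bilinear _ _).2 w)) /=; apply: big_ind => // i _.
have -> : w = fpart false w + fpart true w.
  by case: w => p q; congr pair => /=; rewrite ?addr0 ?add0r.
rewrite (linear_mapD ((tens_bilinear _ _).1 _)).
exact: goodD.
Qed.

Fact form_proj_sum x : exists2 s : seq int, uniq s & x = \sum_(i <- s) form_proj G i x.
Proof. by have [s us [_ xs]] := good_form x; exists s. Qed.

Lemma bihlift_addF (U : lmodType K)
    (F F' : seq ((bool * V) * (bool * forms K)) -> U) a c :
  bihlift G (fun c => a *: F c + F' c) c = a *: bihlift G F c + bihlift G F' c.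
Proof.
elim: c F F' => [|[v r] c IH] F F' //=.
rewrite scaler_sumr -big_split; apply: eq_bigr => b _ /=.
by rewrite scaler_sumr -big_split; apply: eq_bigr => e _ /=; rewrite IH.
Qed.

Lemma eq_bihlift (U : lmodType K) (F F' : seq ((bool * V) * (bool * forms K)) -> U) c :
  F =1 F' -> bihlift G F c = bihlift G F' c.
Proof.
elim: c F F' => [|[v r] c IH] F F' e /=; first exact: e.
by apply: eq_bigr => b _; apply: eq_bigr => b' _; apply: IH.
Qed.

Lemma bihlift_multibilinear (U : lmodType K)
    (F : seq ((bool * V) * (bool * forms K)) -> U) :
  (forall b e s1 s2,
     bilinear_map (fun v r => F (s1 ++ ((b, v), (e, r)) :: s2))) ->
  multibilinear (bihlift G F).
Proof.
move=> bF s1; elim: s1 F bF => [|[v0 r0] s1 IH] F bF s2.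
  split=> [v|r] /=; apply: linear_sum => b _; apply: linear_sum => e _ a y z.
    rewrite -bihlift_addF; apply: eq_bihlift => c.
    by rewrite fpart_linear ((bF b e [::] c).1).
  rewrite -bihlift_addF; apply: eq_bihlift => c.
  by rewrite parity_linear ((bF b e [::] c).2).
split=> [v|r] /=; apply: linear_sum => b _; apply: linear_sum => e _.
  apply: (IH _ _ s2).1 => b' e' s1' s2'; exact: (bF b' e' (_ :: s1')).
apply: (IH _ _ s2).2 => b' e' s1' s2'; exact: (bF b' e' (_ :: s1')).
Qed.

Lemma foldr_fmul_linear (s1 s2 : seq (forms K)) :
  linear (fun r => foldr (@fmul K) (fone K) (s1 ++ r :: s2)).
Proof.
elim: s1 => [|r0 s1 IH] /=; first exact: (fmul_bilinear K).2.
exact: linear_comp ((fmul_bilinear K).1 r0) IH.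
Qed.

Fact form_op_multilinear (q : seq V -> V) :
  multilinear q -> multilinear (form_op G q).
Proof.
move=> ql s1 s2; apply: linear_add.
  apply: mlift_multilinear; apply: bihlift_multibilinear => b e t1 t2.
  split=> [v|r].
    apply: (@linear_ext _ _ _ (fun r => (-1) ^+ koszul_exp
      [seq p.1.1 | p <- t1 ++ ((b, v), (e, 0)) :: t2]
      [seq p.2.1 | p <- t1 ++ ((b, v), (e, 0 : forms K)) :: t2] *:
      tens (q [seq p.1.2 | p <- t1 ++ ((b, v), (e, 0 : forms K)) :: t2])
       (foldr (@fmul K) (fone K)
         ([seq p.2.2 | p <- t1] ++ r :: [seq p.2.2 | p <- t2])))).
      by move=> r; rewrite !map_cat.
    apply: linear_scale.
    exact: linear_comp ((tens_bilinear _ _).1 _) (foldr_fmul_linear _ _).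
  apply: (@linear_ext _ _ _ (fun v => (-1) ^+ koszul_exp
      [seq p.1.1 | p <- t1 ++ ((b, 0), (e, r)) :: t2]
      [seq p.2.1 | p <- t1 ++ ((b, 0 : V), (e, r)) :: t2] *:
      tens (q ([seq p.1.2 | p <- t1] ++ v :: [seq p.1.2 | p <- t2]))
       (foldr (@fmul K) (fone K)
         [seq p.2.2 | p <- t1 ++ ((b, 0 : V), (e, r)) :: t2]))).
    by move=> v; rewrite !map_cat.
  apply: linear_scale.
  exact: linear_comp ((tens_bilinear _ _).2 _) (ql _ _).
case: s1 => [|x s1]; last first.
  by case: s1 => [|y s1] /=; exact: linear_cst0.
case: s2 => [|y s2] /=; last exact: linear_cst0.
apply: tlift_linear; split=> [v|r]; apply: linear_sum => b _; apply: linear_scale.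
  exact: linear_comp ((tens_bilinear _ _).1 _) (@fdiff_linear K).
exact: linear_comp ((tens_bilinear _ _).2 _) (parity_linear G b).
Qed.

Lemma form_eval_bilinear a :
  bilinear_map (fun (v : V) (r : forms K) => feval a r *: v).
Proof.
split=> [v|r] c y z; last by rewrite scalerDr !scalerA mulrC.
by rewrite feval_linear scalerDl scalerA.
Qed.

Lemma form_eval_linear a : linear (form_eval a : VF -> V).
Proof. exact: tlift_linear (form_eval_bilinear a). Qed.

End PolynomialExtensionTheory.

Definition form_grading (K : fieldType) (V : lmodType K) (G : grading V) :
    grading (tensor V (forms K)) :=
  Grading (form_proj_linear G) (form_proj_proj G) (form_proj_sum G).

(* g[t,dt] *)
Definition form_linf (K : fieldType) (g : linf K) : linf K :=
  @Linf K (tensor g (forms K)) (form_grading (lf_gr g))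
    (form_op (lf_gr g) (@lf_op K g))
    (form_op_multilinear (lf_gr g) (@lf_multilinear K g)).

Section Bernoulli.
Variable K : fieldType.

(* The list of the B_k / k!, k < n, obtained by comparing the coefficients of
   x^n in ((e^x - 1) / x) * \sum_k B_k x^k / k! = 1. *)
Fixpoint bernoulli_seq (n : nat) : seq K :=
  if n is n'.+1 then
    let s := bernoulli_seq n' in
    rcons s ((n' == 0)%:R - \sum_(k < n') s`_k / ((n'.+1 - k)`!)%:R)
  else [::].

Definition bernoulli (n : nat) : K := n`!%:R * (bernoulli_seq n.+1)`_n.

Lemma size_bernoulli_seq n : size (bernoulli_seq n) = n.
Proof. by elim: n => //= n IH; rewrite size_rcons IH. Qed.

Lemma nth_bernoulli_seq n k :
  (k < n)%N -> (bernoulli_seq n)`_k = (bernoulli_seq k.+1)`_k.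
Proof.
elim: n => // n IH; rewrite ltnS leq_eqVlt => /predU1P[->//|kn].
by rewrite [LHS]/= nth_rcons size_bernoulli_seq kn IH.
Qed.

Lemma bernoulli_gf n : [pchar K] =i pred0 ->
  \sum_(k < n.+1) bernoulli k / k`!%:R / ((n.+1 - k)`!)%:R = (n == 0)%:R.
Proof.
move=> /pcharf0P K0.
have E k : bernoulli k / k`!%:R = (bernoulli_seq k.+1)`_k.
  by rewrite /bernoulli mulrAC divff ?mul1r // K0 -lt0n fact_gt0.
under eq_bigr do rewrite E.
rewrite big_ord_recr /= nth_rcons size_bernoulli_seq ltnn eqxx subSnn divr1.
rewrite addrC -[RHS]addr0 -addrA; congr (_ + _); rewrite addrC.
apply/eqP; rewrite subr_eq0; apply/eqP.
by apply: eq_bigr => k _; rewrite -(nth_bernoulli_seq (ltn_ord k)).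
Qed.

End Bernoulli.

Section Cone.
Variables (K : fieldType) (L M : dgla K) (chi : dgla_mor L M).

(* C_chi[1]: its component of degree i is L^(i+1) x M^i. *)
Definition cone_space : lmodType K := (L * M)%type.
Local Notation C := cone_space.

Definition cone_proj (i : int) (v : C) : C :=
  (gproj (dgl_gr L) (i + 1) v.1, gproj (dgl_gr M) i v.2).

Fact cone_proj_linear i : linear (cone_proj i).
Proof. by move=> a x y; congr pair; rewrite /= gproj_linear. Qed.

Fact cone_proj_proj i j v :
  cone_proj i (cone_proj j v) = if i == j then cone_proj j v else 0.
Proof.
by rewrite /cone_proj /= !gproj_proj (inj_eq (addIr _)); case: (i == j).
Qed.

Fact cone_proj_sum v :
  exists2 s : seq int, uniq s & v = \sum_(i <- s) cone_proj i v.
Proof.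
have [s us ls] := gproj_fin (dgl_gr L) v.1.
have [t ut mt] := gproj_fin (dgl_gr M) v.2.
pose r := undup ([seq i - 1 | i <- s] ++ t).
have ur : uniq r by exact: undup_uniq.
have rl i : i \notin r -> gproj (dgl_gr L) (i + 1) v.1 = 0.
  rewrite mem_undup mem_cat negb_or => /andP[ir _]; apply: ls.
  by apply: contra ir => ir; apply/mapP; exists (i + 1); rewrite ?addrK.
have rm i : i \notin r -> gproj (dgl_gr M) i v.2 = 0.
  by rewrite mem_undup mem_cat negb_or => /andP[_ /mt].
exists r => //; rewrite [LHS]surjective_pairing [RHS]surjective_pairing.
rewrite !raddf_sum /=; congr pair; last exact: gproj_sumE.
rewrite -(big_map (fun i => i + 1) predT (fun i => gproj (dgl_gr L) i v.1)).
apply: gproj_sumE; first by rewrite map_inj_uniq //; exact: addIr.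
move=> i ir; rewrite -[i](subrK 1) rl //; apply: contra ir => ir.
by apply/mapP; exists (i - 1); rewrite ?subrK.
Qed.

Definition cone_grading : grading C :=
  Grading cone_proj_linear cone_proj_proj cone_proj_sum.

(* In the formulas below the Boolean e stands for the parity of the degree
   of v = (l, m) in C_chi[1], which is that of m in M; the degree of l in L is
   then of parity ~~ e. *)

Definition cone_op1 (v : C) : C := (- dgl_d v.1, - chi v.1 + dgl_d v.2).

(* <m (x) l>_2 *)
Definition cone_ml (e : bool) (m : M) (l : L) : M :=
  ((-1) ^+ e.+1 / 2%:R) *: dgl_br m (chi l).

(* v_(s 0) o .. o v_(s (n-1)) = koszul_sign e s *: v_0 o .. o v_(n-1) *)
Definition koszul_sign (n : nat) (e : 'I_n -> bool) (s : 'S_n) : K :=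
  \prod_(i < n) \prod_(j < n | (i < j)%N && (s j < s i)%N)
    (-1) ^+ (e (s i) && e (s j)).

(* <m_0 o .. o m_(n-1) (x) l>_(n+1) for n >= 2 *)
Definition cone_mml (n : nat) (e : 'I_n -> bool) (m : 'I_n -> M) (l : L) : M :=
  (- (-1) ^+ (\sum_(i < n) e i)%N * (bernoulli K n / n`!%:R)) *:
  \sum_(s : 'S_n) koszul_sign e s *:
    foldr (fun i z => dgl_br (m (s i)) z) (chi l) (enum 'I_n).

(* The M-component of <v_0 o .. o v_n>_(n+1) for n >= 2: by multilinearity only
   the terms with exactly one entry, say v_j, replaced with its component l_j
   and the others with their components m_i contribute; the sign is that of
   moving v_j to the last position. *)
Definition cone_high (n : nat) (e : nat -> bool) (v : nat -> C) : M :=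
  \sum_(j < n.+1)
    (-1) ^+ (\sum_(k < n.+1 | (j < k)%N) (e j && e k))%N *:
    cone_mml (fun i : 'I_n => e (lift j i)) (fun i => (v (lift j i)).2) (v j).1.

Definition cone_homog (c : seq (bool * C)) : C :=
  match c with
  | [::] => 0
  | [:: (_, v)] => cone_op1 v
  | [:: (e1, v1); (e2, v2)] =>
      ((-1) ^+ (~~ e1) *: dgl_br v1.1 v2.1,
       cone_ml e1 v1.2 v2.1 + (-1) ^+ (e1 && e2) *: cone_ml e2 v2.2 v1.1)
  | _ => (0, cone_high (size c).-1 (fun i => (nth (false, 0) c i).1)
                                   (fun i => (nth (false, 0) c i).2))
  end.

Definition cone_op : seq C -> C := hlift cone_grading cone_homog.

Lemma foldr_br_linear n (V : lmodType K) (x : V -> 'I_n -> M) i0 z (s : seq 'I_n) :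
  uniq s -> i0 \in s -> linear (x^~ i0) ->
  (forall i, i != i0 -> forall v v', x v i = x v' i) ->
  linear (fun v => foldr (fun i z => dgl_br (x v i) z) z s).
Proof.
move=> + + xl xc; elim: s => //= i s IH /andP[is_ us].
rewrite inE => /predU1P[i0i|i0s].
  have E v : foldr (fun i z => dgl_br (x v i) z) z s =
             foldr (fun i z => dgl_br (x 0 i) z) z s.
    elim: s is_ {IH us} => //= j s IH; rewrite inE negb_or => /andP[ij js].
    by rewrite IH // (xc j _ v 0) // i0i eq_sym.
  apply: (@linear_ext _ _ _ (fun v =>
      dgl_br (x v i) (foldr (fun i z => dgl_br (x 0 i) z) z s))).
    by move=> v; rewrite E.
  by apply: (linear_comp ((dgl_br_bilinear M).2 _)); rewrite -i0i.
have ii0 : i != i0 by apply: contraNneq is_ => ->.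
apply: (@linear_ext _ _ _ (fun v =>
    dgl_br (x 0 i) (foldr (fun i z => dgl_br (x v i) z) z s))).
  by move=> v; rewrite (xc i ii0 v 0).
exact: linear_comp ((dgl_br_bilinear M).1 _) (IH us i0s).
Qed.

Lemma foldr_br_linear0 n (x : 'I_n -> M) (s : seq 'I_n) :
  linear (fun z => foldr (fun i z => dgl_br (x i) z) z s).
Proof.
elim: s => [|i s IH] //=.
exact: linear_comp ((dgl_br_bilinear M).1 _) IH.
Qed.

Lemma linear_fst : linear (fst : C -> L). Proof. by []. Qed.
Lemma linear_snd : linear (snd : C -> M). Proof. by []. Qed.

Lemma cone_high_linear n e (w : nat -> C) k : (k < n.+1)%N ->
  linear (fun x => cone_high n e (fun i => if i == k then x else w i)).
Proof.
move=> kn; apply: linear_sum => j _; apply: linear_scale; apply: linear_scale.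
apply: linear_sum => s _; apply: linear_scale.
have [jk|jk] := eqVneq (Ordinal kn) j.
  have jk' : nat_of_ord j = k by rewrite -jk.
  apply: (@linear_ext _ _ _ (fun x : C => foldr
      (fun i z => dgl_br (w (lift j (s i))).2 z) (chi x.1) (enum 'I_n))).
    move=> x; rewrite jk' eqxx; congr (foldr _ (chi x.1) _).
    apply: funext => i; apply: funext => z; rewrite -jk'.
    by rewrite (_ : (_ == _) = false) //; apply/negP => /eqP/val_inj/eqP;
       rewrite eq_sym (negPf (neq_lift _ _)).
  apply: (linear_comp (foldr_br_linear0 (fun i => (w (lift j (s i))).2) _)).
  exact: linear_comp (dgm_linear chi) linear_fst.
have jk' : (nat_of_ord j == k) = false.
  by rewrite -(negPf jk) eq_sym; apply/eqP/eqP => [jE|<-//]; apply/val_inj.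
apply: (@linear_ext _ _ _ (fun x : C => foldr (fun i z => dgl_br
    (if lift j (s i) == k :> nat then x else w (lift j (s i))).2 z)
    (chi (w j).1) (enum 'I_n))).
  by move=> x; rewrite jk'.
have [i1 kE] : exists i1, Ordinal kn = lift j i1.
  by case: (unliftP j (Ordinal kn)) jk => [i1 ->|->]; [exists i1 | rewrite eqxx].
have kE' : k = lift j i1 by rewrite -kE.
apply: (@foldr_br_linear _ _ (fun x i =>
    (if lift j (s i) == k :> nat then x else w (lift j (s i))).2) ((s^-1)%g i1)).
- exact: enum_uniq.
- by rewrite mem_enum.
- by rewrite permKV kE' eqxx; exact: linear_snd.
- move=> i ii0 v v'; rewrite kE' val_eqE (inj_eq lift_inj).
  by case: eqP => // si; rewrite -si permK eqxx in ii0.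
Qed.

Lemma cone_homog_linear b s1 s2 :
  linear (fun v : C => cone_homog (s1 ++ (b, v) :: s2)).
Proof.
have inr_linear (f : C -> M) : linear f -> linear (fun v => (0, f v) : C).
  by move=> fl a x y; congr pair; rewrite ?fl //= scaler0 addr0.
have high : linear (fun v : C => (0, cone_high
    (size (s1 ++ (b, v) :: s2)).-1
    (fun i => (nth (false, 0) (s1 ++ (b, v) :: s2) i).1)
    (fun i => (nth (false, 0) (s1 ++ (b, v) :: s2) i).2)) : C).
  apply: inr_linear.
  apply: (@linear_ext _ _ _ (fun v => cone_high (size s1 + size s2)
    (fun i => (nth (false, 0 : C) (s1 ++ (b, 0) :: s2) i).1)
    (fun i => if i == size s1 then v
              else (nth (false, 0 : C) (s1 ++ (b, 0) :: s2) i).2))).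
    move=> v; rewrite size_cat /= addnS /=; congr cone_high; apply: funext => i;
      rewrite !nth_cat; case: ltngtP => [is1|is1|->]; rewrite ?subnn //.
      by case E: (i - size s1)%N => [|k] //=; move/eqP: E; rewrite subn_eq0 leqNgt is1.
    by case E: (i - size s1)%N => [|k] //=; move/eqP: E; rewrite subn_eq0 leqNgt is1.
  by apply: cone_high_linear; rewrite ltnS leq_addr.
case: s1 s2 high => [|[e1 x1] [|[e2 x2] [|[e5 x5] s1]]] [|[e3 x3] [|[e4 x4] s2]] //= _.
- move=> a x y; congr pair => /=.
    by rewrite dgl_d_linear opprD scalerN.
  by rewrite (dgm_linear chi) dgl_d_linear opprD scalerDr scalerN addrACA.
- move=> a x y; congr pair => /=; first by rewrite (dgl_br_bilinear L).2 scalerDr !scalerA mulrC.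
  rewrite /cone_ml (dgl_br_bilinear M).2 (dgm_linear chi) (dgl_br_bilinear M).1.
  by rewrite !scalerDr !scalerA addrACA; congr (_ *: _ + _ *: _ + _); rewrite mulrC // mulrA.
- move=> a x y; congr pair => /=; first by rewrite (dgl_br_bilinear L).1 scalerDr !scalerA mulrC.
  rewrite /cone_ml (dgl_br_bilinear M).2 (dgm_linear chi) (dgl_br_bilinear M).1.
  by rewrite !scalerDr !scalerA addrACA; congr (_ *: _ + _ *: _ + _); rewrite mulrC // mulrA.
Qed.

Lemma cone_high_mml n (e : nat -> bool) (v : nat -> C) :
  (forall j, (j < n)%N -> (v j).1 = 0) ->
  cone_high n e v =
  cone_mml (fun i : 'I_n => e i) (fun i : 'I_n => (v i).2) (v n).1.
Proof.
move=> v0; rewrite /cone_high big_ord_recr /= big1 ?add0r => [|j _].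
  rewrite big1 => [|k]; last by rewrite ltnNge -ltnS ltn_ord.
  rewrite expr0 scale1r; congr (@cone_mml n _ _ _); apply: funext => i;
    by rewrite /= /bump leqNgt ltn_ord add0n.
rewrite v0 //= /cone_mml (linear_map0 (dgm_linear chi)).
rewrite [X in _ *: (_ *: X)]big1 ?scaler0 // => s _.
rewrite (linear_map0 (foldr_br_linear0
  (fun i => (v (lift (widen_ord (leqnSn n) j) (s i))).2) _)).
by rewrite scaler0.
Qed.

Fact cone_op_multilinear : multilinear cone_op.
Proof. apply: hlift_multilinear; exact: cone_homog_linear. Qed.

End Cone.

(* C~(chi) *)
Definition cone_linf (K : fieldType) (L M : dgla K) (chi : dgla_mor L M) : linf K :=
  @Linf K (cone_space L M) (cone_grading L M) (cone_op chi)
    (cone_op_multilinear chi).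

Record functor (K : fieldType) := Functor {
  fobj :> art K -> Type;
  fmap : forall A B : art K, {lrmorphism A -> B} -> fobj A -> fobj B;
  fmap_id : forall (A : art K) (x : fobj A), fmap (idfun : {lrmorphism A -> A}) x = x;
  fmap_comp : forall (A B C : art K) (f : {lrmorphism A -> B}) (g : {lrmorphism B -> C})
    (x : fobj A), fmap (g \o f : {lrmorphism A -> C}) x = fmap g (fmap f x)
}.

Definition functor_iso (K : fieldType) (F G : functor K) : Prop :=
  exists phi : forall A : art K, F A -> G A,
    (forall A, bijective (phi A)) /\
    (forall (A B : art K) (f : {lrmorphism A -> B}) (x : F A),
       phi B (fmap f x) = fmap f (phi A x)).

Section Quotient.
Variables (X : Type) (R : X -> X -> Prop).

(* The elements of quot are the classes of the equivalence relation generated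
   by R, which are those of R itself when R is an equivalence relation. *)
Definition eqclass (x : X) : set X := [set y | clos_refl_sym_trans X R x y].
Definition quot : Type := {S : set X | exists x, S = eqclass x}.
Definition qcls (x : X) : quot := exist _ (eqclass x) (ex_intro _ x erefl).

Lemma quot_eq (S T : quot) : sval S = sval T -> S = T.
Proof.
by case: S T => [S hS] [T hT] /= ST; subst T; congr exist; exact: Prop_irrelevance.
Qed.

Lemma qcls_eq x y : qcls x = qcls y <-> clos_refl_sym_trans X R x y.
Proof.
split=> [[E]|xy].
  by have : eqclass y y by [exact: rst_refl]; rewrite -E.
apply: quot_eq; apply/seteqP; split=> z /= h.
  exact: rst_trans (rst_sym _ _ _ _ xy) h.
exact: rst_trans xy h.
Qed.

Lemma qcls_surj (S : quot) : exists x, S = qcls x.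
Proof. by case: S => S [x Sx]; exists x; exact: quot_eq. Qed.

End Quotient.

Section QuotientMap.
Variables (X Y : Type) (R : X -> X -> Prop) (R' : Y -> Y -> Prop) (f : X -> Y).
Hypothesis fR : forall x y, R x y -> R' (f x) (f y).

Lemma clos_map x y :
  clos_refl_sym_trans X R x y -> clos_refl_sym_trans Y R' (f x) (f y).
Proof.
elim=> [a b /fR ?|a|a b _ ?|a b c _ h1 _ h2].
- exact: rst_step.
- exact: rst_refl.
- exact: rst_sym.
- exact: rst_trans h1 h2.
Qed.

Fact quot_map_subproof (S : quot R) :
  exists y, [set z : Y | exists2 x, sval S x & clos_refl_sym_trans Y R' (f x) z]%classic
            = eqclass R' y.
Proof.
have [x ->] := qcls_surj S; exists (f x); apply/seteqP; split=> z /=.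
  by move=> [x' /clos_map h h']; exact: rst_trans h h'.
by exists x => //; exact: rst_refl.
Qed.

Definition quot_map (S : quot R) : quot R' := exist _ _ (quot_map_subproof S).

Lemma quot_map_cls x : quot_map (qcls R x) = qcls R' (f x).
Proof.
apply: quot_eq; apply/seteqP; split=> z /=.
  by move=> [x' /clos_map h h']; exact: rst_trans h h'.
by exists x => //; exact: rst_refl.
Qed.

End QuotientMap.

Section QuotientFunctor.
Variables (K : fieldType) (F : functor K) (R : forall A, F A -> F A -> Prop).
Hypothesis R_fmap : forall (A B : art K) (f : {lrmorphism A -> B}) (x y : F A),
  R x y -> R (fmap f x) (fmap f y).

Definition quot_functor_map (A B : art K) (f : {lrmorphism A -> B}) :
    quot (@R A) -> quot (@R B) := quot_map (R_fmap f).

Fact quot_functor_id (A : art K) (x : quot (@R A)) :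
  quot_functor_map (idfun : {lrmorphism A -> A}) x = x.
Proof.
by have [y ->] := qcls_surj x; rewrite /quot_functor_map quot_map_cls fmap_id.
Qed.

Fact quot_functor_comp (A B C : art K) (f : {lrmorphism A -> B})
    (g : {lrmorphism B -> C}) (x : quot (@R A)) :
  quot_functor_map (g \o f : {lrmorphism A -> C}) x =
  quot_functor_map g (quot_functor_map f x).
Proof.
by have [y ->] := qcls_surj x; rewrite /quot_functor_map !quot_map_cls fmap_comp.
Qed.

Definition quot_functor : functor K :=
  @Functor K (fun A => quot (@R A)) quot_functor_map
    quot_functor_id quot_functor_comp.

End QuotientFunctor.

Lemma sums_to_linear (K : fieldType) (V W : lmodType K) (f : V -> W) u s :
  linear f -> sums_to u s -> sums_to (fun n => f (u n)) (f s).
Proof.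
move=> fl [N h]; exists N => n /h <-.
by rewrite linear_map_sum.
Qed.

Section BaseChange.
Variables (K : fieldType).
Implicit Types (A B C : art K) (V : lmodType K).

Definition base_change V A B (f : {lrmorphism A -> B}) : tensor V A -> tensor V B :=
  tmap id f.

Lemma base_change_linear V A B (f : {lrmorphism A -> B}) :
  linear (base_change (V := V) f).
Proof. by apply: tmap_linear => //; exact: linearP. Qed.

Lemma base_change_id V A (x : tensor V A) :
  base_change (idfun : {lrmorphism A -> A}) x = x.
Proof. exact: tmap_id. Qed.

Lemma base_change_comp V A B C (f : {lrmorphism A -> B}) (g : {lrmorphism B -> C})
    (x : tensor V A) :
  base_change (g \o f : {lrmorphism A -> C}) x = base_change g (base_change f x).
Proof. by rewrite /base_change tmap_comp //; exact: linearP. Qed.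

Lemma base_change_tens V A B (f : {lrmorphism A -> B}) v a :
  base_change f (tens v a : tensor V A) = tens v (f a).
Proof. by rewrite /base_change tmap_tens //; exact: linearP. Qed.

Lemma base_change_tmem V A B (f : {lrmorphism A -> B}) P (x : tensor V A) :
  tmem P (@maxid K A) x -> tmem P (@maxid K B) (base_change f x).
Proof.
move=> [s [hs ->]]; exists [seq (p.1, f p.2) | p <- s]; split.
  by move=> _ /mapP[p /hs[Pp mp] ->]; split=> //=; exact: lrmorphism_maxid.
rewrite linear_map_sum; last exact: base_change_linear.
by rewrite big_map; apply: eq_bigr => p _; rewrite base_change_tens.
Qed.

Lemma base_change_tmap V (W : lmodType K) A B (f : {lrmorphism A -> B}) (g : V -> W)
    (x : tensor V A) :
  linear g -> base_change f (tmap g id x) = tmap g id (base_change f x).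
Proof.
by move=> gl; rewrite /base_change !tmap_comp //; exact: linearP.
Qed.

Lemma opA_multibilinear A (g : linf K) :
  multibilinear (fun c : seq (g * A) =>
    tens (lf_op [seq p.1 | p <- c]) (\prod_(p <- c) p.2)).
Proof.
move=> s1 s2; split=> [v|a].
  apply: (@linear_ext _ _ _ (fun a : A => tens
    (lf_op ([seq p.1 | p <- s1] ++ v :: [seq p.1 | p <- s2]))
    (\prod_(p <- s1) p.2 * (a * \prod_(p <- s2) p.2)))).
    by move=> a; rewrite map_cat big_cat big_cons.
  apply: (linear_comp ((tens_bilinear _ _).1 _)) => c x y.
  by rewrite mulrDl mulrDr -scalerAl -scalerAr.
apply: (@linear_ext _ _ _ (fun v => tens
    (lf_op ([seq p.1 | p <- s1] ++ v :: [seq p.1 | p <- s2]))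
    (\prod_(p <- s1) p.2 * (a * \prod_(p <- s2) p.2)))).
  by move=> v; rewrite map_cat big_cat big_cons.
exact: linear_comp ((tens_bilinear _ _).2 _) (lf_multilinear _ _).
Qed.

Lemma opA_base_change A B (f : {lrmorphism A -> B}) (g : linf K) xs :
  base_change f (@opA K A g xs) = opA (map (base_change f) xs).
Proof.
rewrite /opA mlift_comp; [|exact: opA_multibilinear|exact: base_change_linear].
rewrite mlift_tmap //; [|exact: opA_multibilinear|exact: linearP].
apply: eq_mlift => c /=; rewrite base_change_tens rmorph_prod big_map /=.
by rewrite -map_comp.
Qed.

Lemma brA_bilinear A (N : dgla K) : bilinear_map (@brA K A N).
Proof.
have b2 u a : bilinear_map (fun v b => tens (dgl_br u v) (a * b) : tensor N A).
  split=> [v|b].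
    apply: (linear_comp ((tens_bilinear _ _).1 _)) => c y z.
    by rewrite mulrDr -scalerAr.
  exact: linear_comp ((tens_bilinear _ _).2 _) ((dgl_br_bilinear N).1 u).
have b1 y : bilinear_map (fun u a =>
    tlift (fun v b => tens (dgl_br u v) (a * b) : tensor N A) y).
  have [s ->] := tensorE y; split=> [u|a].
    apply: (@linear_ext _ _ _ (fun a : A => \sum_(p <- s)
        (tens (dgl_br u p.1) (a * p.2) : tensor N A))).
      move=> a; rewrite tlift_sum //; apply: eq_bigr => p _.
      by rewrite tlift_tens.
    apply: linear_sum => p _; apply: (linear_comp ((tens_bilinear _ _).1 _)) => c z t.
    by rewrite mulrDl -scalerAl.
  apply: (@linear_ext _ _ _ (fun u : N => \sum_(p <- s)
      (tens (dgl_br u p.1) (a * p.2) : tensor N A))).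
    move=> u; rewrite tlift_sum //; apply: eq_bigr => p _.
    by rewrite tlift_tens.
  apply: linear_sum => p _.
  exact: linear_comp ((tens_bilinear _ _).2 _) ((dgl_br_bilinear N).2 p.1).
split=> [x|y]; last exact: tlift_linear.
have [s ->] := tensorE x.
apply: (@linear_ext _ _ _ (fun y : tensor N A => \sum_(p <- s)
    tlift (fun v b => tens (dgl_br p.1 v) (p.2 * b) : tensor N A) y)).
  move=> y; rewrite /brA tlift_sum //; apply: eq_bigr => p _.
  by rewrite tlift_tens.
by apply: linear_sum => p _; exact: tlift_linear.
Qed.

Lemma brA_tens A (N : dgla K) (u v : N) (a b : A) :
  brA (tens u a) (tens v b) = tens (dgl_br u v) (a * b).
Proof.
have b2 u' a' : bilinear_map (fun v b => tens (dgl_br u' v) (a' * b) : tensor N A).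
  split=> [v'|b'].
    apply: (linear_comp ((tens_bilinear _ _).1 _)) => c y z.
    by rewrite mulrDr -scalerAr.
  exact: linear_comp ((tens_bilinear _ _).2 _) ((dgl_br_bilinear N).1 u').
rewrite /brA tlift_tens; first by rewrite tlift_tens.
split=> [u'|a'].
  apply: (@linear_ext _ _ _ (fun a' : A => tens (dgl_br u' v) (a' * b) : tensor N A)).
    by move=> a'; rewrite tlift_tens.
  apply: (linear_comp ((tens_bilinear _ _).1 _)) => c y z.
  by rewrite mulrDl -scalerAl.
apply: (@linear_ext _ _ _ (fun u' : N => tens (dgl_br u' v) (a' * b) : tensor N A)).
  by move=> u'; rewrite tlift_tens.
exact: linear_comp ((tens_bilinear _ _).2 _) ((dgl_br_bilinear N).2 v).
Qed.

Lemma brA_base_change A B (f : {lrmorphism A -> B}) (N : dgla K) (x y : tensor N A) :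
  base_change f (brA x y) = brA (base_change f x) (base_change f y).
Proof.
have fl := @base_change_linear N A B f.
have [s ->] := tensorE x; have [t ->] := tensorE y.
rewrite (linear_map_sum _ _ _ ((brA_bilinear A N).1 _)) !(linear_map_sum _ _ _ fl).
rewrite (linear_map_sum _ _ _ ((brA_bilinear B N).1 _)); apply: eq_bigr => q _.
rewrite (linear_map_sum _ _ _ ((brA_bilinear A N).2 _)) !(linear_map_sum _ _ _ fl).
rewrite (linear_map_sum _ _ _ ((brA_bilinear B N).2 _)); apply: eq_bigr => p _.
by rewrite brA_tens !base_change_tens brA_tens rmorphM.
Qed.

End BaseChange.

Section DefLinf.
Variables (K : fieldType) (g : linf K).

Lemma MC_base_change (h : linf K) (A B : art K) (f : {lrmorphism A -> B}) x :
  @MC_set K A h x -> @MC_set K B h (base_change f x).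
Proof.
move=> [xm xs]; split; first exact: base_change_tmem.
have fl := @base_change_linear K h A B f.
have := sums_to_linear fl xs; rewrite (linear_map0 fl).
move=> [N hN]; exists N => n Nn; rewrite -[RHS](hN n Nn); apply: eq_bigr => k _.
by rewrite (linear_mapZ fl) opA_base_change map_nseq.
Qed.

Definition MC_obj (h : linf K) (A : art K) : Type := {x : tensor h A | MC_set x}.

Definition MC_map (h : linf K) (A B : art K) (f : {lrmorphism A -> B})
    (x : MC_obj h A) : MC_obj h B :=
  exist _ (base_change f (sval x)) (MC_base_change f (svalP x)).

Lemma MC_eq (h : linf K) (A : art K) (x y : MC_obj h A) : sval x = sval y -> x = y.
Proof.
by case: x y => [x hx] [y hy] /= xy; subst y; congr exist; exact: Prop_irrelevance.
Qed.

Fact MC_map_id (A : art K) (x : MC_obj g A) :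
  MC_map (idfun : {lrmorphism A -> A}) x = x.
Proof. by apply: MC_eq; exact: base_change_id. Qed.

Fact MC_map_comp (A B C : art K) (u : {lrmorphism A -> B}) (v : {lrmorphism B -> C})
    (x : MC_obj g A) :
  MC_map (v \o u : {lrmorphism A -> C}) x = MC_map v (MC_map u x).
Proof. by apply: MC_eq; exact: base_change_comp. Qed.

Definition MC : functor K := @Functor K (MC_obj g) (@MC_map g) MC_map_id MC_map_comp.

Definition homotopic (A : art K) (x y : MC A) : Prop :=
  exists z : MC_obj (form_linf g) A,
    tmap (form_eval 0) id (sval z) = sval x /\
    tmap (form_eval 1) id (sval z) = sval y.

Fact homotopic_fmap (A B : art K) (f : {lrmorphism A -> B}) (x y : MC A) :
  homotopic x y -> homotopic (fmap f x) (fmap f y).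
Proof.
move=> [z [zx zy]]; exists (MC_map f z) => /=.
by split; rewrite -[LHS](base_change_tmap f _ (form_eval_linear _)) ?zx ?zy.
Qed.

Definition Def_linf : functor K := quot_functor homotopic_fmap.

End DefLinf.

Section Gauge.
Variables (K : fieldType) (A : art K) (N : dgla K).
Implicit Types a x y z : tensor N A.

(* z = e^a * y; for a in N^0 (x) m_A the sum is finite since m_A is nilpotent. *)
Definition is_gauge a y z : Prop :=
  sums_to (fun n => ((n.+1)`!%:R)^-1 *: iter n (brA a) (brA a y - dA a)) (z - y).

(* The Baker-Campbell-Hausdorff series log(e^x e^y) = z_1 + z_2 + .., where z_n
   is homogeneous of degree n in (x, y).  The series Z(t) = log(e^(tx) e^(ty)) =
   \sum_n z_n t^n is the solution with Z(0) = 0 of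
     Z' = (ad Z / (e^(ad Z) - 1)) x + (ad Z / (1 - e^(- ad Z))) y
        = \sum_p (B_p / p!) (ad Z)^p (x + (-1)^p y),
   that is (n+1) z_(n+1) = \sum_p (B_p / p!) \sum_(k_1 + .. + k_p = n)
   [z_(k_1), .. [z_(k_p), x + (-1)^p y] ..].  Sequences of elements below are
   coefficient sequences of power series in t, and ad_series z is ad Z. *)
Definition ad_series (z u : nat -> tensor N A) (n : nat) : tensor N A :=
  \sum_(k < n.+1) brA (z k) (u (n - k)%N).

Definition bch_next x y (z : nat -> tensor N A) (n : nat) : tensor N A :=
  (n.+1%:R)^-1 *: \sum_(p < n.+1) (bernoulli K p / p`!%:R) *:
    iter p (ad_series z) (fun k => if k == 0%N then x + (-1) ^+ p *: y else 0) n.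

Fixpoint bch_seq x y (n : nat) : seq (tensor N A) :=
  if n is n'.+1 then
    let s := bch_seq x y n' in rcons s (bch_next x y (nth 0 s) n')
  else [:: 0].

Definition bch_term x y (n : nat) : tensor N A := (bch_seq x y n)`_n.

(* e^z = e^x e^y *)
Definition is_expmul x y z : Prop := sums_to (bch_term x y) z.

End Gauge.

Section GaugeBaseChange.
Variables (K : fieldType) (A B : art K) (f : {lrmorphism A -> B}) (N : dgla K).
Implicit Types a x y z : tensor N A.
Local Notation bc := (base_change (V := N) f).

Let fl : linear bc := @base_change_linear K N A B f.

Lemma map_sub x y : bc (x - y) = bc x - bc y.
Proof. by rewrite (linear_mapD fl) -scaleN1r (linear_mapZ fl) scaleN1r. Qed.

Lemma dA_base_change x : bc (dA x) = dA (bc x).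
Proof. by rewrite /dA base_change_tmap; last exact: dgl_d_linear. Qed.

Lemma is_gauge_base_change a y z :
  is_gauge a y z -> is_gauge (bc a) (bc y) (bc z).
Proof.
move=> /(sums_to_linear fl); rewrite map_sub => -[n0 h].
exists n0 => n hn; rewrite -[RHS](h n hn).
apply: eq_bigr => k _; rewrite (linear_mapZ fl); congr (_ *: _).
elim: {k}(nat_of_ord k) => [|k IH] /=.
  by rewrite map_sub brA_base_change dA_base_change.
by rewrite brA_base_change -IH.
Qed.

Lemma bch_seq_base_change x y n :
  bch_seq (bc x) (bc y) n = map bc (bch_seq x y n).
Proof.
have nthE s i : nth 0 (map bc s) i = bc (nth 0 s i).
  by elim: s i => [|v s IH] [|i] //=; rewrite (linear_map0 fl).
elim: n => [|n IH] /=; first by rewrite (linear_map0 fl).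
rewrite map_rcons IH; congr rcons; rewrite /bch_next (linear_mapZ fl); congr (_ *: _).
rewrite (linear_map_sum _ _ _ fl); apply: eq_bigr => p _; rewrite (linear_mapZ fl).
congr (_ *: _); move: (bch_seq x y n) {IH} => s.
pose u p k := if k == 0%N then x + (-1) ^+ p *: y else 0.
suff E q m : iter q (ad_series (nth 0 (map bc s)))
    (fun k => if k == 0%N then bc x + (-1) ^+ p *: bc y else 0) m =
    bc (iter q (ad_series (nth 0 s)) (u p) m) by exact: E.
elim: q m => [|q IH] m /=.
  rewrite /u; case: eqP => _; last by rewrite (linear_map0 fl).
  by rewrite (linear_mapD fl) (linear_mapZ fl).
rewrite {1 3}/ad_series (linear_map_sum _ _ _ fl); apply: eq_bigr => k _.
by rewrite brA_base_change IH nthE.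
Qed.

Lemma is_expmul_base_change x y z :
  is_expmul x y z -> is_expmul (bc x) (bc y) (bc z).
Proof.
move=> /(sums_to_linear fl)[n0 h]; exists n0 => n hn; rewrite -[RHS](h n hn).
apply: eq_bigr => k _; rewrite /bch_term bch_seq_base_change.
have sz : size (bch_seq x y k) = k.+1.
  by elim: {k}(nat_of_ord k) => //= k IH; rewrite size_rcons IH.
by rewrite (nth_map 0) // sz.
Qed.

End GaugeBaseChange.

Section DefChi.
Variables (K : fieldType) (L M : dgla K) (chi : dgla_mor L M).

Definition chiA (A : art K) : tensor L A -> tensor M A := tmap chi id.

(* The pair (x, a) stands for (x, e^a). *)
Definition MCchi_set (A : art K) : set (tensor L A * tensor M A) :=
  [set p | [/\ tmem (homog (dgl_gr L) 1) (@maxid K A) p.1,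
               tmem (homog (dgl_gr M) 0) (@maxid K A) p.2,
               dA p.1 + 2%:R^-1 *: brA p.1 p.1 = 0
             & is_gauge p.2 (chiA p.1) 0]].

Definition MCchi_obj (A : art K) : Type :=
  {p : tensor L A * tensor M A | MCchi_set p}.

Lemma MCchi_base_change (A B : art K) (f : {lrmorphism A -> B}) p :
  MCchi_set (A := A) p -> MCchi_set (A := B) (base_change f p.1, base_change f p.2).
Proof.
have fl := @base_change_linear K L A B f.
move=> [xm am xMC ax]; split=> /=.
- exact: base_change_tmem.
- exact: base_change_tmem.
- rewrite -dA_base_change -brA_base_change -(linear_mapZ fl) -(linear_mapD fl) xMC.
  exact: linear_map0 fl.
- have := is_gauge_base_change f ax.
  by rewrite (linear_map0 (@base_change_linear K M A B f)) base_change_tmap //;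
     exact: dgm_linear.
Qed.

Definition MCchi_map (A B : art K) (f : {lrmorphism A -> B}) (p : MCchi_obj A) :
    MCchi_obj B :=
  exist _ (base_change f (sval p).1, base_change f (sval p).2)
    (MCchi_base_change f (svalP p)).

Lemma MCchi_eq (A : art K) (x y : MCchi_obj A) : sval x = sval y -> x = y.
Proof.
by case: x y => [x hx] [y hy] /= xy; subst y; congr exist; exact: Prop_irrelevance.
Qed.

Fact MCchi_map_id (A : art K) (x : MCchi_obj A) :
  MCchi_map (idfun : {lrmorphism A -> A}) x = x.
Proof.
by apply: MCchi_eq; case: x => [[x a] h]; congr pair; exact: base_change_id.
Qed.

Fact MCchi_map_comp (A B C : art K) (u : {lrmorphism A -> B})
    (v : {lrmorphism B -> C}) (x : MCchi_obj A) :
  MCchi_map (v \o u : {lrmorphism A -> C}) x = MCchi_map v (MCchi_map u x).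
Proof. by apply: MCchi_eq; congr pair; exact: base_change_comp. Qed.

Definition MCchi : functor K :=
  @Functor K MCchi_obj MCchi_map MCchi_map_id MCchi_map_comp.

Definition gauge_equiv (A : art K) (p q : MCchi A) : Prop :=
  exists a b,
    [/\ tmem (homog (dgl_gr L) 0) (@maxid K A) a,
        tmem (homog (dgl_gr M) (-1)) (@maxid K A) b,
        is_gauge a (sval p).1 (sval q).1
      & exists2 w, is_expmul (dA b) (sval p).2 w &
                   is_expmul w (- chiA a) (sval q).2].

Fact gauge_equiv_fmap (A B : art K) (f : {lrmorphism A -> B}) (p q : MCchi A) :
  gauge_equiv p q -> gauge_equiv (fmap f p) (fmap f q).
Proof.
move=> [a [b [am bm ha [w hw hw']]]].
exists (base_change f a), (base_change f b); split.
- exact: base_change_tmem.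
- exact: base_change_tmem.
- exact: is_gauge_base_change.
- exists (base_change f w).
    by rewrite -dA_base_change; exact: is_expmul_base_change.
  have E : base_change f (- chiA a) = - chiA (base_change f a).
    rewrite -scaleN1r (linear_mapZ (@base_change_linear K M A B f)) scaleN1r.
    by rewrite /chiA base_change_tmap //; exact: dgm_linear.
  by have := is_expmul_base_change f hw'; rewrite E.
Qed.

Definition Def_chi : functor K := quot_functor gauge_equiv_fmap.

End DefChi.

(* Main.v *)
(* A Maurer-Cartan element of the cone over A is a pair (x, a) in
   (L^1 (x) m_A) x (M^0 (x) m_A).  Its L-component gives dx + [x, x]/2 = 0 and, by
   symmetry of the brackets, its M-component gives da = b(- ad a) chi(x), where
   b(T) = T / (e^T - 1); multiplying by (e^T - 1) / T at T = ad a this reads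
   e^a * chi(x) = 0.  So the two functors are quotients of the same set.

   Applying this to chi[t,dt] : L[t,dt] -> M[t,dt], a homotopy is a pair (x~, a~) with
   x~ Maurer-Cartan and e^a~ * chi(x~) = 0.  Every such x~ is e^p * x_0 with p(0) = 0, so
   e^w = e^a~ e^chi(p) e^(- a_0) stabilizes 0, that is, w is closed; as w(0) = 0, Stokes'
   formula gives w(1) = db, whence e^a_1 = e^db e^a_0 e^(- chi(p(1))).  Conversely a gauge
   equivalence (a, b) is the endpoint of x~ = e^(t a) * x_0,
   e^a~ = e^(d(t b)) e^a_0 e^(- chi(t a)). *)

From Pilot Require Import Defs.
From HB Require Import structures.
From mathcomp Require Import all_boot all_order perm all_algebra ssrAC.
From mathcomp Require Import boolp classical_sets ring.

Set Implicit Arguments.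
Unset Strict Implicit.
Unset Printing Implicit Defensive.

Import GRing.Theory Pilot.Defs.
Local Open Scope ring_scope.

(** * Power series in nilpotent operators *)

(** The group exp(M^0 (x) m_A) is known only through the Baker-Campbell-Hausdorff series, itself
    defined by a differential equation; no associative algebra is at hand in which exponentials
    multiply. What is used of the group law is drawn from the gauge action on N[t,dt]. The
    differential equation is what makes e^([bch x y]) act as e^x e^y ([gact_bch]). The action on N
    does not separate group elements, as every closed w gives e^w * 0 = 0; in N[t,dt], however, the
    differential contains d/dt, and a path w without dt that vanishes at t = 0 is determined by e^w
    * 0. This gives the cancellation rule [bchK].

    The other obstacle is signs. An element of degree 0 in C_chi[1][t,dt] is a sum of generators v p
    with |v| = 0 and v p dt with |v| = -1. Products of two generators with dt vanish, so that at
    most one entry is odd and all Koszul signs are 1.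

    The series b(-T) appears, although the higher operations carry the B_n of b(T), because the
    separate formula for <m (x) l>_2 amounts to taking B_1 = 1/2 instead of -1/2. *)

Lemma sum_triangle (V : nmodType) (g : nat -> nat -> V) N :
  (forall i j, (N <= i + j)%N -> g i j = 0) ->
  \sum_(n < N) \sum_(i < n.+1) g i (n - i)%N = \sum_(i < N) \sum_(j < N) g i j.
Proof.
move=> g0; under eq_bigr => n _.
  rewrite (big_ord_widen N (fun i => g i (n - i)%N)) //; over.
rewrite (exchange_big_dep xpredT) //=; apply: eq_bigr => i _.
rewrite -(big_mkord (fun n : nat => (i < n.+1)%N) (fun n => g i (n - i)%N)).
rewrite -(big_mkord xpredT (g i)) (big_cat_nat _ (n := i)) ?(ltnW (ltn_ord i)) //=.
rewrite big_nat_cond big_pred0 ?add0r => [|n]; last first.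
  by apply/negbTE/negP => /andP[/andP[_ ni]]; rewrite ltnS leqNgt ni.
rewrite [RHS](big_cat_nat _ (n := N - i)) ?leq_subr //= [X in _ = _ + X]big_nat_cond.
rewrite [X in _ = _ + X]big1 ?addr0 => [|j /andP[/andP[Nj _] _]]; last first.
  by apply: g0; rewrite -leq_subLR.
rewrite -{1}[nat_of_ord i]add0n big_addn.
rewrite !big_mkord; apply: eq_big => [j|j _]; last by rewrite addnK.
by rewrite ltnS leq_addl.
Qed.

Section SumsTo.
Variable V : nmodType.
Implicit Types (u : nat -> V) (s : V).

Lemma sums_to_fin u n : (forall k, (n <= k)%N -> u k = 0) -> sums_to u (\sum_(k < n) u k).
Proof.
move=> u0; exists n => m nm.
rewrite -!(big_mkord xpredT u) (big_cat_nat _ (n := n)) //= [X in _ + X]big_nat_cond.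
by rewrite [X in _ + X]big1 ?addr0 // => k /andP[/andP[/u0]].
Qed.

Lemma sums_to_uniq u s s' : sums_to u s -> sums_to u s' -> s = s'.
Proof.
move=> [n hn] [n' hn']; rewrite -(hn (maxn n n')) ?leq_maxl //.
by rewrite hn' // leq_maxr.
Qed.

End SumsTo.

Section NilpotentSeries.
Variable K : fieldType.
Implicit Types (V W : lmodType K) (c : nat -> K).

Definition nilop V (T : V -> V) : Prop :=
  linear T /\ exists n, forall v, iter n T v = 0.

(* The power series with coefficients c evaluated at T; the empty sum if T is not
   nilpotent. *)
Definition pws c V (T : V -> V) (v : V) : V :=
  \sum_(k < xget 0%N [set n | forall v, iter n T v = 0]%classic) c k *: iter k T v.

Definition conv c c' (n : nat) : K := \sum_(i < n.+1) c i * c' (n - i)%N.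

Lemma iter_linear V (T : V -> V) n : linear T -> linear (iter n T).
Proof. by move=> Tl; elim: n => [|n IH] //=; exact: linear_comp Tl IH. Qed.

Lemma iter_vanish V (T : V -> V) n m v :
  linear T -> iter n T v = 0 -> (n <= m)%N -> iter m T v = 0.
Proof.
move=> Tl Tn nm; rewrite -(subnK nm) iterD Tn.
exact: linear_map0 (iter_linear _ Tl).
Qed.

Lemma pwsE c V (T : V -> V) n v : nilop T -> iter n T v = 0 ->
  pws c T v = \sum_(k < n) c k *: iter k T v.
Proof.
move=> [Tl [n0 Tn0]] Tn; rewrite /pws; case: xgetP => [m _ /= Tm|/(_ n0)//].
apply: (@sums_to_uniq _ (fun k => c k *: iter k T v));
  apply: sums_to_fin => k nk; rewrite (iter_vanish _ _ nk) ?scaler0 //.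
Qed.

Lemma pws_sums_to c V (T : V -> V) v : nilop T ->
  sums_to (fun k => c k *: iter k T v) (pws c T v).
Proof.
move=> nT; have [Tl [n Tn]] := nT; rewrite (pwsE _ nT (Tn v)).
by apply: sums_to_fin => k nk; rewrite (iter_vanish _ _ nk) ?scaler0.
Qed.

Lemma nilopW V (T : V -> V) : nilop T -> exists n, forall m, (n <= m)%N ->
  forall v, iter m T v = 0.
Proof.
by move=> [Tl [n Tn]]; exists n => m nm v; exact: (iter_vanish Tl (Tn v) nm).
Qed.

Lemma pws_linear c V (T : V -> V) : nilop T -> linear (pws c T).
Proof.
move=> nT; have [Tl [n Tn]] := nT.
apply: (@linear_ext _ _ _ (fun v => \sum_(k < n) c k *: iter k T v)).
  by move=> v; rewrite (pwsE c nT (Tn v)).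
by apply: linear_sum => k _; apply: linear_scale; exact: iter_linear.
Qed.

Lemma eq_pws c c' V (T : V -> V) : c =1 c' -> pws c T =1 pws c' T.
Proof. by move=> cc v; apply: eq_bigr => k _; rewrite cc. Qed.

Lemma pws_delta V (T : V -> V) v : nilop T -> pws (fun k => (k == 0)%N%:R) T v = v.
Proof.
move=> nT; have [n Tn] := nilopW nT.
rewrite (pwsE _ nT (Tn n.+1 (leqnSn n) v)) big_ord_recl /= scale1r big1 ?addr0 // => k _.
by rewrite scale0r.
Qed.

Lemma pws_morph c V W (T : V -> V) (T' : W -> W) (f : V -> W) v :
  nilop T -> nilop T' -> linear f -> (forall v, f (T v) = T' (f v)) ->
  f (pws c T v) = pws c T' (f v).
Proof.
move=> nT nT' fl fT; have [_ [n Tn]] := nT; have [_ [n' Tn']] := nT'.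
have fi k u : f (iter k T u) = iter k T' (f u) by elim: k => //= k <-; rewrite fT.
apply: sums_to_uniq (pws_sums_to c (f v) nT').
have [N h] := sums_to_linear fl (pws_sums_to c v nT).
by exists N => m /h <-; apply: eq_bigr => k _; rewrite (linear_mapZ fl) fi.
Qed.

Lemma pws_commute c V (T : V -> V) v : nilop T -> T (pws c T v) = pws c T (T v).
Proof. by move=> nT; apply: pws_morph => //; case: nT. Qed.

Lemma pws_comp c c' V (T : V -> V) v : nilop T ->
  pws c T (pws c' T v) = pws (conv c c') T v.
Proof.
move=> nT; have [Tl [n Tn]] := nT.
have Tz m : (n <= m)%N -> iter m T v = 0 by exact: iter_vanish (Tn v).
rewrite !(pwsE _ nT (Tn _)).
pose g i j := (c i * c' j) *: iter (i + j) T v.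
transitivity (\sum_(i < n) \sum_(j < n) g i j).
  apply: eq_bigr => i _; rewrite (linear_map_sum _ _ _ (iter_linear i Tl)) scaler_sumr.
  apply: eq_bigr => j _; rewrite (linear_mapZ (iter_linear i Tl)) scalerA.
  by rewrite -iterD.
rewrite -sum_triangle => [|i j nij]; last by rewrite /g Tz // scaler0.
apply: eq_bigr => k _; rewrite /conv scaler_suml; apply: eq_bigr => i _.
by rewrite /g subnKC // -ltnS.
Qed.

Lemma nilop_opp V (T : V -> V) : nilop T -> nilop (fun v => - T v).
Proof.
move=> [Tl [n Tn]]; have nl : linear (fun v => - T v).
  by apply: (@linear_ext _ _ _ (fun v => (-1) *: T v)) => [v|];
     [rewrite scaleN1r | exact: linear_scale].
split=> //; exists n => v.
suff -> m : iter m (fun v => - T v) v = (-1) ^+ m *: iter m T v by rewrite Tn scaler0.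
elim: m => [|m /= ->]; first by rewrite scale1r.
by rewrite (linear_mapZ Tl) exprS mulN1r scaleNr.
Qed.

Definition alt c k := (-1) ^+ k * c k : K.

Lemma pws_opp c V (T : V -> V) v : nilop T ->
  pws c (fun v => - T v) v = pws (alt c) T v.
Proof.
move=> nT; have [Tl [n Tn]] := nT; have nT' := nilop_opp nT.
have E m : iter m (fun v => - T v) v = (-1) ^+ m *: iter m T v.
  elim: m => [|m /= ->]; first by rewrite scale1r.
  by rewrite (linear_mapZ Tl) exprS mulN1r scaleNr.
rewrite (pwsE _ nT (Tn v)) (pwsE _ nT' (_ : iter n _ _ = 0)) ?E ?Tn ?scaler0 //.
by apply: eq_bigr => k _; rewrite E scalerA mulrC.
Qed.

Lemma pws_recl c V (T : V -> V) v : nilop T ->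
  pws c T v = c 0%N *: v + pws (c \o succn) T (T v).
Proof.
move=> nT; have [Tl [n Tn]] := nT.
have Tn1 : iter n.+1 T v = 0 by exact: iter_vanish (Tn v) (leqnSn n).
rewrite (pwsE _ nT Tn1) big_ord_recl (pwsE _ nT (Tn _)); congr (_ + _).
by apply: eq_bigr => k _; rewrite /= -iterSr.
Qed.

Lemma pws_fixed c V (T : V -> V) v : nilop T -> T v = 0 -> pws c T v = c 0%N *: v.
Proof.
by move=> nT Tv; rewrite pws_recl // Tv (linear_map0 (pws_linear _ nT)) addr0.
Qed.

Lemma pws_add c c' V (T : V -> V) v :
  pws (fun k => c k + c' k) T v = pws c T v + pws c' T v.
Proof. by rewrite /pws -big_split; apply: eq_bigr => k _; rewrite scalerDl. Qed.

(* The coefficients of e^x, (e^x - 1) / x and x / (e^x - 1). *)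
Definition expc (k : nat) : K := (k`!%:R)^-1.
Definition expc1 (k : nat) : K := (k.+1`!%:R)^-1.
Definition bernc (k : nat) : K := bernoulli K k / k`!%:R.

Hypothesis charK0 : [pchar K] =i pred0.

Lemma natK_neq0 n : (0 < n)%N -> n%:R != 0 :> K.
Proof. by rewrite ((pcharf0P K).1 charK0) lt0n. Qed.

Lemma factK_neq0 n : n`!%:R != 0 :> K.
Proof. exact: natK_neq0 (fact_gt0 n). Qed.

(** The recursion [bernoulli_gf] that defines the Bernoulli numbers, with the order of summation
    reversed. *)
Lemma conv_expc1_bernc n : conv expc1 bernc n = (n == 0)%:R.
Proof.
rewrite -(bernoulli_gf n charK0) /conv (reindex_inj rev_ord_inj) /=.
apply: eq_bigr => i _; rewrite /expc1 /bernc subSS mulrC.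
by rewrite (subKn (ltn_ord i : (i <= n)%N)) subSn // -ltnS.
Qed.

Lemma invf_fact_bin n i : (i <= n)%N ->
  (i`!%:R)^-1 * ((n - i)`!%:R)^-1 = (n`!%:R)^-1 * 'C(n, i)%:R :> K.
Proof.
move=> le_in; rewrite -(bin_fact le_in) !natrM.
have f1 := factK_neq0 i; have f2 := factK_neq0 (n - i).
have f3 : 'C(n, i)%:R != 0 :> K by rewrite natK_neq0 // bin_gt0.
by field; rewrite f1 f2 f3.
Qed.

Lemma sum_alt_bin n : \sum_(i < n.+1) (-1) ^+ i * 'C(n, i)%:R = (n == 0)%:R :> K.
Proof.
have := exprDn 1 (-1 : K) n; rewrite subrr expr0n => ->.
by apply: eq_bigr => i _; rewrite expr1n mul1r mulr_natr.
Qed.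

Lemma conv_alt_expc n : conv (alt expc) expc n = (n == 0)%:R.
Proof.
rewrite /conv /alt /expc.
under eq_bigr => i _ do rewrite -mulrA invf_fact_bin -1?ltnS // mulrCA.
rewrite -mulr_sumr sum_alt_bin.
by case: n => [|n]; rewrite ?mulr0 // fact0 invr1 mulr1.
Qed.

(** This is e^x (1 - e^(-x)) / x = (e^x - 1) / x. The coefficients form the alternating sum of the
    binomials C(n + 1, i), which is 0, without its last term i = n + 1. *)
Lemma conv_expc_alt n : conv expc (alt expc1) n = expc1 n.
Proof.
rewrite /conv /alt /expc /expc1.
have E (i : 'I_n.+1) : i`!%:R^-1 * ((-1) ^+ (n - i) * (n - i).+1`!%:R^-1) =
    (n.+1`!%:R)^-1 * - ((-1) ^+ n.+1 * ((-1) ^+ i * 'C(n.+1, i)%:R)) :> K.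
  have le_in : (i <= n)%N by rewrite -ltnS.
  rewrite mulrCA -subSn // invf_fact_bin; last exact: leqW.
  rewrite mulrCA; congr (_ * _); rewrite mulrA -mulNr; congr (_ * _).
  have {1}-> : (-1) ^+ n.+1 = - ((-1) ^+ (n - i) * (-1) ^+ i) :> K.
    by rewrite -exprD subnK // exprS mulN1r.
  by rewrite mulNr opprK -mulrA -expr2 sqrr_sign mulr1.
rewrite (eq_bigr _ (fun i _ => E i)) -mulr_sumr sumrN -mulr_sumr.
have := sum_alt_bin n.+1; rewrite big_ord_recr /= => /eqP.
rewrite addr_eq0 => /eqP E1; rewrite E1 binn mulr1 -[RHS]mulr1; congr (_ * _).
by rewrite mulrN opprK -expr2 sqrr_sign.
Qed.

Section Identities.
Variables (V : lmodType K) (T : V -> V).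
Hypothesis nT : nilop T.
Let nT' := nilop_opp nT.
Local Notation oppT := (fun v => - T v).

Lemma pws_expc1_bernc v : pws expc1 T (pws bernc T v) = v.
Proof.
by rewrite pws_comp // (eq_pws _ (conv_expc1_bernc)) pws_delta.
Qed.

Lemma pws_bernc_expc1 v : pws bernc T (pws expc1 T v) = v.
Proof.
rewrite pws_comp // -[RHS](pws_expc1_bernc v) [RHS]pws_comp //; apply: eq_pws => n.
rewrite /conv (reindex_inj rev_ord_inj) /=; apply: eq_bigr => i _.
by rewrite subSS (subKn (ltn_ord i : (i <= n)%N)) mulrC.
Qed.

Lemma pws_expN_exp v : pws expc oppT (pws expc T v) = v.
Proof.
by rewrite pws_opp // pws_comp // (eq_pws _ (conv_alt_expc)) pws_delta.
Qed.

Lemma pws_exp_expc1N v : pws expc T (pws expc1 oppT v) = pws expc1 T v.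
Proof. by rewrite pws_opp // pws_comp // (eq_pws _ (conv_expc_alt)). Qed.

Lemma pws_exp_recl v : pws expc T v = v + T (pws expc1 T v).
Proof.
by rewrite pws_recl // /expc fact0 invr1 scale1r pws_commute.
Qed.

End Identities.

Section Identities2.
Variables (V : lmodType K) (T : V -> V).
Hypothesis nT : nilop T.
Let nT' := nilop_opp nT.
Local Notation oppT := (fun v => - T v).

Lemma pws_expc1_berncN v : pws expc1 T (pws bernc oppT v) = pws expc T v.
Proof. by rewrite -pws_exp_expc1N // pws_expc1_bernc. Qed.

(** With b(x) = x / (e^x - 1), this is b(-x) = e^x b(x) = b(x) + x, which contains the vanishing of
    B_n for odd n > 1. *)
Lemma pws_berncN v : pws bernc oppT v = pws bernc T v + T v.
Proof.
rewrite -[LHS](pws_bernc_expc1 nT) pws_expc1_berncN pws_exp_recl //.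
rewrite (linear_mapD (pws_linear _ nT)); congr (_ + _).
by rewrite -pws_commute // pws_bernc_expc1.
Qed.

End Identities2.

(** The Leibniz rule for [T3] along [h] iterates to the binomial formula, so that exponentials
    multiply. The rule is asked on [P] and [Q] because, for brackets, it depends on the degrees of
    the arguments. *)
Lemma pws_exp_bilinear (U V W : lmodType K) (P : set U) (Q : set V)
    (T1 : U -> U) (T2 : V -> V) (T3 : W -> W) (h : U -> V -> W) u v :
  nilop T1 -> nilop T2 -> nilop T3 -> bilinear_map h ->
  (forall u, P u -> P (T1 u)) -> (forall v, Q v -> Q (T2 v)) ->
  (forall u v, P u -> Q v -> T3 (h u v) = h (T1 u) v + h u (T2 v)) ->
  P u -> Q v ->
  pws expc T3 (h u v) = h (pws expc T1 u) (pws expc T2 v).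
Proof.
move=> n1 n2 n3 hb P1 Q2 h3 Pu Qv.
have [N1 T1n] := nilopW n1; have [N2 T2n] := nilopW n2; have [N3 T3n] := nilopW n3.
have Pi i : P (iter i T1 u) by elim: i => //= i; exact: P1.
have Qi i : Q (iter i T2 v) by elim: i => //= i; exact: Q2.
pose g i j := h (expc i *: iter i T1 u) (expc j *: iter j T2 v).
have T3l := n3.1.
have key n : expc n *: iter n T3 (h u v) = \sum_(i < n.+1) g i (n - i)%N.
  elim: n => [|n IH].
    by rewrite big_ord_recl big_ord0 addr0 /g /expc fact0 invr1 !scale1r.
  have nz : n.+1%:R != 0 :> K by exact: natK_neq0.
  apply: (scalerI nz); rewrite scalerA.
  have -> : n.+1%:R * expc n.+1 = expc n.
    by rewrite /expc factS natrM invfM mulrA divff ?mul1r.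
  rewrite iterS -(linear_mapZ T3l) IH (linear_map_sum _ _ _ T3l).
  have gE i j : g i j = (expc i * expc j) *: h (iter i T1 u) (iter j T2 v).
    by rewrite /g (linear_mapZ (hb.2 _)) (linear_mapZ (hb.1 _)) scalerA.
  have gS i j : T3 (g i j) = i.+1%:R *: g i.+1 j + j.+1%:R *: g i j.+1.
    have E k : k.+1%:R * expc k.+1 = expc k.
      by rewrite /expc factS natrM invfM mulrA divff ?mul1r ?natK_neq0.
    rewrite !gE (linear_mapZ T3l) h3 // scalerDr !scalerA mulrA E.
    by rewrite mulrCA E.
  under eq_bigr do rewrite gS.
  rewrite big_split /= scaler_sumr.
  (* Both sides have been multiplied by n + 1, which is split as i + (n + 1 - i): the first part
     matches the terms where [T1] acts, the second those where [T2] acts. *)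
  under [RHS]eq_bigr => i _.
    rewrite -{1}(subnKC (ltn_ord i : (i <= n.+1)%N)) natrD scalerDl; over.
  rewrite big_split /=; congr (_ + _).
    rewrite [RHS]big_ord_recl scale0r add0r; apply: eq_bigr => i _.
    by rewrite /= /bump leq0n add1n subSS.
  rewrite [RHS]big_ord_recr /= subnn scale0r addr0; apply: eq_bigr => i _.
  by rewrite subSn // -ltnS.
(* If i + j >= N, then i >= N1 or j >= N2, so the square of indices below N adds only zero terms to
   the triangle i + j < N. *)
pose N := (N1 + N2 + N3)%N.
rewrite (pwsE _ n3 (T3n N _ _)) ?leq_addl //.
rewrite (pwsE _ n1 (T1n N _ _)); last by rewrite /N -addnA leq_addr.
rewrite (pwsE _ n2 (T2n N _ _)); last by rewrite /N addnAC leq_addl.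
rewrite (eq_bigr _ (fun n _ => key (nat_of_ord n))) sum_triangle.
  rewrite (linear_map_sum _ _ _ (hb.2 _)); apply: eq_bigr => i _.
  by rewrite (linear_map_sum _ _ _ (hb.1 _)).
move=> i j Nij; rewrite /g; have [N1i|iN1] := leqP N1 i.
  by rewrite T1n // scaler0 (linear_map0 (hb.2 _)).
rewrite T2n ?scaler0 ?(linear_map0 (hb.1 _)) //.
rewrite leqNgt; apply/negP => jN2.
have : (i + j < N1 + N2)%N by rewrite -addSn leq_add // ltnW.
by rewrite ltnNge (leq_trans _ Nij) // leq_addr.
Qed.

End NilpotentSeries.

(** * Filtration by the powers of the maximal ideal *)

Section MaximalIdealPowers.
Variables (K : fieldType) (A : art K).

Fixpoint mpow (k : nat) : set A :=
  if k is k'.+1 then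
    [set x | exists s : seq (A * A),
       (forall p, p \in s -> maxid p.1 /\ mpow k' p.2) /\ x = \sum_(p <- s) p.1 * p.2]%classic
  else setT.

Lemma maxid_ideal : is_ideal (@maxid K A).
Proof. exact: art_local. Qed.

Lemma mpow_ideal k : is_ideal (mpow k).
Proof.
elim: k => [|k [_ _ IHM]] //=; split.
- by exists [::]; rewrite big_nil.
- move=> x y [s [hs ->]] [t [ht ->]]; exists (s ++ t); rewrite big_cat; split=> // p.
  by rewrite mem_cat => /orP[/hs|/ht].
- move=> a x [s [hs ->]]; exists [seq (p.1, a * p.2) | p <- s]; split.
    by move=> _ /mapP[p /hs[p1 p2] ->]; split=> //=; exact: IHM.
  by rewrite big_map mulr_sumr; apply: eq_bigr => p _ /=; rewrite mulrCA.
Qed.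

Lemma mpow_sum k I (r : seq I) (P : pred I) (F : I -> A) :
  (forall i, P i -> mpow k (F i)) -> mpow k (\sum_(i <- r | P i) F i).
Proof.
by have [h0 hD _] := mpow_ideal k; move=> hF; apply: big_ind.
Qed.

Lemma mpowS k a b : maxid a -> mpow k b -> mpow k.+1 (a * b).
Proof.
move=> ma mb; exists [:: (a, b)]; rewrite big_seq1; split=> // p.
by rewrite inE => /eqP->.
Qed.

Lemma mpow1 a : mpow 1 a <-> maxid a.
Proof.
have [h0 hD hM] := maxid_ideal; split=> [[s [hs ->]]|ma].
  rewrite big_seq; apply: big_ind => // p /hs[p1 _].
  by rewrite mulrC; exact: hM.
by rewrite -[a]mulr1; apply: mpowS.
Qed.

Lemma mpowD j k a b : mpow j a -> mpow k b -> mpow (j + k) (a * b).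
Proof.
elim: j a => [|j IH] a; first by move=> _; have [_ _] := mpow_ideal k; exact.
move=> [s [hs ->]] mb; rewrite mulr_suml addSn big_seq; apply: mpow_sum => p /hs[p1 p2].
by rewrite -mulrA; apply: mpowS => //; exact: IH.
Qed.

Lemma mpow_le j k a : (j <= k)%N -> mpow k a -> mpow j a.
Proof.
move=> /subnKC <-; elim: (k - j)%N a => [|i IH] a; first by rewrite addn0.
rewrite addnS => -[s [hs ->]]; rewrite big_seq; apply: mpow_sum => p /hs[_ /IH].
by have [_ _] := mpow_ideal j; exact.
Qed.

Lemma unit_1_sub_maxid (a : A) : maxid a -> exists y, (1 - a) * y = 1.
Proof.
move=> ma; apply: contrapT => h; have [_ hD _] := maxid_ideal.
have : @maxid K A 1 by rewrite -[1](subrK a); exact: hD.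
by apply; exists 1; rewrite mulr1.
Qed.

(* If the powers stabilized at I <> 0, then one could choose b_n in m_A with
   b_1 .. b_n I <> 0 for all n, and the principal ideals generated by these
   products would not stabilize. *)
Lemma maxid_nilpotent : exists N, forall a, mpow N a -> a = 0.
Proof.
have [N mN] := art_artinian mpow_ideal (fun n x => @mpow_le n n.+1 x (leqnSn n)).
exists N => a0 Ia0; apply: contrapT => a0n.
pose good a := exists2 b, mpow N b & a * b <> 0.
(* As [mpow N] and [mpow N.+1] agree, an element of the stable power not killed by a is a sum of
   products p.1 p.2 with p.1 in m_A and p.2 in that power, and a fails to kill one of them. *)
have split_good a : good a -> exists2 b, maxid b & good (a * b).
  move=> [b Ib ab]; apply: contrapT => h; apply: ab.
  move: Ib; rewrite -(mN N.+1) // => -[s [hs ->]].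
  rewrite mulr_sumr big_seq big1 // => p /hs[p1 p2]; apply: contrapT => ap.
  by apply: h; exists p.1 => //; exists p.2 => //; rewrite -mulrA.
have [next nextP] : exists f : A -> A, forall a, good a -> maxid (f a) /\ good (a * f a).
  suff /choice[f fP] : forall a, exists b, good a -> maxid b /\ good (a * b) by exists f.
  move=> a; have [/split_good[b mb gb]|ga] := pselect (good a); first by exists b.
  by exists 0.
pose s n := iter n (fun a => a * next a) 1.
have sg n : good (s n).
  elim: n => [|n /nextP[]//]; by exists a0; rewrite ?mul1r.
pose J n : set A := [set x | exists c, x = c * s n]%classic.
have Jideal n : is_ideal (J n).
  split; first by exists 0; rewrite mul0r.
    by move=> _ _ [c ->] [c' ->]; exists (c + c'); rewrite mulrDl.
  by move=> a _ [c ->]; exists (a * c); rewrite mulrA.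
have [|M JM] := art_artinian Jideal.
  by move=> n x [c ->]; exists (c * next (s n)); rewrite /= -mulrA [next _ * _]mulrC.
have : J M (s M) by exists 1; rewrite mul1r.
rewrite -(JM M.+1) // => -[c sE]; have [mn _] := nextP _ (sg M).
(* Here s_M = c b s_M with b = [next (s M)] in m_A, and 1 - c b is invertible. *)
have [_ _ hM] := maxid_ideal; have [y yE] := unit_1_sub_maxid (hM c _ mn).
have s0 : s M = 0.
  have -> : s M = y * ((1 - c * next (s M)) * s M) by rewrite mulrA (mulrC y) yE mul1r.
  by rewrite mulrBl mul1r -mulrA [next _ * _]mulrC -[s M * _]/(s M.+1) -sE subrr mulr0.
by have [b _] := sg M; apply; rewrite s0 mul0r.
Qed.

End MaximalIdealPowers.

(** * Subspaces of tensor products *)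

Section Subspaces.
Variable K : fieldType.
Implicit Types V W : lmodType K.

Definition subsp V (P : set V) : Prop :=
  P 0 /\ forall a x y, P x -> P y -> P (a *: x + y).

Section Closure.
Variables (V : lmodType K) (P : set V).
Hypothesis sP : subsp P.

Lemma subspZ a x : P x -> P (a *: x).
Proof. by move=> Px; rewrite -[_ *: _]addr0; apply: sP.2 => //; exact: sP.1. Qed.

Lemma subspD x y : P x -> P y -> P (x + y).
Proof. by move=> Px Py; rewrite -[x]scale1r; exact: sP.2. Qed.

Lemma subspN x : P x -> P (- x).
Proof. by rewrite -scaleN1r; exact: subspZ. Qed.

Lemma subspB x y : P x -> P y -> P (x - y).
Proof. by move=> Px Py; apply: subspD => //; exact: subspN. Qed.

Lemma subsp_sum I (r : seq I) (Q : pred I) (F : I -> V) :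
  (forall i, Q i -> P (F i)) -> P (\sum_(i <- r | Q i) F i).
Proof. by move=> hF; apply: big_ind => //; [exact: sP.1 | exact: subspD]. Qed.

Lemma subsp_iter (T : V -> V) n x : (forall v, P v -> P (T v)) -> P x -> P (iter n T x).
Proof. by move=> hT Px; elim: n => //= n; exact: hT. Qed.

Lemma subsp_pws c (T : V -> V) v :
  (forall v, P v -> P (T v)) -> P v -> P (pws c T v).
Proof.
by move=> hT Pv; apply: subsp_sum => k _; apply: subspZ; exact: subsp_iter.
Qed.

End Closure.

Lemma subspT V : subsp (@setT V). Proof. by []. Qed.

Lemma subsp_eq V W (f g : V -> W) : linear f -> linear g ->
  subsp [set x | f x = g x]%classic.
Proof.
move=> fl gl; split=> [|a x y /= fx fy]; first by rewrite /= !linear_map0.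
by rewrite fl gl fx fy.
Qed.

Lemma subsp_pre V W (f : V -> W) (P : set W) : linear f -> subsp P ->
  subsp [set x | P (f x)]%classic.
Proof.
move=> fl sP; split=> [|a x y /= Px Py]; first by rewrite /= linear_map0 //; exact: sP.1.
by rewrite fl; exact: sP.2.
Qed.

Lemma homog_subsp V (G : grading V) i : subsp (homog G i).
Proof. exact: subsp_eq (gproj_linear G i) _. Qed.

Section TensorSubspaces.
Variables (V : lmodType K) (B : lmodType K).
Implicit Types (P : set V) (I : set B) (U : lmodType K).

Lemma tmem_tens P I v a : P v -> I a -> tmem P I (tens v a).
Proof.
move=> Pv Ia; exists [:: (v, a)]; rewrite big_seq1; split=> // p.
by rewrite inE => /eqP->.
Qed.

Lemma tmem_ind P I (Q : set (tensor V B)) : subsp Q ->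
  (forall v a, P v -> I a -> Q (tens v a)) -> forall x, tmem P I x -> Q x.
Proof.
move=> sQ h x [s [hs ->]]; rewrite big_seq; apply: subsp_sum => // p /hs[].
exact: h.
Qed.

Lemma tmem_in P I U (R : set U) (f : tensor V B -> U) x : linear f -> subsp R ->
  (forall v a, P v -> I a -> R (f (tens v a))) -> tmem P I x -> R (f x).
Proof.
move=> fl sR h; apply: (@tmem_ind P I (fun x => R (f x))) => //.
exact: subsp_pre fl sR.
Qed.

Lemma tmem_eq P I U (f g : tensor V B -> U) x : linear f -> linear g ->
  (forall v a, P v -> I a -> f (tens v a) = g (tens v a)) -> tmem P I x -> f x = g x.
Proof.
move=> fl gl h; apply: (@tmem_ind P I (fun x => f x = g x)) => //.
exact: subsp_eq fl gl.
Qed.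

Lemma tmem_subsp P I : subsp P -> subsp (tmem P I).
Proof.
move=> sP; split=> [|a x y [s [hs ->]] [t [ht ->]]].
  by exists [::]; rewrite big_nil.
exists ([seq (a *: p.1, p.2) | p <- s] ++ t); split=> [p|].
  rewrite mem_cat => /orP[/mapP[q /hs[q1 q2] ->]|/ht//].
  by split=> //; exact: subspZ.
rewrite big_cat big_map scaler_sumr; congr (_ + _); apply: eq_bigr => p _ /=.
by rewrite (linear_mapZ ((tens_bilinear V B).2 _)).
Qed.

Lemma tmem_sub P I P' I' x : (forall v, P v -> P' v) -> (forall a, I a -> I' a) ->
  tmem P I x -> tmem P' I' x.
Proof.
move=> PP II [s [hs xE]]; exists s; split=> // p /hs[p1 p2].
by split; [exact: PP | exact: II].
Qed.

Lemma tmemT (x : tensor V B) : tmem setT setT x.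
Proof. by have [s ->] := tensorE x; exists s. Qed.

End TensorSubspaces.

Lemma tmem_tmap V W (B : lmodType K) (g : V -> W) (P : set V) (Q : set W) (I : set B) x :
  linear g -> subsp Q -> (forall v, P v -> Q (g v)) ->
  tmem P I x -> tmem Q I (tmap g id x).
Proof.
move=> gl sQ PQ; apply: (@tmem_ind V B P I (fun x => tmem Q I (tmap g id x))).
  apply: subsp_pre; [exact: tmap_linear | exact: tmem_subsp sQ].
by move=> v a Pv Ia; rewrite tmap_tens //; apply: tmem_tens => //; exact: PQ.
Qed.

End Subspaces.

Lemma linear_tensor_eq0 (K : fieldType) (V W U : lmodType K) (f : tensor V W -> U) :
  linear f -> (forall v w, f (tens v w) = 0) -> forall x, f x = 0.
Proof. by move=> fl f0 x; apply: (linear_tensor_eq fl (@linear_cst0 K _ _)). Qed.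

Lemma linear_id (K : fieldType) (V : lmodType K) : linear (@id V).
Proof. by []. Qed.

Lemma linear_opp (K : fieldType) (V W : lmodType K) (f : V -> W) :
  linear f -> linear (fun v => - f v).
Proof.
move=> fl; apply: (@linear_ext _ _ _ (fun v => (-1) *: f v)); last exact: linear_scale.
by move=> v; rewrite scaleN1r.
Qed.

(** * The filtered differential graded Lie algebra N (x) A *)

Section TensorDGLA.
Variables (K : fieldType) (A : art K) (N : dgla K).
Implicit Types (x y z : tensor N A) (i : int) (k : nat).

Definition tdeg (i : int) (k : nat) : set (tensor N A) :=
  tmem (homog (dgl_gr N) i) (@mpow K A k).
Definition tfil (k : nat) : set (tensor N A) := tmem setT (@mpow K A k).

Lemma tdeg_subsp i k : subsp (tdeg i k).
Proof. exact/tmem_subsp/homog_subsp. Qed.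

Lemma tfil_subsp k : subsp (tfil k).
Proof. exact/tmem_subsp/subspT. Qed.

Lemma tfil0 x : tfil 0 x. Proof. exact: tmemT. Qed.

Lemma tdegW i (j k : nat) x : (j <= k)%N -> tdeg i k x -> tdeg i j x.
Proof. by move=> jk; apply: tmem_sub => // a; exact: mpow_le. Qed.

Lemma tfilW (j k : nat) x : (j <= k)%N -> tfil k x -> tfil j x.
Proof. by move=> jk; apply: tmem_sub => // a; exact: mpow_le. Qed.

Lemma tdeg_fil i k x : tdeg i k x -> tfil k x.
Proof. exact: tmem_sub. Qed.

Lemma tdeg_maxid i x : tdeg i 1 x <-> tmem (homog (dgl_gr N) i) (@maxid K A) x.
Proof. by split; apply: tmem_sub => // a /mpow1. Qed.

Lemma tfil_vanish : exists n, forall m, (n <= m)%N -> forall x, tfil m x -> x = 0.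
Proof.
have [n mn] := maxid_nilpotent A; exists n => m nm x [s [hs ->]].
rewrite big_seq big1 // => p /hs[_ /(mpow_le nm) /mn ->].
exact: tens0r.
Qed.

Lemma brAl y : linear (fun x => brA x y).
Proof. exact: (brA_bilinear A N).2. Qed.

Lemma brAr x : linear (brA x).
Proof. exact: (brA_bilinear A N).1. Qed.

Lemma brA0l y : brA 0 y = 0. Proof. exact: linear_map0 (brAl y). Qed.
Lemma brA0r x : brA x 0 = 0. Proof. exact: linear_map0 (brAr x). Qed.
Lemma brADl x x' y : brA (x + x') y = brA x y + brA x' y.
Proof. exact: linear_mapD (brAl y) _ _. Qed.
Lemma brADr x y y' : brA x (y + y') = brA x y + brA x y'.
Proof. exact: linear_mapD (brAr x) _ _. Qed.
Lemma brAZl a x y : brA (a *: x) y = a *: brA x y.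
Proof. exact: linear_mapZ (brAl y) _ _. Qed.
Lemma brAZr a x y : brA x (a *: y) = a *: brA x y.
Proof. exact: linear_mapZ (brAr x) _ _. Qed.
Lemma brANl x y : brA (- x) y = - brA x y.
Proof. by rewrite -scaleN1r brAZl scaleN1r. Qed.
Lemma brANr x y : brA x (- y) = - brA x y.
Proof. by rewrite -scaleN1r brAZr scaleN1r. Qed.
Lemma brABl x x' y : brA (x - x') y = brA x y - brA x' y.
Proof. by rewrite brADl brANl. Qed.
Lemma brABr x y y' : brA x (y - y') = brA x y - brA x y'.
Proof. by rewrite brADr brANr. Qed.

Lemma dA_linear : linear (@dA K A N).
Proof. by apply: tmap_linear => //; exact: dgl_d_linear. Qed.

Lemma dA0 : dA (0 : tensor N A) = 0. Proof. exact: linear_map0 dA_linear. Qed.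
Lemma dAD x y : dA (x + y) = dA x + dA y. Proof. exact: linear_mapD dA_linear _ _. Qed.
Lemma dAZ a x : dA (a *: x) = a *: dA x. Proof. exact: linear_mapZ dA_linear _ _. Qed.
Lemma dAN x : dA (- x) = - dA x. Proof. by rewrite -scaleN1r dAZ scaleN1r. Qed.
Lemma dAB x y : dA (x - y) = dA x - dA y. Proof. by rewrite dAD dAN. Qed.

Lemma dA_tens (u : N) (a : A) : dA (tens u a) = tens (dgl_d u) a.
Proof. by rewrite /dA tmap_tens //; exact: dgl_d_linear. Qed.

Lemma dA_dA x : dA (dA x) = 0.
Proof.
move: x; apply: (@linear_tensor_eq _ _ _ _ (@dA K A N \o @dA K A N) (fun=> 0)).
- exact: linear_comp dA_linear dA_linear.
- exact: linear_cst0.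
by move=> v a /=; rewrite !dA_tens dgl_dd tens0l.
Qed.

Lemma dA_deg i k x : tdeg i k x -> tdeg (i + 1) k (dA x).
Proof.
apply: tmem_tmap; [exact: dgl_d_linear | exact: homog_subsp | exact: dgl_d_deg].
Qed.

Lemma dA_fil k x : tfil k x -> tfil k (dA x).
Proof. by apply: tmem_tmap => //; exact: dgl_d_linear. Qed.

Lemma brA_deg i i' k k' x y :
  tdeg i k x -> tdeg i' k' y -> tdeg (i + i') (k + k') (brA x y).
Proof.
move=> + dy; apply: (tmem_in (brAl y) (tdeg_subsp _ _)) => u a hu ha.
move: dy; apply: (tmem_in (brAr _) (tdeg_subsp _ _)) => v b hv hb.
rewrite brA_tens; apply: tmem_tens; last exact: mpowD.
exact: dgl_br_deg.
Qed.

Lemma brA_fil k k' x y : tfil k x -> tfil k' y -> tfil (k + k') (brA x y).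
Proof.
move=> + dy; apply: (tmem_in (brAl y) (tfil_subsp _)) => u a hu ha.
move: dy; apply: (tmem_in (brAr _) (tfil_subsp _)) => v b hv hb.
by rewrite brA_tens; apply: tmem_tens => //; exact: mpowD.
Qed.

Lemma brA_antisym i (j : int) k k' x y : tdeg i k x -> tdeg j k' y ->
  brA x y = - ((-1) ^ (i * j)) *: brA y x.
Proof.
move=> + dy.
apply: (tmem_eq (brAl y) (linear_scale (- (-1) ^ (i * j)) (brAr y))) => u a hu ha.
move: dy; apply: (tmem_eq (brAr _) (linear_scale (- (-1) ^ (i * j)) (brAl _))).
move=> v b hv hb; rewrite !brA_tens (dgl_antisym hu hv) [b * a]mulrC.
exact: linear_mapZ ((tens_bilinear _ _).2 _) _ _.
Qed.

Lemma brA_leibniz i k x y : tdeg i k x ->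
  dA (brA x y) = brA (dA x) y + ((-1) ^ i) *: brA x (dA y).
Proof.
apply: (@tmem_eq _ _ _ _ _ _ (fun x => dA (brA x y))
    (fun x => brA (dA x) y + ((-1) ^ i) *: brA x (dA y))).
- exact: linear_comp dA_linear (brAl y).
- apply: linear_add; first exact: linear_comp (brAl y) dA_linear.
  exact: linear_scale (brAl (dA y)).
move=> u a hu ha; move: y; apply: (@linear_tensor_eq _ _ _ _ (fun y => dA (brA (tens u a) y))
   (fun y : tensor N A => brA (dA (tens u a)) y + (-1) ^ i *: brA (tens u a) (dA y))).
- exact: linear_comp dA_linear (brAr _).
- apply: linear_add; first exact: brAr.
  exact: linear_scale (linear_comp (brAr _) dA_linear).
move=> v b /=; rewrite !dA_tens !brA_tens dA_tens (dgl_leibniz _ hu).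
rewrite (linear_mapD ((tens_bilinear _ _).2 _)).
by rewrite (linear_mapZ ((tens_bilinear _ _).2 _)).
Qed.

Lemma brA_jacobi i (j : int) k k' x y z : tdeg i k x -> tdeg j k' y ->
  brA x (brA y z) = brA (brA x y) z + ((-1) ^ (i * j)) *: brA y (brA x z).
Proof.
move=> + dy; apply: (@tmem_eq _ _ _ _ _ _ (fun x => brA x (brA y z))
    (fun x => brA (brA x y) z + ((-1) ^ (i * j)) *: brA y (brA x z))).
- exact: brAl.
- apply: linear_add; first exact: (linear_comp (brAl z) (brAl y)).
  exact: linear_scale (linear_comp (brAr y) (brAl z)).
move=> u a hu ha; move: dy; apply: (@tmem_eq _ _ _ _ _ _ (fun y => brA (tens u a) (brA y z))
    (fun y => brA (brA (tens u a) y) z + ((-1) ^ (i * j)) *: brA y (brA (tens u a) z))).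
- exact: (linear_comp (brAr _) (brAl z)).
- apply: linear_add; first exact: (linear_comp (brAl z) (brAr _)).
  exact: linear_scale (brAl _).
move=> v b hv hb; move: z; apply: (@linear_tensor_eq _ _ _ _
   (fun z => brA (tens u a) (brA (tens v b) z)) (fun z => brA (brA (tens u a) (tens v b)) z +
      (-1) ^ (i * j) *: brA (tens v b) (brA (tens u a) z))).
- exact: linear_comp (brAr _) (brAr _).
- apply: linear_add; first exact: brAr.
  exact: linear_scale (linear_comp (brAr _) (brAr _)).
move=> w c /=; rewrite !brA_tens (dgl_jacobi _ hu hv) mulrA [b * (a * c)]mulrCA mulrA.
rewrite (linear_mapD ((tens_bilinear _ _).2 _)).
by rewrite (linear_mapZ ((tens_bilinear _ _).2 _)).
Qed.

Lemma iter_brA_fil n k x y : tfil 1 x -> tfil k y -> tfil (n + k) (iter n (brA x) y).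
Proof.
move=> hx hy; elim: n => //= n IH; rewrite addSn -add1n; exact: brA_fil.
Qed.

Lemma nilop_brA x : tfil 1 x -> nilop (brA x).
Proof.
move=> hx; split; first exact: brAr.
have [n hn] := tfil_vanish; exists n => v.
by apply: (hn (n + 0)%N); [rewrite addn0 | exact: iter_brA_fil (tfil0 v)].
Qed.

End TensorDGLA.

Arguments tdeg_subsp {K A N}.
Arguments tfil_subsp {K A N}.
Arguments dA_linear {K A N}.

Section TensorMorphism.
Variables (K : fieldType) (A : art K) (N N' : dgla K) (phi : dgla_mor N N').
Implicit Types (x y : tensor N A).
Local Notation phiA := (@chiA K N N' phi A).

Lemma chiA_linear : linear phiA.
Proof. by apply: tmap_linear => //; exact: dgm_linear. Qed.

Lemma chiA_tens u (a : A) : phiA (tens u a) = tens (phi u) a.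
Proof. by rewrite /chiA tmap_tens //; exact: dgm_linear. Qed.

Lemma chiA_dA x : phiA (dA x) = dA (phiA x).
Proof.
move: x; apply: (@linear_tensor_eq _ _ _ _ (phiA \o @dA K A N) (@dA K A N' \o phiA)).
- exact: linear_comp chiA_linear (dA_linear).
- exact: linear_comp (dA_linear) chiA_linear.
by move=> v a /=; rewrite chiA_tens !dA_tens chiA_tens dgm_d.
Qed.

Lemma chiA_brA x y : phiA (brA x y) = brA (phiA x) (phiA y).
Proof.
move: x; apply: (@linear_tensor_eq _ _ _ _ (fun x => phiA (brA x y))
  (fun x => brA (phiA x) (phiA y))).
- exact: linear_comp chiA_linear (@brAl K A N y).
- exact: linear_comp (@brAl K A N' _) chiA_linear.
move=> u a; move: y; apply: (@linear_tensor_eq _ _ _ _ (fun y => phiA (brA (tens u a) y))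
  (fun y => brA (phiA (tens u a)) (phiA y))).
- exact: linear_comp chiA_linear (@brAr K A N _).
- exact: linear_comp (@brAr K A N' _) chiA_linear.
by move=> v b; rewrite !chiA_tens !brA_tens chiA_tens dgm_br.
Qed.

Lemma chiA_deg i k x : tdeg i k x -> tdeg i k (phiA x).
Proof.
apply: tmem_tmap; [exact: dgm_linear | exact: homog_subsp | exact: dgm_deg].
Qed.

Lemma chiA_fil k x : tfil k x -> tfil k (phiA x).
Proof. by apply: tmem_tmap => //; exact: dgm_linear. Qed.

End TensorMorphism.

(** * Gauge action and Baker-Campbell-Hausdorff product *)

Section GaugeAction.
Variables (K : fieldType) (A : art K) (N : dgla K).
Implicit Types a x y z : tensor N A.

(* e^a * y *)
Definition gact a y := y + pws (@expc1 K) (brA a) (brA a y - dA a).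

Definition curv y := dA y + 2%:R^-1 *: brA y y.

Lemma is_gaugeP a y z : tfil 1 a -> is_gauge a y z <-> z = gact a y.
Proof.
move=> ha; have h := pws_sums_to (@expc1 K) (brA a y - dA a) (nilop_brA ha).
split=> [h'|->]; last by rewrite /is_gauge /gact addrAC subrr add0r.
by rewrite /gact -(sums_to_uniq h' h) addrC subrK.
Qed.

Lemma gact_deg k a y : tdeg 0 1 a -> tdeg 0 k a -> tdeg 1 k y -> tdeg 1 k (gact a y).
Proof.
move=> ha hak hy; rewrite /gact; apply: (subspD (tdeg_subsp _ _)) => //.
have br v : tdeg 1 k v -> tdeg 1 k (brA a v).
  move=> hv; apply: (@tdegW _ _ _ _ _ (1 + k)); first exact: leqnSn.
  by rewrite -[1]add0r; exact: brA_deg.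
apply: (subsp_pws (tdeg_subsp _ _)) => //.
apply: (subspB (tdeg_subsp _ _)); first exact: br.
by rewrite -[1]add0r; exact: dA_deg.
Qed.

Lemma gact0 y : gact 0 y = y.
Proof.
rewrite /gact brA0l dA0 subrr (linear_map0 (pws_linear _ _)) ?addr0 //.
exact: nilop_brA (tfil_subsp _).1.
Qed.

Hypothesis charK0 : [pchar K] =i pred0.

Lemma gact_exp a y : tfil 1 a ->
  gact a y = pws (@expc K) (brA a) y - pws (@expc1 K) (brA a) (dA a).
Proof.
move=> /nilop_brA ha; have fl := pws_linear (@expc1 K) ha.
rewrite /gact (pws_exp_recl ha) (pws_commute _ _ ha) -addrA; congr (_ + _).
by rewrite (linear_mapD fl) -scaleN1r (linear_mapZ fl) scaleN1r.
Qed.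

Lemma brA_oppl a : brA (- a) = (fun v => - brA a v).
Proof. by apply: funext => v; rewrite brANl. Qed.

(** The action is affine in y: the linear parts cancel by e^(-x) e^x = 1, the translation parts by
    e^(-x) (e^x - 1) / x = (1 - e^(-x)) / x. *)
Lemma gactK a y : tfil 1 a -> gact (- a) (gact a y) = y.
Proof.
move=> ha; have na := nilop_brA ha; have na' := nilop_opp na.
have hNa := subspN (tfil_subsp 1) ha.
have el := pws_linear (@expc K) na'; have fl := pws_linear (@expc1 K) na'.
rewrite gact_exp // gact_exp // brA_oppl dAN.
rewrite (linear_mapD el) (pws_expN_exp charK0 na) -[- pws _ (brA a) _]scaleN1r.
rewrite (linear_mapZ el) -[- dA a]scaleN1r (linear_mapZ fl) !scaleN1r opprK -addrA.
rewrite -[RHS]addr0; congr (_ + _).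
rewrite -[X in _ + X](pws_exp_expc1N charK0 na').
by under [X in _ + pws _ _ (pws _ X _)]funext do rewrite opprK; rewrite addNr.
Qed.

Lemma gactNK a y : tfil 1 a -> gact a (gact (- a) y) = y.
Proof.
move=> /(subspN (tfil_subsp 1)) /gactK => /(_ y); by rewrite opprK.
Qed.

(* Maurer-Cartan curvature as the restriction of a symmetric form on V x K: with
   a acting on V x K by (v, c) |-> ([a, v] - c da, 0), one has
   e^a (y, 1) = (e^a * y, 1). *)
Section Curvature.
Let V : lmodType K := tensor N A.
Let W : lmodType K := (V * K^o)%type.

Let hat a (w : W) : W := (brA a w.1 - w.2 *: (dA a : V), 0).

Let hat_linear a : linear (hat a).
Proof.
move=> c u v; congr pair => /=; last by rewrite scaler0 addr0.
rewrite brADr brAZr scalerDl scalerBr -scalerA opprD addrACA; congr (_ + _ + _).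
Qed.

Let hat_nilop a : tfil 1 a -> nilop (hat a).
Proof.
move=> ha; split; first exact: hat_linear.
have [_ [n hn]] := nilop_brA ha; exists n.+1 => w.
suff -> : iter n.+1 (hat a) w = (iter n (brA a) (brA a w.1 - w.2 *: (dA a : V)), 0).
  by rewrite hn.
by elim: n {hn} => [|n IH] //; rewrite iterS IH /hat /= scale0r subr0.
Qed.

Let pws_hat a y : tfil 1 a -> pws (@expc K) (hat a) (y, 1) = (gact a y, 1).
Proof.
move=> ha; have nh := hat_nilop ha.
rewrite pws_recl // /expc fact0 invr1 scale1r.
have -> : hat a (y, 1) = (brA a y - dA a, 0) by rewrite /hat /= scale1r.
rewrite -(@pws_morph _ _ V W (brA a) (hat a) (fun v : V => (v, 0) : W)) //.
- by rewrite /gact; congr pair; rewrite /= addr0.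
- exact: nilop_brA.
- by move=> c u v; congr pair; rewrite /= scaler0 addr0.
- by move=> v; rewrite /hat /= scale0r subr0.
Qed.

Let form (w w' : W) : V :=
  2%:R^-1 *: (w.2 *: (dA w'.1 : V) + w'.2 *: (dA w.1 : V) + brA w.1 w'.1).

Let form_bilinear : bilinear_map form.
Proof.
split=> w; rewrite /form; apply: linear_scale; apply: linear_add.
- apply: linear_add.
    by apply: linear_scale; exact: linear_comp (dA_linear) (fun _ _ _ => erefl).
  by move=> c u v; rewrite /= scalerDl scalerA.
- exact: linear_comp (brAr _) (fun _ _ _ => erefl).
- apply: linear_add; first by move=> c u v; rewrite /= scalerDl scalerA.
  by apply: linear_scale; exact: linear_comp (dA_linear) (fun _ _ _ => erefl).
- exact: linear_comp (brAl _) (fun _ _ _ => erefl).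
Qed.

(** By the Leibniz and Jacobi identities, the symmetric form intertwines [hat a] with the bracket by
    a on vectors of degree 1; [pws_exp_bilinear] passes from this to the exponentials. *)
Lemma curv_gact a y : tdeg 0 1 a -> tdeg 1 0 y ->
  curv (gact a y) = pws (@expc K) (brA a) (curv y).
Proof.
move=> ha hy; have ha1 := tdeg_fil ha; have n2 := natK_neq0 charK0 (ltn0Sn 1).
have F v : form (v, 1) (v, 1) = curv v.
  rewrite /form /curv /= !scale1r scalerDr; congr (_ + _).
  by rewrite -mulr2n -[dA v *+ 2]scaler_nat scalerA mulVf // scale1r.
rewrite -!F -(pws_hat _ ha1); apply/esym.
pose P : set W := [set w | tdeg 1 0 w.1]%classic.
have hP w : P w -> P (hat a w).
  move=> hw; rewrite /P /=; apply: (subspB (tdeg_subsp _ _)).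
    apply: (@tdegW _ _ _ _ _ (1 + 0)) => //.
    by rewrite -[1]add0r; exact: brA_deg.
  apply: (subspZ (tdeg_subsp _ _)); apply: (@tdegW _ _ _ _ _ 1) => //.
  by rewrite -[1]add0r; exact: dA_deg.
apply: (pws_exp_bilinear charK0 (P := P) (Q := P)) => //.
- exact: hat_nilop.
- exact: hat_nilop.
- exact: nilop_brA.
move=> [v c] [v' c'] hv hv'.
have hda : tdeg 1 1 (dA a) by rewrite -[1]add0r; exact: dA_deg.
have S : brA v (dA a) = brA (dA a) v.
  by rewrite (brA_antisym hv hda) mul1r expr1z opprK scale1r.
rewrite /form /= brAZr -scalerDr; congr (_ *: _).
rewrite !scale0r !add0r !addr0 !dAB !dAZ dA_dA scaler0 !subr0 !brADr !brAZr.
rewrite !(brA_leibniz _ ha) expr0z !scale1r !brABl !brAZl ?brAZr.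
rewrite (brA_jacobi v' ha hv) mul0r expr0z scale1r S !scalerDr.
rewrite /= !scaler0 oppr0 scaler0 addr0 scaleN1r.
by rewrite [RHS](AC ((2*2)*(2*2)) (((6*2)*(3*7))*(1*8)*(4*5)))/= addrN addNr !addr0.
Qed.

End Curvature.

Lemma curv_gact_eq0 a y : tdeg 0 1 a -> tdeg 1 0 y -> curv y = 0 -> curv (gact a y) = 0.
Proof.
move=> ha hy y0; rewrite curv_gact // y0.
exact: linear_map0 (pws_linear _ (nilop_brA (tdeg_fil ha))).
Qed.

End GaugeAction.

Section GaugeMorphism.
Variables (K : fieldType) (A : art K) (N N' : dgla K) (phi : dgla_mor N N').
Local Notation phiA := (@chiA K N N' phi A).

Lemma chiA_pws c a y : tfil 1 a -> phiA (pws c (brA a) y) = pws c (brA (phiA a)) (phiA y).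
Proof.
move=> ha; apply: pws_morph; first exact: nilop_brA.
- by apply: nilop_brA; exact: chiA_fil.
- exact: chiA_linear.
- by move=> v; rewrite chiA_brA.
Qed.

Lemma chiAD x y : phiA (x + y) = phiA x + phiA y.
Proof. exact: linear_mapD (@chiA_linear K A N N' phi) _ _. Qed.

Lemma chiAZ c x : phiA (c *: x) = c *: phiA x.
Proof. exact: linear_mapZ (@chiA_linear K A N N' phi) _ _. Qed.

Lemma chiAN x : phiA (- x) = - phiA x.
Proof. by rewrite -scaleN1r chiAZ scaleN1r. Qed.

Lemma chiA0 : phiA 0 = 0.
Proof. exact: linear_map0 (@chiA_linear K A N N' phi). Qed.

Lemma chiA_gact a y : tfil 1 a -> phiA (gact a y) = gact (phiA a) (phiA y).
Proof.
move=> ha; rewrite /gact chiAD chiA_pws // chiAD chiAN chiA_brA.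
by rewrite chiA_dA.
Qed.

Lemma chiA_curv y : phiA (curv y) = curv (phiA y).
Proof. by rewrite /curv chiAD chiAZ chiA_brA chiA_dA. Qed.

End GaugeMorphism.

Section BCH.
Variables (K : fieldType) (A : art K) (N : dgla K).
Implicit Types x y z : tensor N A.

Definition bch_cst x y (p k : nat) : tensor N A :=
  if k == 0%N then x + (-1) ^+ p *: y else 0.

Lemma size_bch_seq x y n : size (bch_seq x y n) = n.+1.
Proof. by elim: n => //= n IH; rewrite size_rcons IH. Qed.

Lemma nth_bch_seq x y n k : (k <= n)%N -> (bch_seq x y n)`_k = bch_term x y k.
Proof.
elim: n => [|n IH]; first by case: k.
rewrite leq_eqVlt => /predU1P[->//|]; rewrite ltnS => kn.
by rewrite /= nth_rcons size_bch_seq ltnS kn IH.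
Qed.

(** Coefficients up to n involve only the coefficients of z up to n, so the finite list available to
    [bch_next] may be replaced with the whole series. *)
Lemma eq_ad_series (z z' u : nat -> tensor N A) n p m :
  (forall k, (k <= n)%N -> z k = z' k) -> (m <= n)%N ->
  iter p (ad_series z) u m = iter p (ad_series z') u m.
Proof.
move=> zz; elim: p m => //= p IH m mn; apply: eq_bigr => k _.
have km : (k <= m)%N by rewrite -ltnS.
by rewrite zz ?IH // ?(leq_trans km) // (leq_trans (leq_subr _ _)).
Qed.

Lemma bch_term0 x y : bch_term x y 0 = 0.
Proof. by []. Qed.

Lemma bch_termS x y n : bch_term x y n.+1 = (n.+1%:R)^-1 *:
  \sum_(p < n.+1) bernc K p *: iter p (ad_series (bch_term x y)) (bch_cst x y p) n.
Proof.
rewrite {1}/bch_term /= nth_rcons size_bch_seq ltnn eqxx; congr (_ *: _).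
apply: eq_bigr => p _; congr (_ *: _); apply: eq_ad_series (leqnn n) => k kn.
exact: nth_bch_seq.
Qed.

(** Each z_n is a Lie polynomial, homogeneous of degree n in x and y. Suitable families P yield the
    filtration, the degree, stability of subalgebras (P constant) and the collapse of the series
    when all brackets vanish. *)
Lemma bch_term_graded (P : nat -> set (tensor N A)) x y :
  (forall n, subsp (P n)) ->
  (forall i j u v, P i u -> P j v -> P (i + j)%N (brA u v)) ->
  P 1%N x -> P 1%N y -> forall n, P n (bch_term x y n).
Proof.
move=> sP Pbr Px Py n; elim/ltn_ind: n => -[|n] IH; first exact: (sP 0%N).1.
rewrite bch_termS; apply: (subspZ (sP _)); apply: (subsp_sum (sP _)) => p _.
apply: (subspZ (sP _)).
(* The coefficient of t^m has weight m + 1: the indices of the z_k add up to m, and the innermost x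
   or y counts for one more. *)
suff H m : (m <= n)%N ->
    P m.+1 (iter p (ad_series (bch_term x y)) (bch_cst x y p) m) by exact: H.
move: {1}(nat_of_ord p) => q; elim: q m => [|q IHq] m mn /=.
  rewrite /bch_cst; case: eqP => [->|_]; last exact: (sP _).1.
  by apply: (subspD (sP _)) => //; exact: (subspZ (sP _)).
apply: (subsp_sum (sP _)) => k _; have km : (k <= m)%N by rewrite -ltnS.
rewrite (_ : P m.+1 = P (k + (m - k).+1)%N); last by rewrite addnS subnKC.
apply: Pbr; first by apply: IH; rewrite ltnS (leq_trans km).
by apply: IHq; rewrite (leq_trans (leq_subr _ _)).
Qed.

Lemma bch_term_fil x y n : tfil 1 x -> tfil 1 y -> tfil n (bch_term x y n).
Proof.
move=> hx hy; apply: (@bch_term_graded (@tfil K A N)) => //; first exact: tfil_subsp.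
exact: brA_fil.
Qed.

Lemma bch_term_deg x y n : tdeg 0 1 x -> tdeg 0 1 y -> tdeg 0 n (bch_term x y n).
Proof.
move=> hx hy; apply: bch_term_graded => // [k|i j u v hu hv]; first exact: tdeg_subsp.
by have := brA_deg hu hv; rewrite addr0.
Qed.

(* log(e^x e^y) *)
Definition bch x y : tensor N A := xget 0 [set z | is_expmul x y z]%classic.

Lemma bch_expmul x y : tfil 1 x -> tfil 1 y -> is_expmul x y (bch x y).
Proof.
move=> hx hy; rewrite /bch; case: xgetP => [z _ //|h].
have [n hn] := tfil_vanish A N; have := @sums_to_fin _ (bch_term x y) n.
move=> H; case: (h (\sum_(k < n) bch_term x y k)); apply: H => k nk.
by apply: (hn k nk); exact: bch_term_fil.
Qed.

Lemma is_expmulP x y z : tfil 1 x -> tfil 1 y -> is_expmul x y z <-> z = bch x y.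
Proof.
move=> hx hy; split=> [h|->]; last exact: bch_expmul.
exact: sums_to_uniq h (bch_expmul hx hy).
Qed.

Lemma bchE x y : tfil 1 x -> tfil 1 y -> exists n, forall m, (n <= m)%N ->
  bch x y = \sum_(k < m) bch_term x y k.
Proof.
by move=> hx hy; have [n hn] := bch_expmul hx hy; exists n => m /hn.
Qed.

Lemma bch_sub (P : set (tensor N A)) x y : subsp P ->
  (forall u v, P u -> P v -> P (brA u v)) -> tfil 1 x -> tfil 1 y -> P x -> P y ->
  P (bch x y).
Proof.
move=> sP Pbr hx hy Px Py; have [n /(_ _ (leqnn n)) ->] := bchE hx hy.
by apply: (subsp_sum sP) => k _; apply: (@bch_term_graded (fun=> P)).
Qed.

Lemma bch_deg x y : tdeg 0 1 x -> tdeg 0 1 y -> tdeg 0 1 (bch x y).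
Proof.
move=> hx hy; apply: bch_sub (tdeg_fil hx) (tdeg_fil hy) hx hy; first exact: tdeg_subsp.
by move=> u v hu hv; have := tdegW (leqnSn 1) (brA_deg hu hv); rewrite addr0.
Qed.

Hypothesis charK0 : [pchar K] =i pred0.

Lemma bernc0 : bernc K 0 = 1.
Proof.
have := bernoulli_gf 0 charK0; rewrite big_ord_recl big_ord0 addr0 /=.
by rewrite subn0 (_ : 1`! = 1%N) // divr1.
Qed.

Lemma bch_comm x y : tfil 1 x -> tfil 1 y ->
  brA x x = 0 -> brA x y = 0 -> brA y x = 0 -> brA y y = 0 -> bch x y = x + y.
Proof.
move=> hx hy xx xy yx yy.
(* Combinations of x and y in weight 1, zero in all other weights; this is stable under brackets
   since all of them vanish. *)
pose P n : set (tensor N A) :=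
  [set u | exists a b, u = a *: x + b *: y /\ ((n != 1)%N -> u = 0)]%classic.
have P0 n : P n 0 by exists 0, 0; rewrite !scale0r addr0.
have Pt n : P n (bch_term x y n).
  apply: (@bch_term_graded P).
  - move=> k; split=> [|c u v [a [b [uE u0]]] [a' [b' [vE v0]]]]; first exact: P0.
    exists (c * a + a'), (c * b + b'); split.
      by rewrite uE vE !scalerDl scalerDr !scalerA addrACA.
    by move=> k1; rewrite u0 // v0 // scaler0 addr0.
  - move=> i j u v [a [b [-> _]]] [a' [b' [-> _]]].
    rewrite !brADl !brADr !brAZl !brAZr xx xy yx yy !scaler0 !addr0; exact: P0.
  - by exists 1, 0; rewrite scale1r scale0r addr0.
  - by exists 0, 1; rewrite scale1r scale0r add0r.
have [n hn] := bchE hx hy; rewrite (hn n.+2 (leqW (leqnSn n))).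
rewrite big_ord_recl big_ord_recl bch_term0 add0r big1 ?addr0 => [|k _].
  rewrite bch_termS big_ord_recl big_ord0 addr0 bernc0 invr1 !scale1r /=.
  by rewrite /bch_cst eqxx expr0 scale1r.
by have [a [b [_ ->]]] := Pt (lift ord0 (lift ord0 k)).
Qed.

Lemma brA_deg0_self x : tdeg 0 0 x -> brA x x = 0.
Proof.
move=> hx; have := brA_antisym hx hx; rewrite mul0r expr0z scaleN1r => /eqP.
rewrite -addr_eq0 -mulr2n -scaler_nat scaler_eq0 => /orP[|/eqP//].
by rewrite (negPf (natK_neq0 charK0 (ltn0Sn 1))).
Qed.

Lemma bch0r x : tdeg 0 1 x -> bch x 0 = x.
Proof.
move=> hx; have xx : brA x x = 0 by apply: brA_deg0_self; exact: tdegW hx.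
by rewrite (bch_comm (tdeg_fil hx) (tfil_subsp 1).1) ?addr0 ?brA0r ?brA0l.
Qed.

Lemma bch0l x : tdeg 0 1 x -> bch 0 x = x.
Proof.
move=> hx; have xx : brA x x = 0 by apply: brA_deg0_self; exact: tdegW hx.
by rewrite (bch_comm (tfil_subsp 1).1 (tdeg_fil hx)) ?add0r ?brA0r ?brA0l.
Qed.

End BCH.

Section BCHMorphism.
Variables (K : fieldType) (A : art K) (N N' : dgla K) (phi : dgla_mor N N').
Local Notation phiA := (@chiA K N N' phi A).

Lemma chiA_bch_term x y n : phiA (bch_term x y n) = bch_term (phiA x) (phiA y) n.
Proof.
have fl := @chiA_linear K A N N' phi.
elim/ltn_ind: n => -[|n] IH; first exact: chiA0.
rewrite !bch_termS chiAZ (linear_map_sum _ _ _ fl); congr (_ *: _).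
apply: eq_bigr => p _; rewrite chiAZ; congr (_ *: _).
suff H m : (m <= n)%N -> phiA (iter p (ad_series (bch_term x y)) (bch_cst x y p) m) =
  iter p (ad_series (bch_term (phiA x) (phiA y))) (bch_cst (phiA x) (phiA y) p) m.
  exact: H.
move: {1 3}(nat_of_ord p) => q; elim: q m => [|q IHq] m mn /=.
  rewrite /bch_cst; case: eqP => _; last exact: chiA0.
  by rewrite chiAD chiAZ.
rewrite (linear_map_sum _ _ _ fl); apply: eq_bigr => k _.
have km : (k <= m)%N by rewrite -ltnS.
by rewrite chiA_brA IH ?ltnS ?(leq_trans km) // IHq // (leq_trans (leq_subr _ _)).
Qed.

Lemma chiA_bch x y : tfil 1 x -> tfil 1 y -> phiA (bch x y) = bch (phiA x) (phiA y).
Proof.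
move=> hx hy; have [n hn] := bchE hx hy.
have [n' hn'] := bchE (chiA_fil phi hx) (chiA_fil phi hy).
rewrite (hn _ (leq_maxl n n')) (hn' _ (leq_maxr n n')).
rewrite (linear_map_sum _ _ _ (@chiA_linear K A N N' phi)).
by apply: eq_bigr => k _; rewrite chiA_bch_term.
Qed.

End BCHMorphism.

(** * Polynomial forms with values in a DGLA *)

Section Forms.
Variable K : fieldType.

(** The forms p and p dt, with form degree [e]. Together with homogeneous v they generate V[t,dt],
    and identities there are checked on the generators [tens v (fm e p)], where all signs can be
    read off. *)
Definition fm (e : bool) (p : {poly K}) : forms K := if e then (0, p) else (p, 0).

Lemma fm_linear e : linear (fm e).
Proof. by case: e => a x y; congr pair; rewrite /= ?scaler0 ?addr0. Qed.

Lemma fpart_fm b e p : fpart b (fm e p) = if b == e then fm e p else 0.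
Proof. by case: b e => [] []. Qed.

Lemma fpartE b (r : forms K) : fpart b r = fm b (if b then r.2 else r.1).
Proof. by case: b. Qed.

Lemma forms_split (r : forms K) : r = fm false r.1 + fm true r.2.
Proof. by case: r => p q; congr pair => /=; rewrite ?addr0 ?add0r. Qed.

Lemma fmul_fm e e' p q :
  fmul (fm e p) (fm e' q) = if e && e' then 0 else fm (e || e') (p * q).
Proof.
by case: e e' => [] []; rewrite /fmul /= ?mulr0 ?mul0r ?addr0 ?add0r.
Qed.

Lemma fdiff_fm e p : fdiff (fm e p) = if e then 0 else fm true p^`().
Proof. by case: e; rewrite /fdiff //= linear0. Qed.

End Forms.

Arguments fm : simpl never.

Section Signs.
Variable K : fieldType.

Definition sg (i : int) : K := (-1) ^ i.

Lemma sgD i j : sg (i + j) = sg i * sg j.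
Proof. by rewrite /sg expfzDr // oppr_eq0 oner_neq0. Qed.

Lemma sg0 : sg 0 = 1. Proof. exact: expr0z. Qed.
Lemma sg1 : sg 1 = -1. Proof. exact: expr1z. Qed.

Lemma sg_odd i : sg i = (-1) ^+ odd `|i|%N.
Proof.
rewrite /sg; case: i => n; first by rewrite -exprnP signr_odd.
by rewrite NegzE -exprnN invr_sign abszN absz_nat signr_odd.
Qed.

Lemma sgM1 i : sg i * sg i = 1.
Proof. by rewrite sg_odd -expr2 sqrr_sign. Qed.

End Signs.

Section FormGenerators.
Variables (K : fieldType) (V : lmodType K) (G : grading V).
Local Notation VF := (tensor V (forms K)).

(** The linear extension of v -> (-1)^|v| v, the sign produced when a form of degree 1 moves past
    v. *)
Definition gsgn (v : V) : V := \sum_(b : bool) (-1) ^+ b *: parity G b v.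

Lemma gsgn_linear : linear gsgn.
Proof. by apply: linear_sum => b _; apply: linear_scale; exact: parity_linear. Qed.

Lemma gsgn_homog i v : homog G i v -> gsgn v = sg K i *: v.
Proof.
move=> hv; rewrite sg_odd /gsgn (bigD1 (odd `|i|%N)) //= big1 ?addr0 => [|b bi].
  by rewrite (parity_homog _ hv) eqxx.
by rewrite (parity_homog _ hv) eq_sym (negPf bi) scaler0.
Qed.

Lemma gproj_homog i v : homog G i (gproj G i v).
Proof. by rewrite /homog /= gproj_proj eqxx. Qed.

Lemma tens_fm_homog (e : bool) i (j : int) v p : homog G j v -> i = j + e%:Z ->
  homog (form_grading G) i (tens v (fm e p)).
Proof.
move=> hv ->; rewrite /homog /= form_proj_tens !fpart_fm.
by case: e; rewrite /= tens0r ?add0r ?addr0 ?addrK hv.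
Qed.

(** An element of degree i is its own projection, and the projection of a pure tensor is a sum of
    generators v p with |v| = i and v p dt with |v| = i - 1. *)
Lemma form_homog_ind i (Q : set VF) x : subsp Q ->
  (forall (e : bool) (j : int) v p, homog G j v -> i = j + e%:Z -> Q (tens v (fm e p))) ->
  homog (form_grading G) i x -> Q x.
Proof.
move=> sQ h hx; rewrite -hx /=; have [s ->] := tensorE x.
rewrite (linear_map_sum _ _ _ (form_proj_linear G i)); apply: subsp_sum => // q _.
rewrite form_proj_tens !fpartE; apply: (subspD sQ).
  by apply: (h false i); [exact: gproj_homog | rewrite addr0].
by apply: (h true (i - 1)); [exact: gproj_homog | rewrite subrK].
Qed.

Lemma form_ind (Q : set VF) x : subsp Q ->
  (forall e j v p, homog G j v -> Q (tens v (fm e p))) -> Q x.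
Proof.
move=> sQ h; have [s _ ->] := form_proj_sum G x; apply: subsp_sum => // i _.
apply: (@form_homog_ind i Q) => // [e j v p hv _|]; first exact: h hv.
by rewrite /homog /= form_proj_proj eqxx.
Qed.

Lemma form_homog_in (U : lmodType K) (f : VF -> U) (R : set U) i x : linear f -> subsp R ->
  (forall (e : bool) (j : int) v p, homog G j v -> i = j + e%:Z -> R (f (tens v (fm e p)))) ->
  homog (form_grading G) i x -> R (f x).
Proof.
move=> fl sR h; apply: (@form_homog_ind i (fun x => R (f x))) => //.
exact: subsp_pre fl sR.
Qed.

Lemma form_homog_eq (U : lmodType K) (f g : VF -> U) i x : linear f -> linear g ->
  (forall (e : bool) (j : int) v p, homog G j v -> i = j + e%:Z -> f (tens v (fm e p)) = g (tens v (fm e p))) ->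
  homog (form_grading G) i x -> f x = g x.
Proof.
by move=> fl gl h; apply: (@form_homog_ind i (fun x => f x = g x)) => //; exact: subsp_eq.
Qed.

Lemma form_eq (U : lmodType K) (f g : VF -> U) x : linear f -> linear g ->
  (forall e j v p, homog G j v -> f (tens v (fm e p)) = g (tens v (fm e p))) ->
  f x = g x.
Proof.
by move=> fl gl h; apply: (@form_ind (fun x => f x = g x)) => //; exact: subsp_eq.
Qed.

End FormGenerators.

Section TensorBilinear.
Variables (K : fieldType) (V : lmodType K).
Implicit Types u v : V.

Lemma tensZl (W : lmodType K) a u (r : W) : tens (a *: u) r = a *: tens u r.
Proof. exact: linear_mapZ ((tens_bilinear _ _).2 _) _ _. Qed.

Lemma tensNl (W : lmodType K) u (r : W) : tens (- u) r = - tens u r.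
Proof. by rewrite -scaleN1r tensZl scaleN1r. Qed.

Lemma tensDl (W : lmodType K) u v (r : W) : tens (u + v) r = tens u r + tens v r.
Proof. exact: linear_mapD ((tens_bilinear _ _).2 _) _ _. Qed.

Lemma tensDr (W : lmodType K) u (r r' : W) : tens u (r + r') = tens u r + tens u r'.
Proof. exact: linear_mapD ((tens_bilinear _ _).1 _) _ _. Qed.

Lemma tensZr (W : lmodType K) a u (r : W) : tens u (a *: r) = a *: tens u r.
Proof. exact: linear_mapZ ((tens_bilinear _ _).1 _) _ _. Qed.

End TensorBilinear.

Section FormDGLA.
Variables (K : fieldType) (N : dgla K).
Local Notation G := (dgl_gr N).
Local Notation F := (tensor N (forms K)).
Implicit Types (u v w : N) (p q : {poly K}) (r : forms K) (x y z : F).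

(* d(u r) = (du) r + (-1)^|u| u dr *)
Definition fd_d0 u (r : forms K) : F := tens (dgl_d u) r + tens (gsgn G u) (fdiff r).

Lemma fd_d0_bilinear : bilinear_map fd_d0.
Proof.
split=> [u|r]; apply: linear_add.
- exact: (tens_bilinear _ _).1.
- exact: (linear_comp ((tens_bilinear N (forms K)).1 (gsgn G u)) (@fdiff_linear K)).
- exact: (linear_comp ((tens_bilinear N (forms K)).2 r) (@dgl_d_linear K N)).
- exact: (linear_comp ((tens_bilinear N (forms K)).2 (fdiff r)) (gsgn_linear G)).
Qed.

Definition fd_d : F -> F := tlift fd_d0.

Lemma fd_d_linear : linear fd_d.
Proof. exact: tlift_linear fd_d0_bilinear. Qed.

Lemma fd_d_fm e j u p : homog G j u -> fd_d (tens u (fm e p)) =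
  tens (dgl_d u) (fm e p) + (if e then 0 else sg K j *: tens u (fm true p^`())).
Proof.
move=> hu; rewrite /fd_d tlift_tens; last exact: fd_d0_bilinear.
rewrite /fd_d0 fdiff_fm (gsgn_homog hu); case: e; first by rewrite tens0r.
by rewrite tensZl.
Qed.

(* [u r, v s] = (-1)^(|r| |v|) [u, v] r s *)
Definition fd_br0 (u : N) (r : forms K) (v : N) (s : forms K) : F :=
  tens (dgl_br u v) (fmul (fpart false r) s) +
  tens (dgl_br u (gsgn G v)) (fmul (fpart true r) s).

Lemma fd_br0_bilinear u (r : forms K) : bilinear_map (fd_br0 u r).
Proof.
split=> [v|s]; apply: linear_add.
- exact: linear_comp ((tens_bilinear _ _).1 _) ((fmul_bilinear K).1 _).
- exact: linear_comp ((tens_bilinear _ _).1 _) ((fmul_bilinear K).1 _).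
- exact: linear_comp ((tens_bilinear _ _).2 _) ((dgl_br_bilinear N).1 u).
- apply: linear_comp ((tens_bilinear _ _).2 _) _.
  exact: linear_comp ((dgl_br_bilinear N).1 u) (gsgn_linear G).
Qed.

Lemma fd_br0_bilinear' v (s : forms K) : bilinear_map (fun u r => fd_br0 u r v s).
Proof.
split=> [u|r]; apply: linear_add.
- apply: linear_comp ((tens_bilinear _ _).1 _) _.
  exact: linear_comp ((fmul_bilinear K).2 _) (fpart_linear _).
- apply: linear_comp ((tens_bilinear _ _).1 _) _.
  exact: linear_comp ((fmul_bilinear K).2 _) (fpart_linear _).
- exact: linear_comp ((tens_bilinear _ _).2 _) ((dgl_br_bilinear N).2 v).
- exact: linear_comp ((tens_bilinear _ _).2 _) ((dgl_br_bilinear N).2 _).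
Qed.

Definition fd_br x y : F := tlift (fun u r => tlift (fd_br0 u r) y) x.

Lemma fd_br1_bilinear y : bilinear_map (fun u r => tlift (fd_br0 u r) y).
Proof.
have [s ->] := tensorE y; split=> [u|r].
  apply: (@linear_ext _ _ _ (fun r => \sum_(q <- s) fd_br0 u r q.1 q.2)).
    move=> r; rewrite tlift_sum; last exact: fd_br0_bilinear.
    by apply: eq_bigr => q _; rewrite tlift_tens //; exact: fd_br0_bilinear.
  by apply: linear_sum => q _; exact: (fd_br0_bilinear' _ _).1.
apply: (@linear_ext _ _ _ (fun u => \sum_(q <- s) fd_br0 u r q.1 q.2)).
  move=> u; rewrite tlift_sum; last exact: fd_br0_bilinear.
  by apply: eq_bigr => q _; rewrite tlift_tens //; exact: fd_br0_bilinear.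
by apply: linear_sum => q _; exact: (fd_br0_bilinear' _ _).2.
Qed.

Lemma fd_br_bilinear : bilinear_map fd_br.
Proof.
split=> [x|y]; last exact: tlift_linear (fd_br1_bilinear y).
move=> a y z; rewrite /fd_br /tlift /tsum scaler_sumr -big_split /=.
apply: eq_bigr => q _; exact: (tlift_linear (fd_br0_bilinear q.1 q.2)).
Qed.

Lemma fd_br_fm e e' j u v p q : homog G j v ->
  fd_br (tens u (fm e p)) (tens v (fm e' q)) =
  if e && e' then 0 else
    (if e then sg K j else 1) *: tens (dgl_br u v) (fm (e || e') (p * q)).
Proof.
move=> hv; rewrite /fd_br tlift_tens; last exact: fd_br1_bilinear.
rewrite tlift_tens; last exact: fd_br0_bilinear.
rewrite /fd_br0 !fpart_fm (gsgn_homog hv).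
have z s : fmul (0 : forms K) s = 0 by exact: linear_map0 ((fmul_bilinear K).2 s).
case: e => /=; rewrite ?z ?tens0r ?add0r ?addr0 fmul_fm /=; last by rewrite scale1r.
rewrite (linear_mapZ ((dgl_br_bilinear N).1 u)); case: e' => /=.
  by rewrite tens0r.
by rewrite tensZl.
Qed.

Let drl x : linear (fd_br x) := fd_br_bilinear.1 x.
Let dll y : linear (fd_br^~ y) := fd_br_bilinear.2 y.
Let dl := fd_d_linear.

Lemma fd_d_deg i x : homog (form_grading G) i x -> homog (form_grading G) (i + 1) (fd_d x).
Proof.
have sH := homog_subsp (form_grading G) (i + 1).
apply: (form_homog_in dl sH) => e j v p hv ->.
rewrite (fd_d_fm _ _ hv); apply: subspD.
- exact: homog_subsp.
- by apply: (tens_fm_homog _ (dgl_d_deg hv)); rewrite addrAC.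
case: e => /=; first exact: (homog_subsp _ _).1.
apply: subspZ; first exact: homog_subsp.
by apply: (tens_fm_homog _ hv); rewrite addr0.
Qed.

Lemma fd_br_deg i i' x y : homog (form_grading G) i x -> homog (form_grading G) i' y ->
  homog (form_grading G) (i + i') (fd_br x y).
Proof.
have sH := homog_subsp (form_grading G) (i + i'); move=> hx hy; move: hx.
apply: (form_homog_in (dll y) sH) => e j v p hv iE.
move: hy; apply: (form_homog_in (drl _) sH) => e' j' w q hw i'E.
rewrite (fd_br_fm _ _ _ _ _ hw); case: ifP => ee; first exact: sH.1.
apply: (subspZ sH); apply: (tens_fm_homog _ (dgl_br_deg hv hw)).
by rewrite iE i'E; case: e e' ee {iE i'E} => [] [] //= _; rewrite ?addr0 // ?addrA // addrAC.
Qed.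

Lemma fd_dd x : fd_d (fd_d x) = 0.
Proof.
move: x => x; apply: (@form_eq _ _ G _ (fun x => fd_d (fd_d x)) (fun=> 0)).
- exact: linear_comp dl dl.
- exact: linear_cst0.
move=> e j v p hv; rewrite (fd_d_fm _ _ hv) (linear_mapD dl) (fd_d_fm _ _ (dgl_d_deg hv)).
rewrite dgl_dd tens0l add0r; case: e; first by rewrite (linear_map0 dl) addr0.
by rewrite (linear_mapZ dl) (fd_d_fm _ _ hv) addr0 sgD sg1 mulrN1 scaleNr addNr.
Qed.

Lemma fd_antisym i i' x y : homog (form_grading G) i x -> homog (form_grading G) i' y ->
  fd_br x y = - ((-1) ^ (i * i')) *: fd_br y x.
Proof.
move=> hx hy; move: hx.
apply: (form_homog_eq (dll y) (linear_scale _ (drl y))) => e j u p hu iE.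
move: hy; apply: (form_homog_eq (drl _) (linear_scale _ (dll _))) => e' j' v q hv i'E.
rewrite -/(sg K _) iE i'E {iE i'E} /= (fd_br_fm _ _ _ _ _ hv) (fd_br_fm _ _ _ _ _ hu).
rewrite andbC (dgl_antisym hu hv) -/(sg K _) tensZl orbC [q * p]mulrC.
case: e e' => [] [] /=; rewrite ?scaler0 // !scalerA ?addr0 ?mulr1 ?mul1r //.
- by rewrite mulrDl mul1r sgD mulrN mulrC.
- by rewrite mulrDr mulr1 sgD mulNr -mulrA sgM1 mulr1.
Qed.

Lemma fd_leibniz i x y : homog (form_grading G) i x ->
  fd_d (fd_br x y) = fd_br (fd_d x) y + ((-1) ^ i) *: fd_br x (fd_d y).
Proof.
rewrite -/(sg K _); apply: (@form_homog_eq _ _ _ _ (fun x => fd_d (fd_br x y))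
    (fun x => fd_br (fd_d x) y + sg K i *: fd_br x (fd_d y))).
- exact: linear_comp dl (dll y).
- apply: linear_add; first exact: linear_comp (dll y) dl.
  exact: linear_scale (dll (fd_d y)).
move=> e j u p hu ->; apply: (@form_eq _ _ G _ (fun y => fd_d (fd_br (tens u (fm e p)) y))
    (fun y => fd_br (fd_d (tens u (fm e p))) y
       + sg K (j + e) *: fd_br (tens u (fm e p)) (fd_d y))).
- exact: linear_comp dl (drl _).
- apply: linear_add; first exact: drl.
  exact: linear_scale (linear_comp (drl _) dl).
move=> e' j' v q hv; have hdv := dgl_d_deg hv; have hdu := dgl_d_deg hu.
have huv := dgl_br_deg hu hv.
rewrite (fd_br_fm _ _ _ _ _ hv) (fd_d_fm _ _ hu) (fd_d_fm _ _ hv).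
rewrite (linear_mapD (dll _)) (linear_mapD (drl _)) (fd_br_fm _ _ _ _ _ hv).
rewrite (fd_br_fm _ _ _ _ _ hdv).
case: e e' => [] [] /=;
  rewrite ?(linear_map0 dl) ?(linear_map0 (drl _)) ?(linear_map0 (dll _))
    ?(linear_mapZ dl) ?(linear_mapZ (drl _)) ?(linear_mapZ (dll _)) ?(fd_br_fm _ _ _ _ _ hv)
    ?(fd_d_fm _ _ huv) ?(dgl_leibniz _ hu) ?addr0 ?scaler0 ?addr0 //=
    -/(sg K _) !tensDl !tensZl ?scale1r ?scaler0 ?addr0 ?scalerDr ?scalerA.
- by congr (_ + _ *: _); rewrite !sgD !sg1; ring.
- by [].
rewrite derivM (linear_mapD (@fm_linear K true)) tensDr scalerDr sgD.
by rewrite [LHS](AC (2*2) ((1*3)*(2*4))).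
Qed.

Lemma fd_jacobi i i' x y z : homog (form_grading G) i x -> homog (form_grading G) i' y ->
  fd_br x (fd_br y z) = fd_br (fd_br x y) z + ((-1) ^ (i * i')) *: fd_br y (fd_br x z).
Proof.
rewrite -/(sg K _) => hx hy; move: hx.
apply: (@form_homog_eq _ _ _ _ (fun x => fd_br x (fd_br y z))
    (fun x => fd_br (fd_br x y) z + sg K (i * i') *: fd_br y (fd_br x z))).
- exact: dll.
- apply: linear_add; first exact: linear_comp (dll z) (dll y).
  exact: linear_scale (linear_comp (drl y) (dll z)).
move=> e j u p hu ->; move: hy.
apply: (@form_homog_eq _ _ _ _ (fun y => fd_br (tens u (fm e p)) (fd_br y z))
    (fun y => fd_br (fd_br (tens u (fm e p)) y) z +
      sg K ((j + e%:Z) * i') *: fd_br y (fd_br (tens u (fm e p)) z))).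
- exact: linear_comp (drl _) (dll z).
- apply: linear_add; first exact: linear_comp (dll z) (drl _).
  exact: linear_scale (dll _).
move=> e' j' v q hv ->.
apply: (@form_eq _ _ G _ (fun z => fd_br (tens u (fm e p)) (fd_br (tens v (fm e' q)) z))
    (fun z => fd_br (fd_br (tens u (fm e p)) (tens v (fm e' q))) z +
      sg K ((j + e%:Z) * (j' + e'%:Z)) *:
        fd_br (tens v (fm e' q)) (fd_br (tens u (fm e p)) z))).
- exact: linear_comp (drl _) (drl _).
- apply: linear_add; first exact: drl.
  exact: linear_scale (linear_comp (drl _) (drl _)).
move=> e'' j'' w r hw; have hvw := dgl_br_deg hv hw; have huw := dgl_br_deg hu hw.
rewrite !(fd_br_fm _ _ _ _ _ hw) (fd_br_fm _ _ _ _ _ hv).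
case: e e' e'' => [] [] [] /=;
  rewrite ?(linear_map0 (drl _)) ?(linear_map0 (dll _))
    ?(linear_mapZ (drl _)) ?(linear_mapZ (dll _)) ?(fd_br_fm _ _ _ _ _ hw)
    ?(fd_br_fm _ _ _ _ _ hvw) ?(fd_br_fm _ _ _ _ _ huw) /=
    ?scaler0 ?addr0 // (dgl_jacobi _ hu hv) tensDl tensZl -/(sg K _) !scalerDr !scalerA
    ?mul1r ?mulr1 ?addr0 [q * (p * r)]mulrCA [p * (q * r)]mulrA;
  congr (_ *: _ + _ *: _); rewrite ?mulrDl ?mulrDr ?mul1r ?mulr1 ?addr0 ?sgD //.
  by ring.
by rewrite -!mulrA [sg K j * (_ * _)]mulrA sgM1 mul1r mulrC.
Qed.

(** With this structure on N[t,dt], all that is proved of curvature, gauge action and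
    Baker-Campbell-Hausdorff products in an arbitrary DGLA applies to paths. *)
Definition form_dgla : dgla K :=
  @Dgla K F (form_grading G) fd_d fd_br fd_d_linear fd_br_bilinear fd_d_deg fd_br_deg
    fd_dd fd_antisym fd_leibniz fd_jacobi.

End FormDGLA.

Section FormMorphisms.
Variables (K : fieldType) (N : dgla K).
Local Notation G := (dgl_gr N).
Local Notation F := (tensor N (forms K)).

Definition cform (v : N) : F := tens v (fm false 1).

Lemma cform_linear : linear cform.
Proof. exact: ((tens_bilinear N (forms K)).2 (fm false 1)). Qed.

Lemma cform_deg i v : homog G i v -> homog (form_grading G) i (cform v).
Proof. by move=> hv; apply: (tens_fm_homog _ hv); rewrite addr0. Qed.

Lemma cform_d v : cform (dgl_d v) = fd_d (cform v).
Proof.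
have [s _ ->] := gproj_sum G v.
rewrite (linear_map_sum _ _ _ (@dgl_d_linear K N)) !(linear_map_sum _ _ _ cform_linear).
rewrite (linear_map_sum _ _ _ (@fd_d_linear K N)); apply: eq_bigr => i _.
rewrite (fd_d_fm _ _ (gproj_homog G i v)) derivC.
by rewrite (linear_map0 (@fm_linear K _)) tens0r scaler0 addr0.
Qed.

Lemma cform_br u v : cform (dgl_br u v) = fd_br (cform u) (cform v).
Proof.
have [s _ ->] := gproj_sum G v.
rewrite (linear_map_sum _ _ _ ((dgl_br_bilinear N).1 _)) !(linear_map_sum _ _ _ cform_linear).
rewrite (linear_map_sum _ _ _ ((fd_br_bilinear N).1 _)); apply: eq_bigr => i _.
by rewrite (fd_br_fm _ _ _ _ _ (gproj_homog G i v)) scale1r mulr1.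
Qed.

Definition form_cst : dgla_mor N (form_dgla N) :=
  @DglaMor K N (form_dgla N) cform cform_linear cform_deg cform_d cform_br.

Lemma form_eval_fm a e (v : N) p :
  form_eval a (tens v (fm e p)) = if e then 0 else p.[a] *: v.
Proof.
rewrite /form_eval tlift_tens; last exact: form_eval_bilinear.
by case: e; rewrite /feval /fm //= horner0 scale0r.
Qed.

Lemma form_eval_deg a i x :
  homog (form_grading G) i x -> homog G i (form_eval a x).
Proof.
have sH := homog_subsp G i.
apply: (form_homog_in (@form_eval_linear K N a) sH) => e j v p hv iE.
rewrite form_eval_fm; case: e iE => iE; first exact: sH.1.
by apply: (subspZ sH); rewrite iE addr0.
Qed.

Lemma form_eval_d a (x : F) : form_eval a (fd_d x) = dgl_d (form_eval a x).
Proof.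
apply: (@form_eq _ _ G _ (fun x : F => form_eval a (fd_d x))
  (fun x : F => dgl_d (form_eval a x))).
- exact: linear_comp (@form_eval_linear K N a) (@fd_d_linear K N).
- exact: linear_comp (@dgl_d_linear K N) (@form_eval_linear K N a).
move=> e j v p hv; rewrite (fd_d_fm _ _ hv) (linear_mapD (@form_eval_linear K N a)).
rewrite !form_eval_fm; case: e; rewrite ?(linear_map0 (@form_eval_linear K N a)) /=.
  by rewrite addr0 (linear_map0 (@dgl_d_linear K N)).
rewrite (linear_mapZ (@form_eval_linear K N a)) form_eval_fm scaler0 addr0.
by rewrite (linear_mapZ (@dgl_d_linear K N)).
Qed.

Lemma form_eval_br a (x y : F) :
  form_eval a (fd_br x y) = dgl_br (form_eval a x) (form_eval a y).
Proof.
have el := @form_eval_linear K N a.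
have [s ->] := tensorE x; rewrite (linear_map_sum _ _ _ ((fd_br_bilinear N).2 _)).
rewrite !(linear_map_sum _ _ _ el) (linear_map_sum _ _ _ ((dgl_br_bilinear N).2 _)).
apply: eq_bigr => -[u r] _ /=; rewrite (forms_split r) tensDr.
rewrite (linear_mapD ((fd_br_bilinear N).2 _)) !(linear_mapD el).
rewrite (linear_mapD ((dgl_br_bilinear N).2 _)).
suff H e p : form_eval a (fd_br (tens u (fm e p)) y) =
    dgl_br (form_eval a (tens u (fm e p))) (form_eval a y) by rewrite !H.
apply: (@form_eq _ _ G _ (fun y : F => form_eval a (fd_br (tens u (fm e p)) y))
   (fun y : F => dgl_br (form_eval a (tens u (fm e p))) (form_eval a y))).
- exact: linear_comp el ((fd_br_bilinear N).1 _).
- exact: linear_comp ((dgl_br_bilinear N).1 _) el.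
move=> e' j v q hv; rewrite (fd_br_fm _ _ _ _ _ hv) !form_eval_fm.
have z := linear_map0 ((dgl_br_bilinear N).2 _).
case: e; case: e' => /=; rewrite ?(linear_map0 el) ?z ?(linear_mapZ el) ?form_eval_fm ?scaler0 //.
  by rewrite (linear_map0 ((dgl_br_bilinear N).1 _)).
rewrite scale1r hornerM (linear_mapZ ((dgl_br_bilinear N).1 _)).
by rewrite (linear_mapZ ((dgl_br_bilinear N).2 _)) scalerA mulrC.
Qed.

(** Since evaluation is a morphism of DGLAs, as is the inclusion [form_cst] of constants, it
    commutes with curvature, gauge action and [bch] by the general lemmas on [chiA]. *)
Definition form_ev (a : K) : dgla_mor (form_dgla N) N :=
  @DglaMor K (form_dgla N) N (form_eval a) (form_eval_linear a) (@form_eval_deg a)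
    (form_eval_d a) (form_eval_br a).

End FormMorphisms.

Section FormFunctor.
Variables (K : fieldType) (L M : dgla K) (chi : dgla_mor L M).
Let chil := dgm_linear chi.

Definition form_map : tensor L (forms K) -> tensor M (forms K) := tmap chi id.

Lemma form_map_linear : linear form_map.
Proof. exact: tmap_linear. Qed.

Lemma form_map_tens v (r : forms K) : form_map (tens v r) = tens (chi v) r.
Proof. exact: tmap_tens. Qed.

Lemma form_map_deg i x :
  homog (form_grading (dgl_gr L)) i x -> homog (form_grading (dgl_gr M)) i (form_map x).
Proof.
apply: (form_homog_in form_map_linear (homog_subsp _ i)) => e j v p hv ->.
by rewrite form_map_tens; apply: (tens_fm_homog _ (dgm_deg chi hv)).
Qed.

Lemma form_map_d x : form_map (fd_d x) = fd_d (form_map x).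
Proof.
have fl := form_map_linear.
apply: (@form_eq _ _ (dgl_gr L) _ (fun x => form_map (fd_d x)) (fun x => fd_d (form_map x))).
- exact: linear_comp fl (@fd_d_linear K L).
- exact: linear_comp (@fd_d_linear K M) fl.
move=> e j v p hv; rewrite (fd_d_fm _ _ hv) (linear_mapD fl) !form_map_tens.
rewrite (fd_d_fm _ _ (dgm_deg chi hv)) dgm_d; congr (_ + _).
by case: e; rewrite ?(linear_map0 fl) // (linear_mapZ fl) form_map_tens.
Qed.

Lemma form_map_br x y : form_map (fd_br x y) = fd_br (form_map x) (form_map y).
Proof.
have fl := form_map_linear.
have [s ->] := tensorE x; rewrite (linear_map_sum _ _ _ ((fd_br_bilinear L).2 _)).
rewrite !(linear_map_sum _ _ _ fl) (linear_map_sum _ _ _ ((fd_br_bilinear M).2 _)).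
apply: eq_bigr => -[u r] _ /=; rewrite (forms_split r) tensDr.
rewrite (linear_mapD ((fd_br_bilinear L).2 _)) !(linear_mapD fl).
rewrite (linear_mapD ((fd_br_bilinear M).2 _)).
suff H e p : form_map (fd_br (tens u (fm e p)) y) =
    fd_br (form_map (tens u (fm e p))) (form_map y) by rewrite !H.
apply: (@form_eq _ _ (dgl_gr L) _ (fun y => form_map (fd_br (tens u (fm e p)) y))
   (fun y => fd_br (form_map (tens u (fm e p))) (form_map y))).
- exact: linear_comp fl ((fd_br_bilinear L).1 _).
- exact: linear_comp ((fd_br_bilinear M).1 _) fl.
move=> e' j v q hv; rewrite (fd_br_fm _ _ _ _ _ hv) !form_map_tens.
rewrite (fd_br_fm _ _ _ _ _ (dgm_deg chi hv)); case: ifP => _.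
  exact: linear_map0.
by rewrite (linear_mapZ fl) form_map_tens dgm_br.
Qed.

Definition form_mor : dgla_mor (form_dgla L) (form_dgla M) :=
  @DglaMor K (form_dgla L) (form_dgla M) form_map form_map_linear form_map_deg
    form_map_d form_map_br.

End FormFunctor.

(** * Integration of polynomial forms *)

Section Primitive.
Variable K : fieldType.
Implicit Types p q : {poly K}.

Definition pint p : {poly K} :=
  \poly_(i < (size p).+1) (if i is j.+1 then p`_j / j.+1%:R else 0).

Lemma coef_pint p i : (pint p)`_i = if i is j.+1 then p`_j / j.+1%:R else 0.
Proof.
rewrite coef_poly; case: i => [|i] //; rewrite ltnS; case: ltnP => // pi.
by rewrite nth_default // mul0r.
Qed.

Lemma pint_linear : linear pint.
Proof.
move=> a p q; apply/polyP => -[|i]; rewrite coefD coefZ !coef_pint ?mulr0 ?addr0 //.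
by rewrite coefD coefZ mulrDl mulrA.
Qed.

Lemma pint0 p : (pint p).[0] = 0.
Proof. by rewrite horner_coef0 coef_pint. Qed.

Hypothesis charK0 : [pchar K] =i pred0.

Lemma deriv_pint p : (pint p)^`() = p.
Proof.
apply/polyP => i; rewrite coef_deriv coef_pint -[(p`_i / _) *+ _]mulr_natr -mulrA mulVf ?mulr1 //.
exact: natK_neq0.
Qed.

Lemma pint_deriv p : pint p^`() = p - p.[0]%:P.
Proof.
apply/polyP => i; rewrite coef_pint coefB coefC horner_coef0.
case: i => [|i]; first by rewrite subrr.
rewrite coef_deriv -[p`_i.+1 *+ _]mulr_natr mulfK ?subr0 //.
exact: natK_neq0.
Qed.

End Primitive.

Section FormOperators.
Variables (K : fieldType) (N : dgla K).
Local Notation G := (dgl_gr N).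
Local Notation F := (tensor N (forms K)).
Implicit Types (v : N) (x y : F).

Lemma tmap_id_tens (h : forms K -> forms K) v r :
  linear h -> tmap id h (tens v r) = tens v (h r).
Proof. by move=> hl; rewrite tmap_tens. Qed.

Definition fdt : F -> F := tmap id (fpart true).

Lemma fdt_linear : linear fdt.
Proof. by apply: tmap_linear => //; exact: fpart_linear. Qed.

Lemma fdt_fm e v p : fdt (tens v (fm e p)) = if e then tens v (fm e p) else 0.
Proof.
rewrite /fdt tmap_id_tens ?fpart_fm; last exact: fpart_linear.
by case: e; rewrite /= ?tens0r.
Qed.

Definition fint (r : forms K) : forms K := fm false (pint r.2).

Lemma fint_linear : linear fint.
Proof. by move=> a r s; rewrite /fint /= pint_linear fm_linear. Qed.

(** Integration of the dt-component from 0 to t. No sign is inserted for moving dt past v, hence the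
    factors [sg] in [fdt_d_J] and [fJ_dt_d]. *)
Definition fJ : F -> F := tmap id fint.

Lemma fJ_linear : linear fJ.
Proof. by apply: tmap_linear => //; exact: fint_linear. Qed.

Lemma pint_0 : pint (0 : {poly K}) = 0.
Proof. exact: linear_map0 (@pint_linear K). Qed.

Lemma fm0 e : fm e (0 : {poly K}) = 0.
Proof. exact: linear_map0 (@fm_linear K e). Qed.

Lemma fJ_fm e v p : fJ (tens v (fm e p)) = if e then tens v (fm false (pint p)) else 0.
Proof.
rewrite /fJ tmap_id_tens; last exact: fint_linear.
by case: e; rewrite /fint /fm //= pint_0 -/(fm false 0) fm0 tens0r.
Qed.

Definition fI0 (v : N) (r : forms K) : N := (pint r.2).[1] *: v.

Lemma fI0_bilinear : bilinear_map fI0.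
Proof.
split=> [v|r] a x y; last by rewrite /fI0 scalerDr !scalerA mulrC.
by rewrite /fI0 /= pint_linear hornerD hornerZ scalerDl scalerA.
Qed.

Definition fI : F -> N := tlift fI0.

Lemma fI_linear : linear fI.
Proof. exact: tlift_linear fI0_bilinear. Qed.

Lemma fI_fm e v p : fI (tens v (fm e p)) = if e then (pint p).[1] *: v else 0.
Proof.
rewrite /fI tlift_tens; last exact: fI0_bilinear.
by case: e; rewrite /fI0 /fm //= pint_0 horner0 scale0r.
Qed.

Lemma fJ_deg i x : homog (form_grading G) i x -> homog (form_grading G) (i - 1) (fJ x).
Proof.
apply: (form_homog_in fJ_linear (homog_subsp _ _)) => e j v p hv ->.
rewrite fJ_fm; case: e; last exact: (homog_subsp _ _).1.
by apply: (tens_fm_homog _ hv); rewrite addrK addr0.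
Qed.

Lemma fI_deg i x : homog (form_grading G) i x -> homog G (i - 1) (fI x).
Proof.
have sH := homog_subsp G (i - 1).
apply: (form_homog_in fI_linear sH) => e j v p hv iE.
rewrite fI_fm; case: e iE => iE; last exact: sH.1.
by apply: (subspZ sH); rewrite iE addrK.
Qed.

(** The last bracket may keep the dt-component of y because dt dt = 0. *)
Lemma fdt_br x y : fdt (fd_br x y) = fd_br (x - fdt x) (fdt y) + fd_br (fdt x) y.
Proof.
have drl := (fd_br_bilinear N).1; have dll := (fd_br_bilinear N).2.
have fl := fdt_linear.
have fidl : linear (fun x => x - fdt x).
  by apply: linear_add; [exact: linear_id | exact: linear_opp].
apply: (@form_eq _ _ G _ (fun x : F => fdt (fd_br x y))
   (fun x : F => fd_br (x - fdt x) (fdt y) + fd_br (fdt x) y)).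
- exact: linear_comp fl (dll y).
- by apply: linear_add; [exact: linear_comp (dll (fdt y)) fidl | exact: linear_comp (dll y) fl].
move=> e i u p hu.
apply: (@form_eq _ _ G _ (fun y : F => fdt (fd_br (tens u (fm e p)) y))
   (fun y : F => fd_br (tens u (fm e p) - fdt (tens u (fm e p))) (fdt y) +
      fd_br (fdt (tens u (fm e p))) y)).
- exact: linear_comp fl (drl _).
- by apply: linear_add; [exact: linear_comp (drl _) fl | exact: drl].
move=> e' j v q hv; rewrite (fd_br_fm _ _ _ _ _ hv) !fdt_fm.
case: e e' => [] [] /=;
  rewrite ?subrr ?subr0 ?(linear_map0 (dll _)) ?(linear_map0 (drl _)) ?(linear_map0 fl)
    ?(fd_br_fm _ _ _ _ _ hv) ?add0r ?addr0 ?(linear_mapZ fl) ?fdt_fm ?scaler0 //.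
Qed.

Lemma fdt_cform v : fdt (cform v) = 0.
Proof. exact: fdt_fm. Qed.

Lemma fdt_J x : fdt (fJ x) = 0.
Proof.
apply: (@form_eq _ _ G _ (fun x => fdt (fJ x)) (fun=> 0)).
- exact: linear_comp fdt_linear fJ_linear.
- exact: linear_cst0.
move=> e j v p _; rewrite fJ_fm; case: e; rewrite ?fdt_fm //.
exact: linear_map0 fdt_linear.
Qed.

Lemma form_eval0_J x : form_eval 0 (fJ x) = 0.
Proof.
have el := @form_eval_linear K N 0.
apply: (@form_eq _ _ G _ (fun x => form_eval 0 (fJ x)) (fun=> 0)).
- exact: linear_comp el fJ_linear.
- exact: linear_cst0.
move=> e j v p _; rewrite fJ_fm; case: e; last exact: linear_map0.
by rewrite form_eval_fm pint0 scale0r.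
Qed.

Lemma form_eval_cform a v : form_eval a (cform v) = v.
Proof. by rewrite form_eval_fm hornerC scale1r. Qed.

Hypothesis charK0 : [pchar K] =i pred0.

(** The derivative of a primitive. On v p dt of total degree i the differential contributes the sign
    of |v| = i - 1. *)
Lemma fdt_d_J i x : homog (form_grading G) i x ->
  fdt (fd_d (fJ x)) = sg K (i - 1) *: fdt x.
Proof.
apply: (form_homog_eq (linear_comp fdt_linear (linear_comp (@fd_d_linear K N) fJ_linear))
  (linear_scale _ fdt_linear)) => e j v p hv iE.
rewrite /= fJ_fm fdt_fm; case: e iE => iE; last first.
  by rewrite (linear_map0 (@fd_d_linear K N)) (linear_map0 fdt_linear) scaler0.
rewrite (fd_d_fm _ _ hv) (linear_mapD fdt_linear) (linear_mapZ fdt_linear) !fdt_fm add0r.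
by rewrite deriv_pint // iE addrK.
Qed.

(** On v p, integrating p' gives p - p(0), with the sign of |v| = i. The last term accounts for v p
    dt, whose differential (dv) p dt still contains dt. *)
Lemma fJ_dt_d i x : homog (form_grading G) i x ->
  fJ (fdt (fd_d x)) = sg K i *: (x - fdt x - cform (form_eval 0 x)) + fJ (fd_d (fdt x)).
Proof.
have el := @form_eval_linear K N 0; have dl := @fd_d_linear K N.
have fl := fdt_linear; have Jl := fJ_linear.
apply: (@form_homog_eq _ _ _ _ (fun x => fJ (fdt (fd_d x)))
  (fun x => sg K i *: (x - fdt x - cform (form_eval 0 x)) + fJ (fd_d (fdt x)))).
- exact: linear_comp Jl (linear_comp fl dl).
- apply: linear_add; last exact: linear_comp Jl (linear_comp dl fl).
  apply: linear_scale; apply: linear_add.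
    by apply: linear_add; [exact: linear_id | exact: linear_opp].
  by apply: linear_opp; exact: linear_comp (@cform_linear K N) el.
move=> e j v p hv iE; rewrite (fd_d_fm _ _ hv) (linear_mapD fl) !fdt_fm form_eval_fm.
case: e iE => iE.
  rewrite subrr (linear_map0 fl) addr0 (fd_d_fm _ _ hv) addr0.
  by rewrite (linear_map0 (@cform_linear K N)) subr0 scaler0 add0r.
rewrite (linear_map0 dl) (linear_map0 Jl) addr0 subr0 add0r (linear_mapZ fl) fdt_fm.
rewrite (linear_mapZ Jl) fJ_fm pint_deriv // iE addr0; congr (_ *: _).
rewrite (linear_mapD (@fm_linear K _)) -scaleN1r (linear_mapZ (@fm_linear K _)) tensDr.
rewrite tensZr scaleN1r; congr (_ - _).
rewrite (linear_mapZ (@cform_linear K N)) /cform -tensZr -(linear_mapZ (@fm_linear K _)).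
by rewrite -mul_polyC mulr1.
Qed.

(** Stokes' formula on [0, 1]: the boundary term comes from the part of x without dt, the term with
    d from the part with dt. *)
Lemma fI_d i x : homog (form_grading G) i x ->
  fI (fd_d x) = sg K i *: (form_eval 1 x - form_eval 0 x) + dgl_d (fI x).
Proof.
have el a := @form_eval_linear K N a; have dl := @fd_d_linear K N; have Il := fI_linear.
apply: (@form_homog_eq _ _ _ _ (fun x => fI (fd_d x))
  (fun x => sg K i *: (form_eval 1 x - form_eval 0 x) + dgl_d (fI x))).
- exact: linear_comp Il dl.
- apply: linear_add; last exact: linear_comp (@dgl_d_linear K N) Il.
  by apply: linear_scale; apply: linear_add; [exact: el | apply: linear_opp; exact: el].
move=> e j v p hv iE; rewrite (fd_d_fm _ _ hv) (linear_mapD Il) !fI_fm !form_eval_fm.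
case: e iE => iE.
  by rewrite subrr scaler0 add0r (linear_map0 Il) addr0 (linear_mapZ (@dgl_d_linear K N)).
rewrite (linear_map0 (@dgl_d_linear K N)) add0r addr0 (linear_mapZ Il) fI_fm iE addr0.
by rewrite pint_deriv // hornerD hornerN hornerC scalerBl.
Qed.

Definition tpow n v : F := tens v (fm false 'X^n).
Definition tdpow n v : F := tens v (fm true 'X^n).

Lemma tpow_linear n : linear (tpow n).
Proof. exact: ((tens_bilinear N (forms K)).2 _). Qed.
Lemma tdpow_linear n : linear (tdpow n).
Proof. exact: ((tens_bilinear N (forms K)).2 _). Qed.

Lemma tpow_deg n i v : homog G i v -> homog (form_grading G) i (tpow n v).
Proof. by move=> hv; apply: (tens_fm_homog _ hv); rewrite addr0. Qed.

Lemma fd_br_tdpow i j u v : fd_br (tpow i u) (tdpow j v) = tdpow (i + j) (dgl_br u v).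
Proof.
have [s _ ->] := gproj_sum G v.
rewrite (linear_map_sum _ _ _ ((dgl_br_bilinear N).1 _)) !(linear_map_sum _ _ _ (tdpow_linear _)).
rewrite (linear_map_sum _ _ _ ((fd_br_bilinear N).1 _)); apply: eq_bigr => k _.
by rewrite (fd_br_fm _ _ _ _ _ (gproj_homog G k v)) scale1r -exprD.
Qed.

Lemma fdt_d_tpow n v : homog G 0 v -> fdt (fd_d (tpow n v)) = n%:R *: tdpow n.-1 v.
Proof.
move=> hv; rewrite (fd_d_fm _ _ hv) (linear_mapD fdt_linear) (linear_mapZ fdt_linear).
rewrite !fdt_fm add0r sg0 scale1r derivXn -scaler_nat.
by rewrite (linear_mapZ (@fm_linear K _)) tensZr.
Qed.

Lemma form_eval_tpow a n v : form_eval a (tpow n v) = a ^+ n *: v.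
Proof. by rewrite form_eval_fm hornerXn. Qed.

End FormOperators.

Section FormOperatorsA.
Variables (K : fieldType) (A : art K) (N : dgla K).
Local Notation Nt := (form_dgla N).
Implicit Types (v : tensor N A) (x y : tensor Nt A) (n : nat).

Definition dtA : tensor Nt A -> tensor Nt A := tmap (@fdt K N) id.
Definition JA : tensor Nt A -> tensor Nt A := tmap (@fJ K N) id.
Definition IA : tensor Nt A -> tensor N A := tmap (@fI K N) id.
Definition tXA n : tensor N A -> tensor Nt A := tmap (@tpow K N n) id.
Definition tdXA n : tensor N A -> tensor Nt A := tmap (@tdpow K N n) id.
Definition evA (a : K) : tensor Nt A -> tensor N A := @chiA K Nt N (form_ev N a) A.
Definition cstA : tensor N A -> tensor Nt A := @chiA K N Nt (form_cst N) A.

Lemma dtA_linear : linear dtA. Proof. exact: tmap_linear (@fdt_linear K N) (@linear_id K A). Qed.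
Lemma JA_linear : linear JA. Proof. exact: tmap_linear (@fJ_linear K N) (@linear_id K A). Qed.
Lemma IA_linear : linear IA. Proof. exact: tmap_linear (@fI_linear K N) (@linear_id K A). Qed.
Lemma tXA_linear n : linear (tXA n).
Proof. exact: tmap_linear (@tpow_linear K N n) (@linear_id K A). Qed.
Lemma tdXA_linear n : linear (tdXA n).
Proof. exact: tmap_linear (@tdpow_linear K N n) (@linear_id K A). Qed.
Lemma evA_linear a : linear (evA a). Proof. exact: chiA_linear. Qed.
Lemma cstA_linear : linear cstA. Proof. exact: chiA_linear. Qed.

Lemma dtA_tens (u : Nt) (a : A) : dtA (tens u a) = tens (fdt u : Nt) a.
Proof. exact: tmap_tens (@fdt_linear K N) (@linear_id K A). Qed.
Lemma JA_tens (u : Nt) (a : A) : JA (tens u a) = tens (fJ u : Nt) a.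
Proof. exact: tmap_tens (@fJ_linear K N) (@linear_id K A). Qed.
Lemma IA_tens (u : Nt) (a : A) : IA (tens u a) = tens (fI u) a.
Proof. exact: tmap_tens (@fI_linear K N) (@linear_id K A). Qed.
Lemma tXA_tens n (u : N) (a : A) : tXA n (tens u a) = tens (tpow n u : Nt) a.
Proof. exact: tmap_tens (@tpow_linear K N n) (@linear_id K A). Qed.
Lemma tdXA_tens n (u : N) (a : A) : tdXA n (tens u a) = tens (tdpow n u : Nt) a.
Proof. exact: tmap_tens (@tdpow_linear K N n) (@linear_id K A). Qed.
Lemma evA_tens c (u : Nt) (a : A) : evA c (tens u a) = tens (form_eval c u) a.
Proof. exact: chiA_tens. Qed.
Lemma cstA_tens (u : N) (a : A) : cstA (tens u a) = tens (cform u : Nt) a.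
Proof. exact: chiA_tens. Qed.

Lemma dA_form_tens (u : Nt) (a : A) : dA (tens u a) = tens (fd_d u : Nt) a.
Proof. exact: dA_tens. Qed.

Lemma dtA_fil k x : tfil k x -> tfil k (dtA x).
Proof. by apply: tmem_tmap => //; exact: fdt_linear. Qed.
Lemma JA_fil k x : tfil k x -> tfil k (JA x).
Proof. by apply: tmem_tmap => //; exact: fJ_linear. Qed.
Lemma JA_deg i k x : tdeg i k x -> tdeg (i - 1) k (JA x).
Proof. by apply: tmem_tmap; [exact: fJ_linear|exact: homog_subsp|exact: fJ_deg]. Qed.
Lemma IA_deg i k x : tdeg i k x -> tdeg (i - 1) k (IA x).
Proof. by apply: tmem_tmap; [exact: fI_linear|exact: homog_subsp|exact: fI_deg]. Qed.
Lemma tXA_deg n i k v : tdeg i k v -> tdeg i k (tXA n v).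
Proof. by apply: tmem_tmap; [exact: tpow_linear|exact: homog_subsp|exact: tpow_deg]. Qed.

Lemma dtA_brA x y : dtA (brA x y) = brA (x - dtA x) (dtA y) + brA (dtA x) y.
Proof.
have fl := dtA_linear.
have fidl : linear (fun x => x - dtA x).
  by apply: linear_add; [exact: linear_id | exact: linear_opp].
move: x; apply: (@linear_tensor_eq _ _ _ _ (fun x => dtA (brA x y))
   (fun x => brA (x - dtA x) (dtA y) + brA (dtA x) y)).
- exact: linear_comp fl (brAl y).
- apply: linear_add; first exact: linear_comp (brAl _) fidl.
  exact: linear_comp (brAl y) fl.
move=> u a; move: y; apply: (@linear_tensor_eq _ _ _ _ (fun y => dtA (brA (tens u a) y))
   (fun y => brA (tens u a - dtA (tens u a)) (dtA y) + brA (dtA (tens u a)) y)).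
- exact: linear_comp fl (brAr _).
- apply: linear_add; first exact: linear_comp (brAr _) fl.
  exact: brAr.
move=> v b; rewrite !dtA_tens brABl !brA_tens dtA_tens /= fdt_br tensDl.
congr (_ + _); rewrite (linear_mapD ((fd_br_bilinear N).2 _)) tensDl; congr (_ + _).
rewrite -[- fdt u]scaleN1r (linear_mapZ ((fd_br_bilinear N).2 _)) tensZl.
by rewrite scaleN1r.
Qed.

Lemma dtA_brA_free x y : dtA x = 0 -> dtA (brA x y) = brA x (dtA y).
Proof. by move=> x0; rewrite dtA_brA x0 subr0 brA0l addr0. Qed.

Lemma dtA_cst v : dtA (cstA v) = 0.
Proof.
move: v; apply: (@linear_tensor_eq0 _ _ _ _ (fun v => dtA (cstA v))).
- exact: linear_comp dtA_linear cstA_linear.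
by move=> u a; rewrite cstA_tens dtA_tens fdt_cform tens0l.
Qed.

Lemma dtA_J x : dtA (JA x) = 0.
Proof.
move: x; apply: (@linear_tensor_eq0 _ _ _ _ (fun x => dtA (JA x))).
- exact: linear_comp dtA_linear JA_linear.
by move=> u a; rewrite JA_tens dtA_tens fdt_J tens0l.
Qed.

Lemma evA0_J x : evA 0 (JA x) = 0.
Proof.
move: x; apply: (@linear_tensor_eq0 _ _ _ _ (fun x => evA 0 (JA x))).
- exact: linear_comp (evA_linear 0) JA_linear.
by move=> u a; rewrite JA_tens evA_tens form_eval0_J tens0l.
Qed.

Lemma evA_cst c v : evA c (cstA v) = v.
Proof.
move: v; apply: (@linear_tensor_eq _ _ _ _ (fun v => evA c (cstA v)) id).
- exact: linear_comp (evA_linear c) cstA_linear.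
- exact: linear_id.
by move=> u a; rewrite cstA_tens evA_tens form_eval_cform.
Qed.

Lemma brA_tdXA i j u v : brA (tXA i u) (tdXA j v) = tdXA (i + j) (brA u v).
Proof.
move: u; apply: (@linear_tensor_eq _ _ _ _ (fun u => brA (tXA i u) (tdXA j v))
  (fun u => tdXA (i + j) (brA u v))).
- exact: linear_comp (brAl _) (tXA_linear i).
- exact: linear_comp (tdXA_linear _) (brAl v).
move=> u a; move: v; apply: (@linear_tensor_eq _ _ _ _
  (fun v => brA (tXA i (tens u a)) (tdXA j v)) (fun v => tdXA (i + j) (brA (tens u a) v))).
- exact: linear_comp (brAr _) (tdXA_linear j).
- exact: linear_comp (tdXA_linear _) (brAr _).
by move=> v b; rewrite !tXA_tens !tdXA_tens !brA_tens tdXA_tens /= fd_br_tdpow.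
Qed.

Lemma dtA_tXA n v : dtA (tXA n v) = 0.
Proof.
move: v; apply: (@linear_tensor_eq0 _ _ _ _ (fun v => dtA (tXA n v))).
- exact: linear_comp dtA_linear (tXA_linear n).
by move=> u a; rewrite tXA_tens dtA_tens fdt_fm tens0l.
Qed.

Lemma evA_tXA c n v : evA c (tXA n v) = c ^+ n *: v.
Proof.
move: v; apply: (@linear_tensor_eq _ _ _ _ (fun v => evA c (tXA n v)) (fun v => c ^+ n *: v)).
- exact: linear_comp (evA_linear c) (tXA_linear n).
- exact: linear_scale (@linear_id K _).
by move=> u a; rewrite tXA_tens evA_tens form_eval_tpow tensZl.
Qed.

Lemma dtA_dA_tXA n k v : tdeg 0 k v -> dtA (dA (tXA n v)) = n%:R *: tdXA n.-1 v.
Proof.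
apply: (@tmem_eq _ _ _ _ _ _ (fun v => dtA (dA (tXA n v))) (fun v => n%:R *: tdXA n.-1 v)).
- exact: linear_comp dtA_linear (linear_comp dA_linear (tXA_linear n)).
- exact: linear_scale (tdXA_linear _).
move=> u a hu _; rewrite tXA_tens dA_form_tens dtA_tens fdt_d_tpow //.
by rewrite tdXA_tens tensZl.
Qed.

Hypothesis charK0 : [pchar K] =i pred0.

Lemma dtA_dA_J i k x : tdeg i k x -> dtA (dA (JA x)) = sg K (i - 1) *: dtA x.
Proof.
apply: (@tmem_eq _ _ _ _ _ _ (fun x => dtA (dA (JA x))) (fun x => sg K (i - 1) *: dtA x)).
- exact: linear_comp dtA_linear (linear_comp dA_linear JA_linear).
- exact: linear_scale dtA_linear.
move=> u a hu _; rewrite JA_tens (dA_form_tens (fJ u) a) !dtA_tens (fdt_d_J charK0 hu).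
exact: tensZl.
Qed.

Lemma JA_dtA_dA i k x : tdeg i k x -> dtA x = 0 ->
  JA (dtA (dA x)) = sg K i *: (x - cstA (evA 0 x)).
Proof.
(* The condition [dtA x = 0] does not pass to the summands of x, so the formula is extended by its
   terms in [dtA x] before it is checked on pure tensors. *)
move=> hx x0; suff -> : JA (dtA (dA x)) =
    sg K i *: (x - dtA x - cstA (evA 0 x)) + JA (dA (dtA x)).
  by rewrite x0 dA0 (linear_map0 JA_linear) subr0 addr0.
move: hx {x0}; apply: (@tmem_eq _ _ _ _ _ _ (fun x => JA (dtA (dA x)))
  (fun x => sg K i *: (x - dtA x - cstA (evA 0 x)) + JA (dA (dtA x)))).
- exact: linear_comp JA_linear (linear_comp dtA_linear dA_linear).
- apply: linear_add; last exact: linear_comp JA_linear (linear_comp dA_linear dtA_linear).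
  apply: linear_scale; apply: linear_add; last first.
    by apply: linear_opp; exact: linear_comp cstA_linear (evA_linear 0).
  by apply: linear_add; [exact: linear_id | apply: linear_opp; exact: dtA_linear].
move=> u a hu _.
rewrite evA_tens cstA_tens dA_form_tens !dtA_tens dA_form_tens !JA_tens (fJ_dt_d charK0 hu).
have S (w w' : Nt) : tens w a - tens w' a = tens (w - w') a.
  by rewrite tensDl -[- w']scaleN1r tensZl scaleN1r.
by rewrite !S -[sg K i *: tens _ _]tensZl -tensDl.
Qed.

Lemma IA_dA i k x : tdeg i k x ->
  IA (dA x) = sg K i *: (evA 1 x - evA 0 x) + dA (IA x).
Proof.
apply: (@tmem_eq _ _ _ _ _ _ (fun x => IA (dA x))
  (fun x => sg K i *: (evA 1 x - evA 0 x) + dA (IA x))).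
- exact: linear_comp IA_linear dA_linear.
- apply: linear_add; last exact: linear_comp dA_linear IA_linear.
  by apply: linear_scale; apply: linear_add; [exact: evA_linear|apply: linear_opp; exact: evA_linear].
move=> u a hu _; rewrite !evA_tens IA_tens dA_form_tens dA_tens IA_tens (fI_d charK0 hu).
have S (w w' : N) : tens w a - tens w' a = tens (w - w') a.
  by rewrite tensDl -[- w']scaleN1r tensZl scaleN1r.
by rewrite S -tensZl -tensDl.
Qed.

(** By [JA_dtA_dA], the difference between x and its value at t = 0 is, up to sign, the integral of
    the dt-component of dx. *)
Lemma free_const i k x : tdeg i k x -> dtA x = 0 -> dtA (dA x) = 0 ->
  x = cstA (evA 0 x).
Proof.
move=> hx x0 dx0; have := JA_dtA_dA hx x0; rewrite dx0 (linear_map0 JA_linear).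
move=> /esym/(congr1 (fun z => sg K i *: z)); rewrite scalerA sgM1 scale1r scaler0.
by move/eqP; rewrite subr_eq0 => /eqP.
Qed.

End FormOperatorsA.

Section FormGauge.
Variables (K : fieldType) (A : art K) (N : dgla K).
Hypothesis charK0 : [pchar K] =i pred0.
Local Notation Nt := (form_dgla N).

Lemma dtA_pws c (Z w : tensor Nt A) : tfil 1 Z -> dtA Z = 0 ->
  dtA (pws c (brA Z) w) = pws c (brA Z) (dtA w).
Proof.
move=> hZ Z0; have nZ := nilop_brA hZ; apply: pws_morph => //; first exact: dtA_linear.
by move=> v; rewrite dtA_brA_free.
Qed.

Lemma dtA_gact (Z w : tensor Nt A) : tfil 1 Z -> dtA Z = 0 ->
  dtA (gact Z w) =
  pws (@expc K) (brA Z) (dtA w) - pws (@expc1 K) (brA Z) (dtA (dA Z)).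
Proof.
move=> hZ Z0; rewrite gact_exp // (linear_mapD (@dtA_linear K A N)) dtA_pws //.
rewrite -scaleN1r (linear_mapZ (@dtA_linear K A N)) dtA_pws //.
Qed.

Lemma dtA_curv_free (w : tensor Nt A) : dtA w = 0 -> dtA (curv w) = dtA (dA w).
Proof.
move=> w0; rewrite /curv (linear_mapD (@dtA_linear K A N)).
rewrite (linear_mapZ (@dtA_linear K A N)) dtA_brA_free // w0.
by rewrite brA0r scaler0 addr0.
Qed.

End FormGauge.

(** * The gauge action and the differential equation of the Baker-Campbell-Hausdorff series *)

Section GaugeBCH.
Variables (K : fieldType) (A : art K) (N : dgla K).
Hypothesis charK0 : [pchar K] =i pred0.
Local Notation Nt := (form_dgla N).
Variables (x y : tensor N A).
Hypotheses (hx : tdeg 0 1 x) (hy : tdeg 0 1 y).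
Let hx1 := tdeg_fil hx.
Let hy1 := tdeg_fil hy.
Local Notation z := (bch_term x y).
Variable m : nat.
Hypothesis vN : forall k, (m <= k)%N -> forall v : tensor N A, tfil k v -> v = 0.
Hypothesis vNt : forall k, (m <= k)%N -> forall v : tensor Nt A, tfil k v -> v = 0.
Hypothesis m0 : (0 < m)%N.

Let hz n : tdeg 0 n (z n). Proof. exact: bch_term_deg. Qed.

(** The path Z(t) = log(e^(t x) e^(t y)) = \sum_k z_k t^k, cut at m, from where on the filtration
    makes the z_k vanish. *)
Definition bch_path : tensor Nt A := \sum_(k < m) tXA k (z k).
Local Notation Z := bch_path.

Lemma bch_path_deg : tdeg 0 1 Z.
Proof.
apply: (subsp_sum (tdeg_subsp _ _)) => -[[|k] km] _; apply: tXA_deg.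
  by rewrite bch_term0; exact: (tdeg_subsp _ _).1.
exact: tdegW (hz k.+1).
Qed.

Let hZ1 := tdeg_fil bch_path_deg.
Let nZ := nilop_brA hZ1.

Lemma dtA_bch_path : dtA Z = 0.
Proof.
rewrite (linear_map_sum _ _ _ (@dtA_linear K A N)) big1 // => k _.
exact: dtA_tXA.
Qed.

Lemma evA1_bch_path : evA 1 Z = bch x y.
Proof.
have [n hn] := bchE hx1 hy1; rewrite (hn _ (leq_maxl n m)).
rewrite (linear_map_sum _ _ _ (evA_linear 1)).
under eq_bigr do rewrite evA_tXA expr1n scale1r.
rewrite -!(big_mkord xpredT z) [RHS](big_cat_nat _ (n := m)) ?leq_maxr //=.
rewrite [X in _ = _ + X]big_nat_cond [X in _ = _ + X]big1 ?addr0 // => k.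
by case/andP => /andP[mk _] _; apply: (vN mk); exact: tdeg_fil (hz k).
Qed.

Lemma evA0_bch_path : evA 0 Z = 0.
Proof.
rewrite (linear_map_sum _ _ _ (evA_linear 0)) big1 // => -[[|k] km] _.
  by rewrite evA_tXA bch_term0 scaler0.
by rewrite evA_tXA expr0n scale0r.
Qed.

(** The form \sum_k u_k t^k dt with coefficient sequence u; on such forms ad Z acts as [ad_series z]
    acts on sequences. *)
Let pd (u : nat -> tensor N A) : tensor Nt A := \sum_(k < m) tdXA k (u k).

Let brA_pd u : (forall k, tfil k (u k)) -> brA Z (pd u) = pd (ad_series z u).
Proof.
move=> hu; rewrite /pd (linear_map_sum _ _ _ (brAr _)).
under eq_bigr do rewrite (linear_map_sum _ _ _ (brAl _)).
rewrite exchange_big /=.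
under eq_bigr => i _ do under eq_bigr => j _ do rewrite brA_tdXA.
rewrite -(@sum_triangle _ (fun i j => tdXA (i + j) (brA (z i) (u j)))) => [|i j ij].
  apply: eq_bigr => n _; rewrite (linear_map_sum _ _ _ (tdXA_linear _)).
  by apply: eq_bigr => i _; rewrite subnKC // -ltnS.
have hij : tfil (i + j) (brA (z i) (u j)) by apply: brA_fil => //; exact: tdeg_fil (hz i).
by rewrite (vN ij hij) (linear_map0 (tdXA_linear _)).
Qed.

Let ad_series_fil u : (forall k, tfil k (u k)) -> forall k, tfil k (ad_series z u k).
Proof.
move=> hu k; apply: (subsp_sum (tfil_subsp _)) => i _.
have ik : (i <= k)%N by rewrite -ltnS.
have := brA_fil (tdeg_fil (hz i)) (hu (k - i)%N).
by rewrite subnKC.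
Qed.

Let iter_pd p u : (forall k, tfil k (u k)) ->
  iter p (brA Z) (pd u) = pd (iter p (ad_series z) u).
Proof.
move=> hu; elim: p => //= p ->; apply: brA_pd; elim: p => //= p IH.
exact: ad_series_fil.
Qed.

(** As z_0 = 0, each application of ad Z raises the order in t by at least one. *)
Let iter_ad_series0 p u k : (k < p)%N -> iter p (ad_series z) u k = 0.
Proof.
elim: p k => // p IH k kp; rewrite iterS {1}/ad_series big1 // => -[[|i] ik] _.
  by rewrite brA0l.
rewrite /= IH ?brA0r //; case: k kp ik => // k kp ik.
by rewrite subSS (leq_ltn_trans (leq_subr _ _)).
Qed.

Let pd_cst p : pd (bch_cst x y p) = tdXA 0 x + (-1) ^+ p *: tdXA 0 y.
Proof.
case: m m0 @pd => // n _ pd'; rewrite /pd' big_ord_recl /= big1 ?addr0.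
  by rewrite (linear_mapD (tdXA_linear _)) (linear_mapZ (tdXA_linear _)).
by move=> k _; exact: linear_map0 (tdXA_linear _).
Qed.

Let cst_fil p k : tfil k (bch_cst x y p k).
Proof.
rewrite /bch_cst; case: eqP => [->|_]; first exact: tfil0.
exact: (tfil_subsp _).1.
Qed.

(** With b(T) = T / (e^T - 1), this is Z' dt = b(ad Z) x dt + b(- ad Z) y dt, the equation whose
    coefficients define the z_n. *)
Lemma dtA_dA_bch_path : dtA (dA Z) = pws (bernc K) (brA Z) (tdXA 0 x) +
  pws (alt (bernc K)) (brA Z) (tdXA 0 y).
Proof.
have -> : dtA (dA Z) = pd (fun k => k.+1%:R *: z k.+1).
  rewrite (linear_map_sum _ _ _ (@dA_linear K A Nt)) (linear_map_sum _ _ _ (@dtA_linear K A N)).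
  under eq_bigr => k _ do rewrite (dtA_dA_tXA _ (hz k)).
  (* Differentiation shifts the indices, so the sum on the other side ends with z_m. *)
  have zm : z m = 0 by apply: (vN (leqnn m)); exact: tdeg_fil (hz m).
  move: zm; rewrite /pd; case: m m0 => // n _ zn.
  rewrite big_ord_recl scale0r add0r [RHS]big_ord_recr /= zn scaler0.
  rewrite (linear_map0 (tdXA_linear _)) addr0; apply: eq_bigr => k _.
  by rewrite (linear_mapZ (tdXA_linear _)).
have iterm v : iter m (brA Z) v = 0.
  by apply: (vNt (leqnn m)); have := iter_brA_fil m hZ1 (tfil0 v); rewrite addn0.
rewrite !(pwsE _ nZ (iterm _)) -big_split /=.
transitivity (\sum_(p < m) bernc K p *: iter p (brA Z) (pd (bch_cst x y p))); last first.
  apply: eq_bigr => p _; rewrite pd_cst (linear_mapD (iter_linear _ (brAr _))) scalerDr.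
  by rewrite (linear_mapZ (iter_linear _ (brAr _))) /alt scalerA mulrC.
under [RHS]eq_bigr => p _ do rewrite (iter_pd _ (cst_fil p)) /pd scaler_sumr.
rewrite exchange_big /=; apply: eq_bigr => k _.
rewrite bch_termS scalerA mulfV ?natK_neq0 // scale1r.
under [RHS]eq_bigr => p _ do rewrite -(linear_mapZ (tdXA_linear _)).
rewrite -(linear_map_sum _ _ _ (tdXA_linear _)); congr (tdXA _ _).
(* The recursion for z_(k+1) stops at p = k; the powers of ad Z beyond k do not reach the
   coefficient of t^k. *)
rewrite (big_ord_widen m (fun p => bernc K p *: iter p (ad_series z) (bch_cst x y p) k)) //.
rewrite big_mkcond; apply: eq_bigr => p _; case: ltnP => // kp.
by rewrite iter_ad_series0 // scaler0.
Qed.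

Let Tx := tXA 1 x.
Let Ty := tXA 1 y.

Let hT (w : tensor N A) : tdeg 0 1 w -> tdeg 0 1 (- tXA 1 w).
Proof. by move=> hw; apply: (subspN (tdeg_subsp _ _)); exact: tXA_deg. Qed.

Let dtNT (w : tensor N A) : dtA (- tXA 1 w) = 0.
Proof. by rewrite -scaleN1r (linear_mapZ (@dtA_linear K A N)) dtA_tXA scaler0. Qed.

Let dtdNT (w : tensor N A) : tdeg 0 1 w -> dtA (dA (- tXA 1 w)) = - tdXA 0 w.
Proof.
move=> hw; rewrite dAN -scaleN1r (linear_mapZ (@dtA_linear K A N)) (dtA_dA_tXA _ hw).
by rewrite scale1r scaleN1r.
Qed.

Let pws_NT c (w : tensor N A) : tdeg 0 1 w ->
  pws c (brA (- tXA 1 w)) (- tdXA 0 w) = c 0%N *: - tdXA 0 w.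
Proof.
move=> hw; apply: pws_fixed; first exact: nilop_brA (tdeg_fil (hT hw)).
rewrite brANl brANr opprK brA_tdXA brA_deg0_self ?(linear_map0 (tdXA_linear _)) //.
exact: tdegW hw.
Qed.

(* Let Z(t) be the path above.  By the differential equation defining Z, the element
   e^(- t x) * e^Z * e^(- t y) * v of N[t,dt] has no dt-component; as its curvature has
   none either, it does not depend on t, and it is v at t = 0. *)
Lemma gact_bch_path v : tdeg 1 0 v -> gact (- x) (gact (bch x y) (gact (- y) v)) = v.
Proof.
move=> hv; pose w0 := cstA v.
have hw0 : tdeg 1 0 w0 by exact: chiA_deg.
pose w1 := gact (- Ty) w0; pose w2 := gact Z w1; pose w3 := gact (- Tx) w2.
have W a w : tdeg 0 1 a -> tdeg 1 0 w -> tdeg 1 0 (gact a w : tensor Nt A).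
  by move=> ha hw; apply: gact_deg => //; exact: tdegW ha.
have hw1 : tdeg 1 0 w1 := W _ _ (hT hy) hw0.
have hw2 : tdeg 1 0 w2 := W _ _ bch_path_deg hw1.
have hw3 : tdeg 1 0 w3 := W _ _ (hT hx) hw2.
have f1 (w : tensor N A) : tdeg 0 1 w -> tfil 1 (- tXA 1 w) by move=> /hT/tdeg_fil.
have p0 c (T : tensor Nt A -> tensor Nt A) : nilop T -> pws c T 0 = 0.
  by move=> nT; exact: linear_map0 (pws_linear _ nT).
have dt0 : dtA w0 = 0 by exact: dtA_cst.
have gx := f1 _ hx; have gy := f1 _ hy.
have dt1 : dtA w1 = tdXA 0 y.
  rewrite (dtA_gact _ gy (dtNT y)) dt0 (p0 _ _ (nilop_brA gy)) (dtdNT hy).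
  by rewrite (pws_NT _ hy) /expc1 invr1 scale1r sub0r opprK.
(* At T = ad Z, ((e^T - 1) / T) b(T) = 1 and ((e^T - 1) / T) b(-T) = e^T, so both terms in y cancel
   and - x dt remains. *)
have dt2 : dtA w2 = - tdXA 0 x.
  rewrite (dtA_gact _ hZ1 dtA_bch_path) dt1 dtA_dA_bch_path.
  rewrite (linear_mapD (pws_linear _ nZ)) pws_expc1_bernc // -pws_opp //.
  by rewrite pws_expc1_berncN // opprD addrCA subrr addr0.
have dt3 : dtA w3 = 0.
  rewrite (dtA_gact _ gx (dtNT x)) dt2 (dtdNT hx) !(pws_NT _ hx) /expc /expc1 fact0.
  by rewrite subrr.
have cw : dtA (curv w3) = 0.
  rewrite /w3 (curv_gact charK0 (hT hx) hw2) (dtA_pws _ _ gx (dtNT x)).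
  rewrite /w2 (curv_gact charK0 bch_path_deg hw1) (dtA_pws _ _ hZ1 dtA_bch_path).
  rewrite /w1 (curv_gact charK0 (hT hy) hw0) (dtA_pws _ _ gy (dtNT y)).
  rewrite /w0 -chiA_curv dtA_cst (p0 _ _ (nilop_brA gy)) (p0 _ _ nZ).
  exact: p0 (nilop_brA gx).
have := free_const charK0 hw3 dt3; rewrite -(dtA_curv_free dt3) cw => /(_ erefl).
have ev a : evA a w3 = gact (- (a ^+ 1 *: x)) (gact (evA a Z) (gact (- (a ^+ 1 *: y)) v)).
  rewrite /evA /w3 (chiA_gact _ _ gx) /w2 (chiA_gact _ _ hZ1) /w1 (chiA_gact _ _ gy).
  by rewrite !chiAN -/(evA _ _) -/(evA _ _) -/(evA _ _) -/(evA _ _) !evA_tXA evA_cst.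
rewrite ev evA0_bch_path !expr1 !scale0r oppr0 !gact0 => /(congr1 (evA 1)).
by rewrite ev evA_cst evA1_bch_path expr1 !scale1r.
Qed.

End GaugeBCH.

(** * Cancellation in the group, and Maurer-Cartan elements of N[t,dt] *)

Section Consequences.
Variables (K : fieldType) (A : art K).
Hypothesis charK0 : [pchar K] =i pred0.

(** Apply [gact_bch_path] to e^y * v in place of v, then act by e^x on both sides. *)
Lemma gact_bch (N : dgla K) (x y v : tensor N A) : tdeg 0 1 x -> tdeg 0 1 y ->
  tdeg 1 0 v -> gact (bch x y) v = gact x (gact y v).
Proof.
move=> hx hy hv; have [n hn] := tfil_vanish A N; have [n' hn'] := tfil_vanish A (form_dgla N).
pose m := (maxn n n').+1.
have hv' : tdeg 1 0 (gact y v) by apply: gact_deg => //; exact: tdegW hy.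
have vN k : (m <= k)%N -> forall w : tensor N A, tfil k w -> w = 0.
  by move=> mk; apply: hn; apply: leq_trans mk; rewrite ltnW // ltnS leq_maxl.
have vNt k : (m <= k)%N -> forall w : tensor (form_dgla N) A, tfil k w -> w = 0.
  by move=> mk; apply: hn'; apply: leq_trans mk; rewrite ltnW // ltnS leq_maxr.
have := gact_bch_path charK0 hx hy vN vNt isT hv'.
rewrite (gactK charK0 _ (tdeg_fil hy)) => <-.
by rewrite (gactNK charK0 _ (tdeg_fil hx)).
Qed.

(** Replace x with x' in one bracket at a time: the factor x - x' brings filtration degree k, and
    the inner term, which contains c, at least one more. *)
Lemma iter_brA_sub_fil (N : dgla K) (x x' c : tensor N A) k p :
  tfil 1 x -> tfil 1 x' -> tfil k (x - x') -> tfil 1 c ->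
  tfil k.+1 (iter p (brA x) c - iter p (brA x') c).
Proof.
move=> hx hx' hxx hc; elim: p => [|p IH] /=; first by rewrite subrr; exact: (tfil_subsp _).1.
have -> (u u' : tensor N A) : brA x u - brA x' u' = brA x (u - u') + brA (x - x') u'.
  by rewrite brABr brABl addrA subrK.
apply: (subspD (tfil_subsp _)).
  by apply: tfilW (brA_fil hx IH); rewrite add1n.
rewrite -addn1; apply: brA_fil => //.
by apply: tfilW (iter_brA_fil p hx' hc); rewrite leq_addl.
Qed.

(* With U = t u and V = t v, the elements W = bch (bch U V) (- V) and U satisfy
   e^W * 0 = e^U * 0.  For elements without dt-component that vanish at t = 0, this
   forces W = U, by induction along the filtration; then take t = 1. *)
Lemma bchK (N : dgla K) (u v : tensor N A) : tdeg 0 1 u -> tdeg 0 1 v ->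
  bch (bch u v) (- v) = u.
Proof.
move=> hu hv; have hNv := subspN (tdeg_subsp _ _) hv.
pose U := tXA 1 u; pose V := tXA 1 v; pose W := bch (bch U V) (- V).
have hU : tdeg 0 1 U by exact: tXA_deg.
have hV : tdeg 0 1 V by exact: tXA_deg.
have hNV := subspN (tdeg_subsp _ _) hV.
have hUV := bch_deg hU hV; have hW : tdeg 0 1 W by exact: bch_deg.
have h0 : tdeg 1 0 (0 : tensor (form_dgla N) A) by exact: (tdeg_subsp _ _).1.
have E : gact W 0 = gact U 0.
  rewrite /W gact_bch // gact_bch //; last by apply: gact_deg => //; exact: tdegW hNV.
  by rewrite (gactNK charK0 _ (tdeg_fil hV)).
have nW := nilop_brA (tdeg_fil hW); have nU := nilop_brA (tdeg_fil hU).
pose c := pws (@expc1 K) (brA U) (dA U).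
have cE : pws (@expc1 K) (brA W) (dA W) = c.
  move: E; rewrite (gact_exp _ (tdeg_fil hW)) (gact_exp _ (tdeg_fil hU)).
  by rewrite (linear_map0 (pws_linear _ nW)) (linear_map0 (pws_linear _ nU)) !sub0r => /oppr_inj.
have hc : tfil 1 c.
  apply: (subsp_pws (tfil_subsp _)); last by apply: dA_fil; exact: tdeg_fil hU.
  by move=> w hw; apply: tfilW (brA_fil (tdeg_fil hU) hw).
have dW : dA W = pws (bernc K) (brA W) c by rewrite -cE pws_bernc_expc1.
have dU : dA U = pws (bernc K) (brA U) c by rewrite pws_bernc_expc1.
have freeD : subsp [set w : tensor (form_dgla N) A | dtA w = 0]%classic.
  split=> [|a w w' /= w0 w0']; first exact: linear_map0 (@dtA_linear K A N).
  by rewrite (@dtA_linear K A N) w0 w0' scaler0 addr0.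
have freeB w w' : dtA w = 0 -> dtA w' = 0 -> dtA (brA w w' : tensor (form_dgla N) A) = 0.
  by move=> w0 w0'; rewrite dtA_brA_free // w0' brA0r.
have U0 : dtA U = 0 by exact: dtA_tXA.
have V0 : dtA V = 0 by exact: dtA_tXA.
have NV0 : dtA (- V) = 0 by exact: (subspN freeD).
have W0 : dtA W = 0.
  apply: (bch_sub freeD freeB _ (tdeg_fil hNV) _ NV0); first exact: tdeg_fil hUV.
  exact: (bch_sub freeD freeB (tdeg_fil hU) (tdeg_fil hV)).
have evW a : evA a W = bch (bch (a *: u) (a *: v)) (- (a *: v)).
  rewrite /evA /W (chiA_bch _ (tdeg_fil hUV) (tdeg_fil hNV)).
  rewrite (chiA_bch _ (tdeg_fil hU) (tdeg_fil hV)).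
  by rewrite chiAN -/(evA _ _) -/(evA _ _) !evA_tXA expr1.
have z0 : tdeg 0 1 (0 : tensor N A) by exact: (tdeg_subsp _ _).1.
have D0 : evA 0 (W - U) = 0.
  rewrite (linear_mapD (evA_linear 0)) evW !scale0r oppr0 !bch0r // add0r.
  by rewrite -scaleN1r (linear_mapZ (evA_linear 0)) evA_tXA expr1 scale0r scaler0.
(* W - U is the integral of the dt-component of its differential b(ad W) c - b(ad U) c, and by
   [iter_brA_sub_fil] this differential lies one step deeper in the filtration than W - U. *)
have DE : W - U = JA (dtA (dA (W - U))).
  have hD : tdeg 0 1 (W - U) by exact: (subspB (tdeg_subsp _ _)).
  rewrite (JA_dtA_dA charK0 hD); first by rewrite sg0 scale1r D0 (linear_map0 (@cstA_linear K A N)) subr0.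
  exact: (subspB freeD).
have fil k : tfil k (W - U).
  elim: k => [|k IH]; first exact: tfil0.
  rewrite DE; apply: JA_fil; apply: dtA_fil; rewrite dAB dW dU.
  have [n hn] := nilopW nW; have [n' hn'] := nilopW nU.
  rewrite (pwsE _ nW (hn _ (leq_maxl n n') _)) (pwsE _ nU (hn' _ (leq_maxr n n') _)).
  rewrite -sumrB; apply: (subsp_sum (tfil_subsp _)) => i _; rewrite -scalerBr.
  apply: (subspZ (tfil_subsp _)); exact: (iter_brA_sub_fil _ (tdeg_fil hW) (tdeg_fil hU) IH hc).
have [n /(_ _ (leqnn n) _ (fil n)) /eqP] := tfil_vanish A (form_dgla N).
rewrite subr_eq0 => /eqP/(congr1 (evA 1)).
by rewrite evW evA_tXA expr1 !scale1r.
Qed.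

Lemma dtA_dtA (N : dgla K) (x : tensor (form_dgla N) A) : dtA (dtA x) = dtA x.
Proof.
move: x; apply: (@linear_tensor_eq _ _ _ _ (fun x => dtA (dtA x)) (@dtA K A N)).
- exact: linear_comp (@dtA_linear K A N) (@dtA_linear K A N).
- exact: dtA_linear.
move=> u a; rewrite !dtA_tens; congr (tens _ a).
apply: (@form_eq _ _ (dgl_gr N) _ (fun u => fdt (fdt u)) (@fdt K N)).
- exact: linear_comp (@fdt_linear K N) (@fdt_linear K N).
- exact: fdt_linear.
move=> e j w p _; rewrite !fdt_fm; case: e; rewrite ?fdt_fm //.
exact: linear_map0 (@fdt_linear K N).
Qed.

Lemma dtA_deg (N : dgla K) i k (x : tensor (form_dgla N) A) : tdeg i k x -> tdeg i k (dtA x).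
Proof.
apply: tmem_tmap; [exact: fdt_linear | exact: homog_subsp | move=> v].
apply: (form_homog_in (@fdt_linear K N) (homog_subsp _ _)) => e j w p hw ->.
rewrite fdt_fm; case: e; last exact: (homog_subsp _ _).1.
exact: (tens_fm_homog _ hw).
Qed.

(* Gauging by a primitive of the dt-component pushes this component one step further
   in the filtration, until it vanishes. *)
Lemma MC_form_trivial (N : dgla K) (x : tensor (form_dgla N) A) :
  tdeg 1 1 x -> curv x = 0 -> exists p,
    [/\ tdeg 0 1 p, evA 0 p = 0 & x = gact p (cstA (evA 0 x))].
Proof.
have [m hm] := tfil_vanish A (form_dgla N).
suff H j k (y : tensor (form_dgla N) A) : (m <= k + j)%N -> (0 < k)%N -> tdeg 1 1 y ->
    curv y = 0 -> tfil k (dtA y) ->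
    exists p, [/\ tdeg 0 1 p, evA 0 p = 0 & y = gact p (cstA (evA 0 y))].
  move=> hx cx; apply: (H m 1%N) => //.
  by apply: dtA_fil; exact: tdeg_fil hx.
elim: j k y => [|j IH] k y mk k0 hy cy hdy.
  have y0 : dtA y = 0 by apply: hm hdy; rewrite -[k]addn0.
  exists 0; split; [exact: (tdeg_subsp _ _).1 | exact: linear_map0 (evA_linear 0)|].
  rewrite gact0; apply: (free_const charK0 hy y0).
  by rewrite -dtA_curv_free // cy (linear_map0 (@dtA_linear K A N)).
pose q := JA (dtA y).
have hq : tdeg 0 1 q by have := JA_deg (dtA_deg hy); rewrite subrr.
have hq1 := tdeg_fil hq; have nq := nilop_brA hq1.
have hqk : tfil k q by exact: JA_fil.
have q0 : evA 0 q = 0 by exact: evA0_J.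
have dq : dtA (dA q) = dtA y.
  by rewrite (dtA_dA_J charK0 (dtA_deg hy)) subrr sg0 scale1r dtA_dtA.
have [||||p [hp p0 pE]] := IH k.+1 (gact q y) _ (ltn0Sn k).
- by rewrite addSnnS.
- by apply: gact_deg.
- by apply: curv_gact_eq0 => //; exact: tdegW hy.
(* The new dt-component is e^T y_1 - ((e^T - 1) / T) y_1 with T = ad q and y_1 = [dtA y]: the
   constant terms cancel, and what remains contains a bracket of q with y_1. *)
- rewrite (dtA_gact _ hq1 (dtA_J _)) dq (pws_recl (@expc K)) // (pws_recl (@expc1 K)) //.
  rewrite /expc /expc1 fact0 !invr1 !scale1r opprD addrACA subrr add0r.
  have h : tfil k.+1 (brA q (dtA y)).
    by apply: tfilW (brA_fil hqk hdy); rewrite -addn1 leq_add2l.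
  have hb w : tfil k.+1 w -> tfil k.+1 (brA q w).
    by move=> hw; apply: tfilW (brA_fil hq1 hw); rewrite add1n.
  by apply: (subspB (tfil_subsp _)); apply: (subsp_pws (tfil_subsp _)).
have hNq := subspN (tdeg_subsp _ _) hq.
have Nq0 : evA 0 (- q) = 0 by rewrite -scaleN1r (linear_mapZ (evA_linear 0)) q0 scaler0.
exists (bch (- q) p); split; first exact: bch_deg.
  rewrite /evA (chiA_bch _ (tdeg_fil hNq) (tdeg_fil hp)) -/(evA _ _) -/(evA _ _).
  by rewrite Nq0 p0 bch0r //; exact: (tdeg_subsp _ _).1.
have e0 : evA 0 (gact q y) = evA 0 y.
  by rewrite /evA (chiA_gact _ _ hq1) -/(evA _ _) -/(evA _ _) q0 gact0.
rewrite gact_bch //; last by apply: tdegW (chiA_deg _ (chiA_deg _ hy)).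
by rewrite -e0 -pE (gactK charK0 _ hq1).
Qed.

End Consequences.

(** * The Maurer-Cartan equation of the cone *)

Section TupleSums.
Variables (V : nmodType) (T : finType).

Lemma sum_tuple_cons n (G : seq T -> V) :
  \sum_(t : n.+1.-tuple T) G t = \sum_(i : T) \sum_(t : n.-tuple T) G (i :: t).
Proof.
rewrite pair_big /= (reindex (fun q : T * n.-tuple T => [tuple of q.1 :: q.2])) //=.
exists (fun t : n.+1.-tuple T => (thead t, [tuple of behead t])) => [[i t] _|t _] /=.
  by congr pair; apply: val_inj.
by case/tupleP: t => i t; apply: val_inj.
Qed.

Lemma sum_tuple_rcons n (G : seq T -> V) :
  \sum_(t : n.+1.-tuple T) G t = \sum_(t : n.-tuple T) \sum_(i : T) G (rcons t i).
Proof.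
elim: n G => [|n IH] G.
  rewrite sum_tuple_cons exchange_big; apply: eq_bigr => t _; apply: eq_bigr => i _.
  by rewrite tuple0.
rewrite sum_tuple_cons [RHS](sum_tuple_cons _ (fun t => \sum_i G (rcons t i))).
by apply: eq_bigr => i _; rewrite (IH (fun t => G (i :: t))).
Qed.

Lemma sum_tuple_perm n (s : 'S_n) (G : n.-tuple T -> V) :
  \sum_(t : n.-tuple T) G t = \sum_t G [tuple tnth t (s i) | i < n].
Proof.
rewrite (reindex (fun t : n.-tuple T => [tuple tnth t (s i) | i < n])) //=.
exists (fun t : n.-tuple T => [tuple tnth t ((s^-1)%g i) | i < n]) => t _;
  by apply: eq_from_tnth => i; rewrite !tnth_mktuple ?permK ?permKV.
Qed.

End TupleSums.

Lemma multilinear_expand (K : fieldType) (V U : lmodType K) (F : seq V -> U)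
    (I : finType) (u : I -> V) n : multilinear F ->
  F (nseq n (\sum_i u i)) = \sum_(t : n.-tuple I) F (map u t).
Proof.
move=> Fl; suff H s0 : F (s0 ++ nseq n (\sum_i u i)) =
    \sum_(t : n.-tuple I) F (s0 ++ map u t) by exact: (H [::]).
elim: n s0 => [|n IH] s0.
  rewrite (big_pred1 [tuple]) // => t.
  by apply/esym/eqP; rewrite tuple0.
rewrite (sum_tuple_cons _ (fun t => F (s0 ++ map u t))) /=.
rewrite (linear_map_sum _ _ _ (Fl s0 _)); apply: eq_bigr => i _.
by rewrite -cat_rcons IH; apply: eq_bigr => t _; rewrite cat_rcons.
Qed.

(** * Operations extended to K[t,dt], on generators *)

Section FormsMonoid.
Variable K : fieldType.

Lemma fmulA : associative (@fmul K).
Proof.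
by move=> r s t; rewrite /fmul; congr pair => /=; rewrite ?mulrDr ?mulrDl !mulrA ?addrA.
Qed.

Lemma fmulC : commutative (@fmul K).
Proof.
by move=> r s; rewrite /fmul; congr pair => /=; rewrite mulrC // addrC; congr (_ + _); rewrite mulrC.
Qed.

Lemma fmul1l : left_id (fone K) (@fmul K).
Proof. by case=> p q; rewrite /fmul /= !mul1r mul0r addr0. Qed.

HB.instance Definition _ :=
  Monoid.isComLaw.Build (forms K) (fone K) (@fmul K) fmulA fmulC fmul1l.

Lemma fmul0r (r : forms K) : fmul r 0 = 0.
Proof. exact: linear_map0 ((fmul_bilinear K).1 r). Qed.

Definition formprod (T : Type) (e : T -> bool) (p : T -> {poly K}) (s : seq T) : forms K :=
  \big[@fmul K/fone K]_(i <- s) fm (e i) (p i).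

Lemma foldr_fmul (T : Type) (e : T -> bool) (p : T -> {poly K}) (s : seq T) :
  foldr (@fmul K) (fone K) [seq fm (e i) (p i) | i <- s] = formprod e p s.
Proof. by rewrite /formprod; elim: s => [|i s IH]; rewrite ?big_nil ?big_cons //= IH. Qed.

Lemma formprodE (T : Type) (e : T -> bool) (p : T -> {poly K}) (s : seq T) :
  formprod e p s = if (count e s <= 1)%N then fm (count e s == 1%N) (\prod_(i <- s) p i) else 0.
Proof.
rewrite /formprod; elim: s => [|i s IH]; first by rewrite !big_nil.
rewrite !big_cons IH /=; case: (e i) => /=; last first.
  rewrite add0n; case: ifP => _; last by rewrite fmul0r.
  by rewrite fmul_fm /=.
case: (count e s) => [|[|c]] /=; rewrite ?fmul0r //.
  by rewrite fmul_fm.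
by rewrite fmul_fm.
Qed.

(** In degree 0 the factor v and its form have the same parity, hence the same list twice. A sign
    would need two odd positions, and then the product of the forms is already 0. *)
Lemma koszul_exp_le1 (s : seq bool) : (count id s <= 1)%N -> koszul_exp s s = 0%N.
Proof.
move=> s1; apply: big1 => j _; apply: big1 => i _; apply/eqP.
rewrite eqb0; apply/negP => /andP[si sj].
have ij := ltn_ord i; have js := ltn_ord j.
have : (1 < count id s)%N.
  rewrite -(cat_take_drop j s) count_cat (drop_nth false js) /= sj addnA addn1 ltnS.
  rewrite ltn_addr // -has_count; apply/(has_nthP false); exists i.
    by rewrite size_take js.
  by rewrite nth_take.
by rewrite ltnNge s1.
Qed.

End FormsMonoid.

Section FormOp.
Variables (K : fieldType) (V : lmodType K) (G : grading V).

Definition slot_bilinear (U : lmodType K) (F : seq ((bool * V) * (bool * forms K)) -> U) :=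
  forall b e s1 s2, bilinear_map (fun v r => F (s1 ++ ((b, v), (e, r)) :: s2)).

Lemma bihlift_fm (U : lmodType K) (F : seq ((bool * V) * (bool * forms K)) -> U)
    (I : Type) (e : I -> bool) (v : I -> V) (p : I -> {poly K}) (s : seq I) :
  slot_bilinear F -> (forall i b, parity G b (v i) = if b == e i then v i else 0) ->
  bihlift G F [seq (v i, fm (e i) (p i)) | i <- s] =
  F [seq ((e i, v i), (e i, fm (e i) (p i))) | i <- s].
Proof.
move=> + hv; elim: s F => [|i s IH] F hF //=.
have hF' b (w : V) e' r : slot_bilinear (fun c => F (((b, w), (e', r)) :: c)).
  by move=> b1 e1 s1 s2; exact: (hF b1 e1 (_ :: s1) s2).
rewrite (bigD1 (e i)) //= [X in _ + X]big1 ?addr0 => [|b /negPf be].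
  rewrite (bigD1 (e i)) //= [X in _ + X]big1 ?addr0 => [|b /negPf be].
    by rewrite IH // hv eqxx fpart_fm eqxx.
  rewrite IH // fpart_fm be.
  exact: (linear_map0 ((hF (e i) b [::] _).1 _)).
apply: big1 => e' _; rewrite IH // hv be.
exact: (linear_map0 ((hF b e' [::] _).2 _)).
Qed.

Variable q : seq V -> V.
Hypothesis ql : multilinear q.

Let Fop (c : seq ((bool * V) * (bool * forms K))) : tensor V (forms K) :=
  (-1) ^+ koszul_exp [seq p.1.1 | p <- c] [seq p.2.1 | p <- c] *:
    tens (q [seq p.1.2 | p <- c]) (foldr (@fmul K) (fone K) [seq p.2.2 | p <- c]).

Let Fop_bilinear : slot_bilinear Fop.
Proof.
move=> b e s1 s2; split=> [v|r].
  apply: (@linear_ext _ _ _ (fun r => (-1) ^+ koszul_exp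
    [seq p.1.1 | p <- s1 ++ ((b, v), (e, 0 : forms K)) :: s2]
    [seq p.2.1 | p <- s1 ++ ((b, v), (e, 0 : forms K)) :: s2] *:
    tens (q [seq p.1.2 | p <- s1 ++ ((b, v), (e, 0 : forms K)) :: s2])
      (foldr (@fmul K) (fone K) ([seq p.2.2 | p <- s1] ++ r :: [seq p.2.2 | p <- s2])))).
    by move=> r; rewrite /Fop !map_cat.
  apply: linear_scale.
  exact: linear_comp ((tens_bilinear _ _).1 _) (foldr_fmul_linear _ _).
apply: (@linear_ext _ _ _ (fun v => (-1) ^+ koszul_exp
    [seq p.1.1 | p <- s1 ++ ((b, 0 : V), (e, r)) :: s2]
    [seq p.2.1 | p <- s1 ++ ((b, 0 : V), (e, r)) :: s2] *:
    tens (q ([seq p.1.2 | p <- s1] ++ v :: [seq p.1.2 | p <- s2]))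
      (foldr (@fmul K) (fone K) [seq p.2.2 | p <- s1 ++ ((b, 0 : V), (e, r)) :: s2]))).
  by move=> v; rewrite /Fop !map_cat.
apply: linear_scale.
exact: linear_comp ((tens_bilinear _ _).2 _) (ql _ _).
Qed.

Lemma form_op_main (I : Type) (e : I -> bool) (v : I -> V) (p : I -> {poly K}) (s : seq I) :
  (forall i b, parity G b (v i) = if b == e i then v i else 0) ->
  mlift (bihlift G Fop) [seq tens (v i) (fm (e i) (p i)) | i <- s] =
  tens (q (map v s)) (formprod e p s).
Proof.
move=> hv.
rewrite (_ : [seq tens (v i) (fm (e i) (p i)) | i <- s] =
  [seq tens c.1 c.2 | c <- [seq (v i, fm (e i) (p i)) | i <- s]]); last by rewrite -map_comp.
rewrite mlift_tens; last exact: bihlift_multibilinear Fop_bilinear.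
rewrite (bihlift_fm _ _ Fop_bilinear hv) /Fop -!map_comp /= foldr_fmul.
rewrite formprodE; case: leqP => c1; last by rewrite tens0r scaler0.
by rewrite koszul_exp_le1 ?scale1r // count_map.
Qed.

Lemma form_op_fm (I : Type) (e : I -> bool) (v : I -> V) (p : I -> {poly K}) (s : seq I) :
  (forall i b, parity G b (v i) = if b == e i then v i else 0) -> (1 < size s)%N ->
  form_op G q [seq tens (v i) (fm (e i) (p i)) | i <- s] =
  tens (q (map v s)) (formprod e p s).
Proof.
move=> hv ss; rewrite -(form_op_main _ _ hv) /form_op.
by case: s ss => [|i [|j s]] //= _; rewrite addr0.
Qed.

Lemma form_op1_fm e v (p : {poly K}) :
  (forall b, parity G b v = if b == e then v else 0) ->
  form_op G q [:: tens v (fm e p)] =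
  tens (q [:: v]) (fm e p) + (if e then 0 else tens v (fm true p^`())).
Proof.
move=> hv; rewrite /form_op; congr (_ + _).
  have := @form_op_main unit (fun=> e) (fun=> v) (fun=> p) [:: tt] (fun=> hv).
  by rewrite /= /formprod big_seq1.
rewrite tlift_tens.
  rewrite (bigD1 e) //= big1 ?addr0 => [|b /negPf be]; last first.
    by rewrite hv be tens0l scaler0.
  by rewrite hv eqxx fdiff_fm; case: e {hv}; rewrite ?tens0r ?scaler0 ?scale1r.
split=> [w|r]; apply: linear_sum => b _; apply: linear_scale.
  exact: linear_comp ((tens_bilinear _ _).1 _) (@fdiff_linear K).
exact: linear_comp ((tens_bilinear _ _).2 _) (parity_linear G b).
Qed.

End FormOp.

Lemma opA_tens (K : fieldType) (A : art K) (g : linf K) (I : Type) (x : I -> g)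
    (a : I -> A) (s : seq I) :
  opA [seq (tens (x i) (a i) : tensor g A) | i <- s] =
  tens (lf_op (map x s)) (\prod_(i <- s) a i).
Proof.
rewrite /opA (_ : [seq _ | i <- s] =
  [seq tens c.1 c.2 | c <- [seq (x i, a i) | i <- s]]); last by rewrite -map_comp.
by rewrite mlift_tens ?big_map -?map_comp //; exact: opA_multibilinear.
Qed.

(** * Operations of the cone on a sum of generators of degree 0 *)

Section ConeForms.
Variables (K : fieldType) (A : art K) (L M : dgla K) (chi : dgla_mor L M).
Local Notation C := (cone_space L M).
Local Notation g := (cone_linf chi).
Local Notation Lt := (form_dgla L).
Local Notation Mt := (form_dgla M).
Local Notation chit := (@chiA K Lt Mt (form_mor chi) A).

Definition lform (x : tensor (form_linf g) A) : tensor Lt A :=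
  tmap (tmap (fst : C -> L) (@id (forms K))) (@id A) x.
Definition mform (x : tensor (form_linf g) A) : tensor Mt A :=
  tmap (tmap (snd : C -> M) (@id (forms K))) (@id A) x.

Let fstl : linear (tmap (fst : C -> L) (@id (forms K))).
Proof. by apply: tmap_linear. Qed.
Let sndl : linear (tmap (snd : C -> M) (@id (forms K))).
Proof. by apply: tmap_linear. Qed.

Lemma lform_linear : linear lform. Proof. exact: tmap_linear fstl (@linear_id K A). Qed.
Lemma mform_linear : linear mform. Proof. exact: tmap_linear sndl (@linear_id K A). Qed.

Lemma lform_tens (v : C) (r : forms K) (a : A) :
  lform (tens (tens v r : form_linf g) a) = tens (tens v.1 r : Lt) a.
Proof.
rewrite /lform tmap_tens //; congr (tens _ _); exact: tmap_tens.
Qed.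

Lemma mform_tens (v : C) (r : forms K) (a : A) :
  mform (tens (tens v r : form_linf g) a) = tens (tens v.2 r : Mt) a.
Proof.
rewrite /mform tmap_tens //; congr (tens _ _); exact: tmap_tens.
Qed.

Variables (I : finType) (e : I -> bool) (l : I -> L) (m : I -> M)
  (p : I -> {poly K}) (a : I -> A).
Hypothesis hl : forall i, homog (dgl_gr L) (1 - (e i)%:Z) (l i).
Hypothesis hm : forall i, homog (dgl_gr M) (- (e i)%:Z) (m i).

Let v i : C := (l i, m i).

Let hv i b : parity (cone_grading L M) b (v i) = if b == e i then v i else 0.
Proof.
have h : homog (cone_grading L M) (- (e i)%:Z) (v i).
  by rewrite /homog /= /cone_proj addrC /=; congr pair; [exact: hl | exact: hm].
by rewrite (parity_homog b h) abszN absz_nat oddb eq_sym.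
Qed.

(** In total degree 0 the pair (l, m) next to a form of degree e has degree - e in C_chi[1], so l
    has degree 1 - e in L and m degree - e in M. Every element of degree 0 over m_A has this shape,
    by [form_decomp]. *)
Definition gen_sum : tensor (form_linf g) A :=
  \sum_i tens (tens (v i) (fm (e i) (p i)) : form_linf g) (a i).
Local Notation z := gen_sum.

Let X i : tensor Lt A := tens (tens (l i) (fm (e i) (p i)) : Lt) (a i).
Let Y i : tensor Mt A := tens (tens (m i) (fm (e i) (p i)) : Mt) (a i).
Let W i : tensor Mt A := tens (tens (chi (l i)) (fm (e i) (p i)) : Mt) (a i).

Lemma lform_gen : lform z = \sum_i X i.
Proof.
rewrite (linear_map_sum _ _ _ lform_linear); apply: eq_bigr => i _.
by rewrite lform_tens.
Qed.

Lemma mform_gen : mform z = \sum_i Y i.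
Proof.
rewrite (linear_map_sum _ _ _ mform_linear); apply: eq_bigr => i _.
by rewrite mform_tens.
Qed.

Lemma chi_gen : chit (lform z) = \sum_i W i.
Proof.
rewrite lform_gen (linear_map_sum _ _ _ (@chiA_linear K A Lt Mt _)); apply: eq_bigr => i _.
by rewrite chiA_tens /= form_map_tens.
Qed.

Lemma opA_gen n : opA (nseq n z) = \sum_(t : n.-tuple I)
  tens (form_op (cone_grading L M) (cone_op chi) [seq tens (v i) (fm (e i) (p i)) | i <- t]
    : form_linf g) (\prod_(i <- t) a i).
Proof.
have ml : multilinear (@opA K A (form_linf g)).
  by apply: mlift_multilinear; exact: opA_multibilinear.
rewrite (multilinear_expand _ _ ml); apply: eq_bigr => t _.
exact: (@opA_tens K A (form_linf g) I (fun i => tens (v i) (fm (e i) (p i))) a t).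
Qed.

Let cone_op_gen (s : seq I) : cone_op chi (map v s) = cone_homog chi [seq (e i, v i) | i <- s].
Proof.
rewrite /cone_op (_ : map v s = [seq c.2 | c <- [seq (- (e i)%:Z, v i) | i <- s]]); last first.
  by rewrite -map_comp.
rewrite hlift_homog.
- by rewrite -map_comp; congr cone_homog; apply: eq_map => i /=; rewrite abszN absz_nat oddb.
- exact: cone_homog_linear.
- move=> _ /mapP[i _ ->] /=; rewrite /homog /= /cone_proj addrC /=.
  by congr pair; [exact: hl | exact: hm].
Qed.

Lemma opA_gen_ge2 n : (1 < n)%N -> opA (nseq n z) = \sum_(t : n.-tuple I)
  tens (tens (cone_homog chi [seq (e i, v i) | i <- t]) (formprod e p t) : form_linf g)
    (\prod_(i <- t) a i).
Proof.
move=> n1; rewrite opA_gen; apply: eq_bigr => t _; congr (tens _ _).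
rewrite (form_op_fm (@cone_op_multilinear K L M chi) p hv) ?size_tuple //.
by rewrite cone_op_gen.
Qed.

Lemma sum_tuple1 (V : nmodType) (G : seq I -> V) :
  \sum_(t : 1.-tuple I) G t = \sum_i G [:: i].
Proof.
rewrite sum_tuple_cons; apply: eq_bigr => i _.
by rewrite (big_pred1 [tuple]) // => t; apply/esym/eqP; rewrite tuple0.
Qed.

Lemma sum_tuple2 (V : nmodType) (G : seq I -> V) :
  \sum_(t : 2.-tuple I) G t = \sum_i \sum_j G [:: i; j].
Proof.
rewrite sum_tuple_cons; apply: eq_bigr => i _.
exact: (sum_tuple1 (fun t => G (i :: t))).
Qed.

Lemma opA_gen1 : opA [:: z] = \sum_i tens
  (tens (cone_op1 chi (v i)) (fm (e i) (p i)) +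
   (if e i then 0 else tens (v i) (fm true (p i)^`())) : form_linf g) (a i).
Proof.
rewrite -[[:: z]]/(nseq 1 z) opA_gen (sum_tuple1 (fun t => tens
  (form_op (cone_grading L M) (cone_op chi) [seq tens (v i) (fm (e i) (p i)) | i <- t]
    : form_linf g) (\prod_(i <- t) a i))).
apply: eq_bigr => i _; rewrite big_seq1; congr (tens _ _).
rewrite /= (form_op1_fm (@cone_op_multilinear K L M chi) (p i) (hv i)).
by have := cone_op_gen [:: i]; rewrite /= => ->.
Qed.

(** The extension of scalars adds l p' dt, as v has degree 0 in C_chi[1]. Since l has degree 1 in L,
    this is also the derivative term of - d(l p). *)
Lemma lform_op1 : lform (opA [:: z]) = - dA (lform z).
Proof.
rewrite opA_gen1 lform_gen !(linear_map_sum _ _ _ lform_linear) (linear_map_sum _ _ _ dA_linear).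
rewrite -sumrN; apply: eq_bigr => i _; rewrite tensDl (linear_mapD lform_linear) lform_tens.
rewrite /X dA_form_tens (fd_d_fm _ _ (hl i)) tensDl opprD /= -!scaleN1r -!tensZl.
congr (_ + _); case: (e i); first by rewrite scaler0 !tens0l (linear_map0 lform_linear).
by rewrite lform_tens subr0 sg1 !tensZl scalerA mulrNN mulr1 scale1r.
Qed.

Lemma mform_op1 : mform (opA [:: z]) = - chit (lform z) + dA (mform z).
Proof.
rewrite opA_gen1 chi_gen mform_gen !(linear_map_sum _ _ _ mform_linear).
rewrite (linear_map_sum _ _ _ dA_linear) -sumrN -big_split; apply: eq_bigr => i _ /=.
rewrite tensDl (linear_mapD mform_linear) mform_tens.
rewrite /Y /W dA_form_tens (fd_d_fm _ _ (hm i)) !tensDl -addrA; congr (_ + _).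
  by rewrite -!scaleN1r !tensZl.
congr (_ + _); case: (e i); first by rewrite !tens0l (linear_map0 mform_linear).
by rewrite mform_tens oppr0 sg0 scale1r.
Qed.

(** The sign (-1)^|l_1| of the operation and the sign of moving dt past l_2 in the bracket of
    L[t,dt] always differ by the same factor -1. *)
Lemma lform_op2 : lform (opA [:: z; z]) = - brA (lform z) (lform z).
Proof.
rewrite -[[:: z; z]]/(nseq 2 z) opA_gen_ge2 // (linear_map_sum _ _ _ lform_linear).
under eq_bigr do rewrite lform_tens.
rewrite (sum_tuple2 (fun t => tens (tens (cone_homog chi [seq (e i, v i) | i <- t]).1
  (formprod e p t) : Lt) (\prod_(i <- t) a i))).
rewrite lform_gen (linear_map_sum _ _ _ (brAl _)) -sumrN; apply: eq_bigr => i _.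
rewrite (linear_map_sum _ _ _ (brAr _)) -sumrN; apply: eq_bigr => j _.
rewrite brA_tens big_cons big_seq1 /formprod big_cons big_seq1 fmul_fm /=.
rewrite (fd_br_fm _ _ _ _ _ (hl j)); case: (e i) (e j) (hl j) => [] [] hj /=;
  rewrite ?tens0r ?tens0l ?oppr0 ?subr0 ?sg1 ?scale1r ?scaleN1r ?tensZl //.
- by rewrite scaleN1r opprK.
- by rewrite !tensNl.
- by rewrite !tensNl.
Qed.

Lemma mform_op2 : (2%:R != 0 :> K) -> mform (opA [:: z; z]) = - brA (mform z) (chit (lform z)).
Proof.
move=> two0; rewrite -[[:: z; z]]/(nseq 2 z) opA_gen_ge2 // (linear_map_sum _ _ _ mform_linear).
under eq_bigr do rewrite mform_tens.
rewrite (sum_tuple2 (fun t => tens (tens (cone_homog chi [seq (e i, v i) | i <- t]).2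
  (formprod e p t) : Mt) (\prod_(i <- t) a i))).
pose H i j : tensor Mt A := tens (tens (cone_ml chi (e i) (m i) (l j))
  (formprod e p [:: i; j]) : Mt) (a i * a j).
(* The two mixed terms of the operation are exchanged by swapping i and j, which cancels the factor
   1/2 of [cone_ml]. *)
transitivity (\sum_i \sum_j (H i j + H j i)).
  apply: eq_bigr => i _; apply: eq_bigr => j _; rewrite big_cons big_seq1 /= !tensDl /H.
  congr (_ + _); rewrite [a j * a i]mulrC; congr (tens _ _).
  rewrite !formprodE /= !addn0 !big_cons !big_nil !mulr1 [p j * p i]mulrC [(e j + e i)%N]addnC.
  by case: (e i) (e j) => [] []; rewrite /= ?tens0r // expr0 scale1r.
have -> : \sum_i \sum_j (H i j + H j i) = 2%:R *: \sum_i \sum_j H i j.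
  under eq_bigr do rewrite big_split; rewrite big_split /= [X in _ + X]exchange_big /=.
  by rewrite -mulr2n -[RHS]/(2%:R *: _) scaler_nat.
have HE i j : H i j = - (2%:R^-1 *: brA (Y i) (W j)).
  rewrite brA_tens /= (fd_br_fm _ _ _ _ _ (dgm_deg chi (hl j))) /H /formprod.
  rewrite big_cons big_seq1 fmul_fm /cone_ml.
  case: (e i) (e j) (hl j) => [] [] hj; rewrite /= ?tens0r ?tens0l ?scaler0 ?oppr0 //.
  - by rewrite subr0 sg1 !tensZl scaleN1r scalerN opprK expr2 mulrNN mulr1 mul1r.
  - by rewrite scale1r !tensZl expr1 mulN1r scaleNr.
  - by rewrite scale1r !tensZl expr1 mulN1r scaleNr.
rewrite mform_gen chi_gen (linear_map_sum _ _ _ (brAl _)) -sumrN scaler_sumr.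
apply: eq_bigr => i _; rewrite (linear_map_sum _ _ _ (brAr _)) -sumrN scaler_sumr.
apply: eq_bigr => j _; rewrite HE scalerN scalerA mulfV // scale1r.
by [].
Qed.

Let nest (t : seq I) (w : M) : M := foldr (fun i w => dgl_br (m i) w) w t.

Lemma nest_homog (t : seq I) j :
  homog (dgl_gr M) (1 - (count e (rcons t j))%:Z) (nest t (chi (l j))).
Proof.
elim: t => [|i t IH] /=; first by rewrite addn0; exact: dgm_deg (hl j).
have := dgl_br_deg (hm i) IH; rewrite PoszD opprD addrA [- _ + 1]addrC addrA.
by [].
Qed.

(** A dt attached to some m_i must pass the bracket nested to its right, which has degree 1 as no
    other dt can occur; a dt attached to l_j passes nothing. Hence the sign depends only on the odd
    entries of t. *)
Lemma nest_pure (t : seq I) j : foldr (fun i w => brA (Y i) w) (W j) t =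
  tens (tens (nest t (chi (l j))) ((-1) ^+ count e t *: formprod e p (rcons t j)) : Mt)
    (\prod_(i <- rcons t j) a i).
Proof.
elim: t => [|i t IH].
  by rewrite /= expr0 scale1r /formprod !big_seq1.
rewrite /= IH brA_tens big_cons; congr (tens _ _); rewrite /= !tensZr.
rewrite (linear_mapZ ((fd_br_bilinear M).1 _)) {2}/formprod big_cons -/(formprod e p _) formprodE.
have hw := nest_homog t j; have cE : count e (rcons t j) = (count e t + e j)%N.
  by rewrite -cats1 count_cat /= addn0.
case: leqP => c1; last by rewrite tens0r (linear_map0 ((fd_br_bilinear M).1 _)) fmul0r tens0r !scaler0.
rewrite (fd_br_fm _ _ _ _ _ hw) fmul_fm exprD.
case: (e i) => /=; last by rewrite mul1r scale1r.
case: (count e _) c1 cE => [|[|c]] //= _ cE; last by rewrite tens0r !scaler0.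
have -> : count e t = 0%N by move/esym/eqP: cE; rewrite addn_eq0 => /andP[/eqP].
by rewrite subr0 sg1 expr0 expr1 scale1r mulr1.
Qed.

Lemma iter_expand n : iter n (brA (mform z)) (chit (lform z)) =
  \sum_(t : n.-tuple I) \sum_j foldr (fun i w => brA (Y i) w) (W j) t.
Proof.
rewrite mform_gen chi_gen; elim: n => [|n IH].
  by rewrite (big_pred1 [tuple]) // => t; apply/esym/eqP; rewrite tuple0.
rewrite iterS IH (sum_tuple_cons _ (fun t => \sum_j foldr (fun i w => brA (Y i) w) (W j) t)).
rewrite (linear_map_sum _ _ _ (brAl _)); apply: eq_bigr => i _.
rewrite (linear_map_sum _ _ _ (brAr _)); apply: eq_bigr => t _.
by rewrite (linear_map_sum _ _ _ (brAr _)).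
Qed.

(** The value found in [nest_pure], as a function of the whole list with the index of l in last
    place; in this form the sum over tuples can be reindexed by permutations of all positions. *)
Let nestlast (s : seq I) : tensor Mt A :=
  if s is i :: s' then
    tens (tens (nest (belast i s') (chi (l (last i s'))))
      ((-1) ^+ count e (belast i s') *: formprod e p s) : Mt) (\prod_(k <- s) a k)
  else 0.

Let nestlast_rcons (t : seq I) j : nestlast (rcons t j) =
  tens (tens (nest t (chi (l j))) ((-1) ^+ count e t *: formprod e p (rcons t j)) : Mt)
    (\prod_(i <- rcons t j) a i).
Proof.
by case: t => [|i t] //; rewrite /nestlast rcons_cons belast_rcons last_rcons.
Qed.

Lemma iter_nestlast n : iter n (brA (mform z)) (chit (lform z)) =
  \sum_(t : n.+1.-tuple I) nestlast t.
Proof.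
rewrite iter_expand (sum_tuple_rcons _ nestlast); apply: eq_bigr => t _.
by apply: eq_bigr => j _; rewrite nestlast_rcons nest_pure.
Qed.

Lemma count_tnth n (t : n.-tuple I) : count e t = (\sum_(i < n) e (tnth t i))%N.
Proof. by rewrite -sum1_count big_mkcond big_tuple; apply: eq_bigr => i _; case: (e _). Qed.

Lemma count_enum n (f : 'I_n -> I) :
  count e [seq f i | i <- enum 'I_n] = (\sum_(i < n) e (f i))%N.
Proof.
rewrite count_map -sum1_count big_mkcond big_enum /=.
by apply: eq_bigr => i _; case: (e _).
Qed.

Lemma count_le1_tnth n (t : n.-tuple I) i j : (count e t <= 1)%N -> i != j ->
  e (tnth t i) && e (tnth t j) = false.
Proof.
move=> c1 ij; apply/negbTE/negP => /andP[ei ej].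
move: c1; rewrite count_tnth (bigD1 i) //= (bigD1 j) 1?eq_sym //= ei ej.
by [].
Qed.

Let tperm n (t : n.+1.-tuple I) (j : 'I_n.+1) (s : 'S_n) :=
  [tuple tnth t (lift_perm ord_max j s i) | i < n.+1].

Let tpermE n (t : n.+1.-tuple I) (j : 'I_n.+1) (s : 'S_n) :
  tval (tperm t j s) = rcons [seq tnth t (lift j (s i)) | i <- enum 'I_n] (tnth t j).
Proof.
rewrite /= enum_ordSr map_rcons lift_perm_id -map_comp; congr rcons.
apply: eq_map => i /=; congr (tnth t _); rewrite -(lift_perm_lift ord_max j).
by congr (lift_perm _ _ _ _); apply: val_inj; rewrite /= /bump leqNgt ltn_ord.
Qed.

Let tperm_perm n (t : n.+1.-tuple I) (j : 'I_n.+1) (s : 'S_n) : perm_eq (tperm t j s) t.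
Proof. by apply/tuple_permP; exists (lift_perm ord_max j s). Qed.

Lemma cone_homog_gen n (t : n.+1.-tuple I) : (1 < n)%N ->
  (cone_homog chi [seq (e i, v i) | i <- t]).2 =
  \sum_(j < n.+1) (-1) ^+ (\sum_(k < n.+1 | (j < k)%N) (e (tnth t j) && e (tnth t k)))%N *:
    cone_mml chi (fun i => e (tnth t (lift j i))) (fun i => m (tnth t (lift j i)))
      (l (tnth t j)).
Proof.
move=> n1; set c := [seq _ | i <- t]; have sc : size c = n.+1 by rewrite size_map size_tuple.
have -> : cone_homog chi c = (0, cone_high chi (size c).-1
    (fun i => (nth (false, 0) c i).1) (fun i => (nth (false, 0) c i).2)).
  by move: sc; case: c => [|[? ?] [|[? ?] [|? c]]] //= [] nE; move: n1; rewrite -nE.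
rewrite /= sc /= /cone_high.
have nE (k : 'I_n.+1) : nth (false, 0) c k = (e (tnth t k), v (tnth t k)).
  by rewrite (nth_map (tnth t k)) ?size_tuple // -tnth_nth.
apply: eq_bigr => j _; congr (_ ^+ _ *: _).
  by apply: eq_bigr => k _; rewrite !nE.
rewrite nE; congr (@cone_mml _ _ _ _ _ _ _ _); apply: funext => i; by rewrite nE.
Qed.

(* Expand over the tuples t of summands of z, and reindex by lift_perm ord_max j s the
   term of cone_high in which l_j is moved last and the m_i are permuted by s: all the
   n! (n + 1) contributions become equal.  No Koszul sign appears, since a tuple with
   two odd entries contributes (dt)^2 = 0. *)
Lemma mform_opn n : [pchar K] =i pred0 -> (1 < n)%N -> mform (opA (nseq n.+1 z)) =
  - (n.+1`!%:R * bernc K n) *: iter n (brA (mform z)) (chit (lform z)).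
Proof.
move=> charK0 n1; rewrite opA_gen_ge2 1?ltnW // (linear_map_sum _ _ _ mform_linear).
transitivity (\sum_(t : n.+1.-tuple I) \sum_(j < n.+1) \sum_(s : 'S_n)
    (- bernc K n) *: nestlast (tperm t j s)).
  apply: eq_bigr => t _; rewrite mform_tens cone_homog_gen //.
  have fpE j s := perm_big _ (tperm_perm t j s) :
    formprod e p (tperm t j s) = formprod e p t.
  case: (leqP (count e t) 1) => [c1|c1]; last first.
    have f0 : formprod e p t = 0 by rewrite formprodE leqNgt c1.
    rewrite f0 tens0r tens0l big1 // => j _; rewrite big1 // => s _.
    have := fpE j s; rewrite f0 tpermE nestlast_rcons => ->.
    by rewrite scaler0 tens0r tens0l scaler0.
  pose Phi (w : M) : tensor Mt A :=
    tens (tens w (formprod e p t) : Mt) (\prod_(i <- t) a i).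
  have Pl : linear Phi.
    by move=> b w w'; rewrite /Phi tensDl tensZl tensDl tensZl.
  rewrite -/(Phi _) (linear_map_sum _ _ _ Pl); apply: eq_bigr => j _.
  rewrite big1 => [|k jk]; last first.
    by rewrite count_le1_tnth //; apply: contraTneq jk => ->; rewrite ltnn.
  rewrite expr0 scale1r /cone_mml (linear_mapZ Pl) (linear_map_sum _ _ _ Pl) scaler_sumr.
  apply: eq_bigr => s _; rewrite (linear_mapZ Pl) scalerA.
  have -> : koszul_sign K (fun i => e (tnth t (lift j i))) s = 1.
    apply: big1 => i _; apply: big1 => i' /andP[ii' _].
    rewrite count_le1_tnth // (inj_eq (@lift_inj _ _)) (inj_eq perm_inj).
    by apply: contraTneq ii' => ->; rewrite ltnn.
  have := fpE j s; have := perm_big _ (tperm_perm t j s) :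
    \prod_(i <- tperm t j s) a i = \prod_(i <- t) a i.
  rewrite tpermE nestlast_rcons => -> ->.
  rewrite count_enum mulr1 /Phi.
  have -> : (\sum_(i < n) e (tnth t (lift j (s i))) = \sum_(i < n) e (tnth t (lift j i)))%N.
    by rewrite [RHS](reindex_inj (@perm_inj _ s)).
  rewrite tensZr tensZl scalerA mulrC mulNr mulrN /bernc; congr (_ *: tens (tens _ _) _).
    by rewrite /nest foldr_map.
rewrite exchange_big /=.
under eq_bigr => j _ do rewrite exchange_big /=.
transitivity (\sum_(j < n.+1) \sum_(s : 'S_n)
    (- bernc K n) *: iter n (brA (mform z)) (chit (lform z))).
  apply: eq_bigr => j _; apply: eq_bigr => s _; rewrite -scaler_sumr iter_nestlast.
  by rewrite [in RHS](sum_tuple_perm (lift_perm ord_max j s)).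
rewrite !sumr_const card_ord card_Sn -mulrnA -scaler_nat scalerA; congr (_ *: _).
by rewrite factS !natrM; ring.
Qed.

Lemma lform_opn n : (1 < n)%N -> lform (opA (nseq n.+1 z)) = 0.
Proof.
move=> n1; rewrite opA_gen_ge2 1?ltnW // (linear_map_sum _ _ _ lform_linear).
rewrite big1 // => t _; rewrite lform_tens.
set c := [seq _ | i <- t]; have sc : size c = n.+1 by rewrite size_map size_tuple.
have -> : (cone_homog chi c).1 = 0.
  by move: sc; case: c => [|[? ?] [|[? ?] [|? c]]] //= [] nE; move: n1; rewrite -nE.
by rewrite !tens0l.
Qed.

End ConeForms.

(** * The components of an element of the cone in L and M *)

Section ConePairs.
Variables (K : fieldType) (A : art K) (L M : dgla K) (chi : dgla_mor L M).
Local Notation C := (cone_space L M).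
Local Notation g := (cone_linf chi).
Local Notation Lt := (form_dgla L).
Local Notation Mt := (form_dgla M).
Local Notation chit := (@chiA K Lt Mt (form_mor chi) A).
Local Notation chiA := (@chiA K L M chi A).
Local Notation lform := (@lform K A L M chi).
Local Notation mform := (@mform K A L M chi).

Definition cinl (l : L) : C := (l, 0).
Definition cinr (m : M) : C := (0, m).

Lemma cinl_linear : linear cinl.
Proof. by move=> a x y; congr pair; rewrite /= scaler0 addr0. Qed.
Lemma cinr_linear : linear cinr.
Proof. by move=> a x y; congr pair; rewrite /= scaler0 addr0. Qed.

Lemma cone_split (v : C) : v = cinl v.1 + cinr v.2.
Proof. by case: v => x y; congr pair; rewrite /= ?addr0 ?add0r. Qed.

Lemma cone_homogP i (v : C) :
  homog (cone_grading L M) i v <-> homog (dgl_gr L) (i + 1) v.1 /\ homog (dgl_gr M) i v.2.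
Proof.
case: v => x y; rewrite /homog /= /cone_proj /=; split=> [[-> ->]//|[hx hy]].
by congr pair.
Qed.

Definition lproj (x : tensor g A) : tensor L A := tmap (fst : C -> L) (@id A) x.
Definition mproj (x : tensor g A) : tensor M A := tmap (snd : C -> M) (@id A) x.
Definition cpair (l : tensor L A) (m : tensor M A) : tensor g A :=
  tmap cinl (@id A) l + tmap cinr (@id A) m.

Lemma lproj_linear : linear lproj. Proof. by apply: tmap_linear. Qed.
Lemma mproj_linear : linear mproj. Proof. by apply: tmap_linear. Qed.
Let inll : linear (tmap cinl (@id A)).
Proof. by apply: tmap_linear => //; exact: cinl_linear. Qed.
Let inrl : linear (tmap cinr (@id A)).
Proof. by apply: tmap_linear => //; exact: cinr_linear. Qed.

Lemma lproj_tens (v : g) (a : A) : lproj (tens v a) = tens v.1 a.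
Proof. exact: tmap_tens. Qed.
Lemma mproj_tens (v : g) (a : A) : mproj (tens v a) = tens v.2 a.
Proof. exact: tmap_tens. Qed.

Lemma cpair_proj x : cpair (lproj x) (mproj x) = x.
Proof.
move: x; apply: (@linear_tensor_eq _ _ _ _ (fun x => cpair (lproj x) (mproj x)) id).
- apply: linear_add; first exact: linear_comp inll lproj_linear.
  exact: linear_comp inrl mproj_linear.
- exact: linear_id.
move=> v a; rewrite lproj_tens mproj_tens /cpair.
rewrite !tmap_tens //; try exact: cinl_linear; try exact: cinr_linear.
by rewrite -tensDl -cone_split.
Qed.

Lemma proj_cpair l m : lproj (cpair l m) = l /\ mproj (cpair l m) = m.
Proof.
have H1 : lproj (tmap cinl (@id A) l) = l.
  rewrite /lproj tmap_comp //; last exact: cinl_linear.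
  exact: tmap_id.
have H2 : mproj (tmap cinr (@id A) m) = m.
  rewrite /mproj tmap_comp //; last exact: cinr_linear.
  exact: tmap_id.
have H3 : lproj (tmap cinr (@id A) m) = 0.
  move: m {H2}; apply: (@linear_tensor_eq0 _ _ _ _ (fun m => lproj (tmap cinr (@id A) m))).
    exact: linear_comp lproj_linear inrl.
  move=> v a; rewrite tmap_tens //; last exact: cinr_linear.
  by rewrite lproj_tens tens0l.
have H4 : mproj (tmap cinl (@id A) l) = 0.
  move: l {H1}; apply: (@linear_tensor_eq0 _ _ _ _ (fun l => mproj (tmap cinl (@id A) l))).
    exact: linear_comp mproj_linear inll.
  move=> v a; rewrite tmap_tens //; last exact: cinl_linear.
  by rewrite mproj_tens tens0l.
rewrite /cpair (linear_mapD lproj_linear) (linear_mapD mproj_linear).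
by rewrite H1 H2 H3 H4 addr0 add0r.
Qed.

Lemma cpair_deg l m : tdeg 1 1 l -> tdeg 0 1 m ->
  tmem (homog (lf_gr g) 0) (@maxid K A) (cpair l m).
Proof.
move=> /tdeg_maxid hl /tdeg_maxid hm; apply: subspD.
- exact/tmem_subsp/homog_subsp.
- apply: tmem_tmap hl; [exact: cinl_linear | exact: homog_subsp | move=> v hv].
  by apply/cone_homogP; split; [rewrite add0r | exact: (homog_subsp _ _).1].
- apply: tmem_tmap hm; [exact: cinr_linear | exact: homog_subsp | move=> v hv].
  by apply/cone_homogP; split; [exact: (homog_subsp _ _).1 | ].
Qed.

Lemma lproj_deg x : tmem (homog (lf_gr g) 0) (@maxid K A) x -> tdeg 1 1 (lproj x).
Proof.
move=> hx; apply/tdeg_maxid; apply: tmem_tmap hx => //; first exact: homog_subsp.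
by move=> v /cone_homogP[]; rewrite add0r.
Qed.

Lemma mproj_deg x : tmem (homog (lf_gr g) 0) (@maxid K A) x -> tdeg 0 1 (mproj x).
Proof.
move=> hx; apply/tdeg_maxid; apply: tmem_tmap hx => //; first exact: homog_subsp.
by move=> v /cone_homogP[].
Qed.

Let fl : linear (tmap cinl (@id (forms K))).
Proof. by apply: tmap_linear => //; exact: cinl_linear. Qed.
Let fr : linear (tmap cinr (@id (forms K))).
Proof. by apply: tmap_linear => //; exact: cinr_linear. Qed.

Definition fpair (l : tensor Lt A) (m : tensor Mt A) : tensor (form_linf g) A :=
  tmap (tmap cinl (@id (forms K))) (@id A) l + tmap (tmap cinr (@id (forms K))) (@id A) m.

Lemma fpair_proj z : fpair (lform z) (mform z) = z.
Proof.
have Tl : linear (tmap (tmap cinl (@id (forms K))) (@id A)) by exact: tmap_linear.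
have Tr : linear (tmap (tmap cinr (@id (forms K))) (@id A)) by exact: tmap_linear.
have ll := @lform_linear K A L M chi; have ml := @mform_linear K A L M chi.
have T : linear (fun z => fpair (lform z) (mform z)).
  by apply: linear_add; [exact: linear_comp Tl ll | exact: linear_comp Tr ml].
move: z; apply: (@linear_tensor_eq _ _ _ _ (fun z => fpair (lform z) (mform z)) id T) => //.
move=> w a; move: w; apply: (@linear_tensor_eq _ _ _ _
   (fun w : form_linf g => fpair (lform (tens w a)) (mform (tens w a)))
   (fun w : form_linf g => tens w a)).
- exact: (linear_comp T ((tens_bilinear (form_linf g) A).2 a)).
- exact: ((tens_bilinear (form_linf g) A).2 a).
move=> v r; rewrite lform_tens mform_tens /fpair !tmap_tens //;
  try exact: cinl_linear; try exact: cinr_linear.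
by rewrite -!tensDl -cone_split.
Qed.

Lemma lform_mform_eq0 z : lform z = 0 -> mform z = 0 -> z = 0.
Proof.
move=> l0 m0; rewrite -[z]fpair_proj l0 m0 /fpair.
have Tl : linear (tmap (tmap cinl (@id (forms K))) (@id A)) by exact: tmap_linear.
have Tr : linear (tmap (tmap cinr (@id (forms K))) (@id A)) by exact: tmap_linear.
by rewrite (linear_map0 Tl) (linear_map0 Tr) addr0.
Qed.

Lemma form_fpair l m : lform (fpair l m) = l /\ mform (fpair l m) = m.
Proof.
have Tl : linear (tmap (tmap cinl (@id (forms K))) (@id A)) by exact: tmap_linear.
have Tr : linear (tmap (tmap cinr (@id (forms K))) (@id A)) by exact: tmap_linear.
have ll := @lform_linear K A L M chi; have ml := @mform_linear K A L M chi.
have [H1 H4] : lform (tmap (tmap cinl (@id (forms K))) (@id A) l) = l /\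
    mform (tmap (tmap cinl (@id (forms K))) (@id A) l) = 0.
  have [s ->] := tensorE l; rewrite (linear_map_sum _ _ _ Tl).
  rewrite (linear_map_sum _ _ _ ll) (linear_map_sum _ _ _ ml); split.
    apply: eq_bigr => -[w a] _ /=; rewrite tmap_tens //.
    have [t ->] := tensorE w; rewrite (linear_map_sum _ _ _ fl).
    have tl : linear (fun w : form_linf g => lform (tens w a)).
      exact: linear_comp ll ((tens_bilinear (form_linf g) A).2 a).
    rewrite (linear_map_sum _ _ _ tl) (linear_map_sum _ _ _ ((tens_bilinear Lt A).2 a)).
    apply: eq_bigr => q _; rewrite tmap_tens //; last exact: cinl_linear.
    by rewrite lform_tens.
  rewrite big1 // => -[w a] _ /=; rewrite tmap_tens //.
  have [t ->] := tensorE w; rewrite (linear_map_sum _ _ _ fl).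
  have tl : linear (fun w : form_linf g => mform (tens w a)).
    exact: linear_comp ml ((tens_bilinear (form_linf g) A).2 a).
  rewrite (linear_map_sum _ _ _ tl) big1 // => q _; rewrite tmap_tens //; last exact: cinl_linear.
  by rewrite mform_tens !tens0l.
have [H3 H2] : lform (tmap (tmap cinr (@id (forms K))) (@id A) m) = 0 /\
    mform (tmap (tmap cinr (@id (forms K))) (@id A) m) = m.
  have [s ->] := tensorE m; rewrite (linear_map_sum _ _ _ Tr).
  rewrite (linear_map_sum _ _ _ ll) (linear_map_sum _ _ _ ml); split.
    rewrite big1 // => -[w a] _ /=; rewrite tmap_tens //.
    have [t ->] := tensorE w; rewrite (linear_map_sum _ _ _ fr).
    have tl : linear (fun w : form_linf g => lform (tens w a)).
      exact: linear_comp ll ((tens_bilinear (form_linf g) A).2 a).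
    rewrite (linear_map_sum _ _ _ tl) big1 // => q _; rewrite tmap_tens //; last exact: cinr_linear.
    by rewrite lform_tens !tens0l.
  apply: eq_bigr => -[w a] _ /=; rewrite tmap_tens //.
  have [t ->] := tensorE w; rewrite (linear_map_sum _ _ _ fr).
  have tl : linear (fun w : form_linf g => mform (tens w a)).
    exact: linear_comp ml ((tens_bilinear (form_linf g) A).2 a).
  rewrite (linear_map_sum _ _ _ tl) (linear_map_sum _ _ _ ((tens_bilinear Mt A).2 a)).
  apply: eq_bigr => q _; rewrite tmap_tens //; last exact: cinr_linear.
  by rewrite mform_tens.
rewrite /fpair (linear_mapD ll) (linear_mapD ml).
by rewrite H1 H2 H3 H4 addr0 add0r.
Qed.

Lemma fpair_deg l m : tdeg 1 1 l -> tdeg 0 1 m ->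
  tmem (homog (lf_gr (form_linf g)) 0) (@maxid K A) (fpair l m).
Proof.
move=> /tdeg_maxid hl /tdeg_maxid hm; apply: subspD.
- exact/tmem_subsp/homog_subsp.
- apply: tmem_tmap hl; [exact: fl | exact: homog_subsp | move=> v].
  apply: (form_homog_in fl (homog_subsp _ _)) => e j w p hw jE.
  rewrite tmap_tens //; last exact: cinl_linear.
  apply: (@tens_fm_homog _ _ (cone_grading L M) e 0 (- e%:Z)); last by rewrite addNr.
  apply/cone_homogP; split; last exact: (homog_subsp _ _).1.
  by rewrite /= jE addrC addrK.
- apply: tmem_tmap hm; [exact: fr | exact: homog_subsp | move=> v].
  apply: (form_homog_in fr (homog_subsp _ _)) => e j w p hw jE.
  rewrite tmap_tens //; last exact: cinr_linear.
  apply: (@tens_fm_homog _ _ (cone_grading L M) e 0 j) => //.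
  by apply/cone_homogP; split; first exact: (homog_subsp _ _).1.
Qed.

(** Total degree 0 forces |v| = - e on each generator. Scalars are absorbed into v, so that the
    finite lists of generators form a subspace, and positions in the list serve as the index
    type. *)
Lemma form_decomp z : tmem (homog (lf_gr (form_linf g)) 0) (@maxid K A) z ->
  exists (k : nat) (e : 'I_k -> bool) (l : 'I_k -> L) (m : 'I_k -> M)
    (p : 'I_k -> {poly K}) (a : 'I_k -> A),
    [/\ forall i, homog (dgl_gr L) (1 - (e i)%:Z) (l i),
        forall i, homog (dgl_gr M) (- (e i)%:Z) (m i),
        forall i, maxid (a i) & z = gen_sum chi e l m p a].
Proof.
pose Q z := exists s : seq (bool * C * {poly K} * A),
  (forall q, q \in s -> homog (cone_grading L M) (- (q.1.1.1)%:Z) q.1.1.2 /\ maxid q.2) /\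
  z = \sum_(q <- s) (tens (tens q.1.1.2 (fm q.1.1.1 q.1.2) : form_linf g) q.2).
have sQ : subsp Q.
  split=> [|b x y [s [hs ->]] [t [ht ->]]]; first by exists [::]; rewrite big_nil.
  exists ([seq (q.1.1.1, b *: q.1.1.2, q.1.2, q.2) | q <- s] ++ t); split.
    move=> q; rewrite mem_cat => /orP[/mapP[q' /hs[q1 q2] ->]|/ht//].
    by split=> //=; apply: subspZ => //; exact: homog_subsp.
  rewrite big_cat big_map scaler_sumr; congr (_ + _); apply: eq_bigr => q _ /=.
  by rewrite !tensZl.
move=> hz; suff [s [hs zE]] : Q z.
  pose T i := tnth (in_tuple s) i.
  exists (size s), (fun i => (T i).1.1.1), (fun i => (T i).1.1.2.1), (fun i => (T i).1.1.2.2),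
    (fun i => (T i).1.2), (fun i => (T i).2).
  have hT i : homog (cone_grading L M) (- ((T i).1.1.1)%:Z) (T i).1.1.2 /\ maxid (T i).2.
    by apply: hs; exact: mem_tnth.
  split.
  - by move=> i; have [/cone_homogP[h _] _] := hT i; rewrite addrC.
  - by move=> i; have [/cone_homogP[_ h] _] := hT i.
  - by move=> i; have [] := hT i.
  rewrite zE big_tnth; apply: eq_bigr => i _; rewrite /T.
  by case: (tnth _ i) => [[[e' [l' m']] p'] a'].
apply: tmem_ind hz => // v a hv ha; move: hv.
apply: (form_homog_in (R := Q) ((tens_bilinear (form_linf g) A).2 a) sQ) => e j w p hw jE.
exists [:: (e, w, p, a)]; rewrite big_seq1; split=> // q; rewrite inE => /eqP-> /=.
by split=> //; move/eqP: jE; rewrite eq_sym addr_eq0 => /eqP <-.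
Qed.

End ConePairs.

(** * From the series of operations to curvature and gauge action *)

Section MaurerCartan.
Variables (K : fieldType) (A : art K) (L M : dgla K) (chi : dgla_mor L M).
Hypothesis charK0 : [pchar K] =i pred0.
Local Notation C := (cone_space L M).
Local Notation g := (cone_linf chi).
Local Notation Lt := (form_dgla L).
Local Notation Mt := (form_dgla M).
Local Notation chit := (@chiA K Lt Mt (form_mor chi) A).
Local Notation chiA := (@chiA K L M chi A).
Local Notation lform := (@lform K A L M chi).
Local Notation mform := (@mform K A L M chi).

Lemma lform_deg z : tmem (homog (lf_gr (form_linf g)) 0) (@maxid K A) z -> tdeg 1 1 (lform z).
Proof.
have fl : linear (tmap (fst : C -> L) (@id (forms K))) by exact: tmap_linear.
move=> hz; apply/tdeg_maxid; apply: tmem_tmap hz => //; first exact: homog_subsp.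
move=> v; apply: (form_homog_in fl (homog_subsp _ _)) => e j w p hw jE.
rewrite tmap_tens //; have [h _] := (cone_homogP j w).1 hw.
by apply: (tens_fm_homog _ h); rewrite addrAC -jE add0r.
Qed.

Lemma mform_deg z : tmem (homog (lf_gr (form_linf g)) 0) (@maxid K A) z -> tdeg 0 1 (mform z).
Proof.
have fl : linear (tmap (snd : C -> M) (@id (forms K))) by exact: tmap_linear.
move=> hz; apply/tdeg_maxid; apply: tmem_tmap hz => //; first exact: homog_subsp.
move=> v; apply: (form_homog_in fl (homog_subsp _ _)) => e j w p hw jE.
rewrite tmap_tens //; have [_ h] := (cone_homogP j w).1 hw.
exact: (tens_fm_homog _ h).
Qed.

Lemma bernc1 : bernc K 1 = - 2%:R^-1.
Proof.
have := bernoulli_gf 1 charK0; rewrite !big_ord_recl big_ord0 addr0 /=.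
rewrite -/(bernc K 0) -/(bernc K 1) bernc0 // /bump /= addn0 subn0 subSS subn0.
rewrite (_ : 1`! = 1%N) // (_ : 2`! = 2%N) // divr1 mul1r => /eqP.
by rewrite addrC addr_eq0 => /eqP.
Qed.

(* The coefficients of b(-T) = T / (1 - e^(-T)), which differ from those of b(T) only
   in degree 1: B_n vanishes for odd n > 1. *)
Lemma pws_bernc_opp (V : lmodType K) (T : V -> V) v : nilop T ->
  pws (bernc K) (fun v => - T v) v = pws (fun n => bernc K n + (n == 1%N)%:R) T v.
Proof.
move=> nT; rewrite pws_berncN // pws_add; congr (_ + _).
by rewrite pws_recl // scale0r add0r pws_delta.
Qed.

(** At T = ad a the equation reads ((e^T - 1) / T) da = e^T y, and (T / (e^T - 1)) e^T = b(-T). *)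
Lemma gact_eq0 (N : dgla K) (a y : tensor N A) : tfil 1 a ->
  gact a y = 0 <-> dA a = pws (bernc K) (fun v => - brA a v) y.
Proof.
move=> ha; have na := nilop_brA ha; rewrite gact_exp //; split=> [/eqP|->].
  rewrite subr_eq0 => /eqP E; rewrite -[LHS](pws_bernc_expc1 charK0 na) -E.
  by rewrite -(pws_expc1_berncN charK0 na) pws_bernc_expc1.
by rewrite pws_expc1_berncN // subrr.
Qed.

Lemma MC_form_iff z : tmem (homog (lf_gr (form_linf g)) 0) (@maxid K A) z ->
  MC_set z <-> curv (lform z) = 0 /\ gact (mform z) (chit (lform z)) = 0.
Proof.
move=> hz; have [k [e [l [m [p [a [hl hm _ zE]]]]]]] := form_decomp hz.
pose u n := (n.+1`!%:R)^-1 *: opA (nseq n.+1 z) : tensor (form_linf g) A.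
have ll := @lform_linear K A L M chi; have ml := @mform_linear K A L M chi.
have n2 := natK_neq0 charK0 (ltn0Sn 1).
have lu : sums_to (fun n => lform (u n)) (- curv (lform z)).
  have -> : - curv (lform z) = \sum_(n < 2) lform (u n).
    rewrite !big_ord_recl big_ord0 addr0 /u !(linear_mapZ ll) /=.
    rewrite zE lform_op1 // lform_op2 // -zE.
    by rewrite (_ : 1`! = 1%N) // (_ : 2`! = 2%N) // invr1 scale1r scalerN /curv opprD.
  apply: sums_to_fin => n n1.
  by rewrite /u (linear_mapZ ll) zE lform_opn // scaler0.
have hm1 : tfil 1 (mform z) by exact: tdeg_fil (mform_deg hz).
have nT := nilop_brA hm1.
set T := brA (mform z) in nT *; set X := chit (lform z).
pose c n := bernc K n + (n == 1%N)%:R.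
(* The term [u n] has arity n + 1, and its M-component is - c_n T^n X, to which arity 1 adds d m.
   The value c_1 = 1/2 comes from the binary operation. *)
have mu : sums_to (fun n => mform (u n)) (dA (mform z) - pws (bernc K) (fun v => - T v) X).
  have [N hN] := pws_sums_to c X nT; exists N.+1 => -[|n] // Nn.
  rewrite pws_bernc_opp // -(hN n.+1 (ltnW Nn)) -sumrN.
  rewrite [in LHS]big_ord_recl [in RHS]big_ord_recl addrA; congr (_ + _).
    rewrite /u (linear_mapZ ml) /= zE mform_op1 // -zE invr1 scale1r addrC.
    by rewrite /c bernc0 // addr0 scale1r.
  apply: eq_bigr => -[[|i] ik] _ /=.
    rewrite /u (linear_mapZ ml) zE mform_op2 // -zE /bump /= (_ : 2`! = 2%N) //.
    rewrite /c bernc1 eqxx /= scalerN; congr (- (_ *: _)).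
    by field.
  rewrite /u (linear_mapZ ml) zE mform_opn // -zE scalerA /c /bump /= addr0 -scaleNr.
  by rewrite mulrN mulrA mulVf ?mul1r // factK_neq0.
split=> [[_ us]|[lz mz]].
  have z0 (W : lmodType K) (f : tensor (form_linf g) A -> W) : linear f ->
      sums_to (fun n => f (u n)) 0.
    by move=> fl; have := sums_to_linear fl us; rewrite (linear_map0 fl).
  split.
    by have /eqP := sums_to_uniq lu (z0 _ _ ll); rewrite oppr_eq0 => /eqP.
  apply/(gact_eq0 _ hm1); have /eqP := sums_to_uniq mu (z0 _ _ ml).
  by rewrite subr_eq0 => /eqP.
split=> //; move: lu mu; rewrite lz oppr0 ((gact_eq0 _ hm1).1 mz) subrr => -[N1 h1] [N2 h2].
exists (maxn N1 N2) => n; rewrite geq_max => /andP[n1 n2'].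
apply: (@lform_mform_eq0 _ _ _ _ chi).
  by rewrite (linear_map_sum _ _ _ ll) h1.
by rewrite (linear_map_sum _ _ _ ml) h2.
Qed.

(** Constant paths embed the cone into its extension by K[t,dt] compatibly with the operations in
    degree 0; the Maurer-Cartan equation of the cone itself thus becomes a case of [MC_form_iff]. *)
Definition cst_cone (x : tensor g A) : tensor (form_linf g) A :=
  tmap (fun v : C => tens v (fm false 1) : tensor C (forms K)) (@id A) x.

Let cstl : linear (fun v : C => tens v (fm false 1) : tensor C (forms K)).
Proof. exact: ((tens_bilinear C (forms K)).2 (fm false 1)). Qed.

Lemma cst_cone_linear : linear cst_cone.
Proof. exact: tmap_linear cstl (@linear_id K A). Qed.

Lemma cst_cone_tens (v : g) (a : A) :
  cst_cone (tens v a) = tens (tens (v : C) (fm false 1) : form_linf g) a.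
Proof. exact: tmap_tens cstl (@linear_id K A). Qed.

Lemma lform_cst x : lform (cst_cone x) = cstA (lproj x).
Proof.
move: x; apply: (@linear_tensor_eq _ _ _ _ (fun x => lform (cst_cone x))
  (fun x : tensor g A => cstA (lproj x))).
- exact: linear_comp (@lform_linear K A L M chi) cst_cone_linear.
- exact: linear_comp (@cstA_linear K A L) (@lproj_linear K A L M chi).
by move=> v a; rewrite cst_cone_tens lform_tens lproj_tens cstA_tens.
Qed.

Lemma mform_cst x : mform (cst_cone x) = cstA (mproj x).
Proof.
move: x; apply: (@linear_tensor_eq _ _ _ _ (fun x => mform (cst_cone x))
  (fun x : tensor g A => cstA (mproj x))).
- exact: linear_comp (@mform_linear K A L M chi) cst_cone_linear.
- exact: linear_comp (@cstA_linear K A M) (@mproj_linear K A L M chi).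
by move=> v a; rewrite cst_cone_tens mform_tens mproj_tens cstA_tens.
Qed.

Lemma cst_cone_inj x : cst_cone x = 0 -> x = 0.
Proof.
move=> x0; rewrite -[x]cpair_proj.
have l0 : lproj x = 0.
  rewrite -[lproj x](evA_cst 0) -lform_cst x0 (linear_map0 (@lform_linear K A L M chi)).
  exact: linear_map0 (evA_linear 0).
have m0 : mproj x = 0.
  rewrite -[mproj x](evA_cst 0) -mform_cst x0 (linear_map0 (@mform_linear K A L M chi)).
  exact: linear_map0 (evA_linear 0).
have := cpair_proj (0 : tensor g A).
by rewrite l0 m0 (linear_map0 (@lproj_linear K A L M chi)) (linear_map0 (@mproj_linear K A L M chi)).
Qed.

Lemma cst_cone_deg x : tmem (homog (lf_gr g) 0) (@maxid K A) x ->
  tmem (homog (lf_gr (form_linf g)) 0) (@maxid K A) (cst_cone x).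
Proof.
apply: tmem_tmap; [exact: cstl | exact: homog_subsp | move=> v hv].
by apply: (@tens_fm_homog _ _ (cone_grading L M) false 0 0).
Qed.

Lemma opA_cst x n : tmem (homog (lf_gr g) 0) (@maxid K A) x ->
  opA (nseq n.+1 (cst_cone x)) = cst_cone (opA (nseq n.+1 x)).
Proof.
move=> [s [hs ->]]; pose T i := tnth (in_tuple s) i.
have hT i b : parity (cone_grading L M) b (T i).1 = if b == false then (T i).1 else 0.
  have [h _] := hs (T i) (mem_tnth _ _).
  by rewrite (parity_homog b h) /= eq_sym.
rewrite big_tnth (linear_map_sum _ _ _ cst_cone_linear).
have mg (h : linf K) : multilinear (@opA K A h).
  by apply: mlift_multilinear; exact: opA_multibilinear.
rewrite !multilinear_expand // (linear_map_sum _ _ _ cst_cone_linear).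
apply: eq_bigr => t _.
have -> : map (fun i => cst_cone (tens (T i).1 (T i).2)) t =
    [seq tens (tens ((T i).1 : C) (fm false 1) : form_linf g) (T i).2 | i <- t].
  by apply: eq_map => i; rewrite cst_cone_tens.
rewrite (opA_tens (fun i => tens ((T i).1 : C) (fm false 1) : form_linf g)).
rewrite (opA_tens (fun i => (T i).1 : g)) cst_cone_tens; congr (tens _ _) => /=.
have fp : formprod (fun=> false) (fun=> 1 : {poly K}) t = fm false 1.
  by rewrite formprodE (eq_count (a2 := pred0)) // count_pred0 big1.
have q := @cone_op_multilinear K L M chi.
case: n t fp => [|n] t fp; last first.
  by rewrite (form_op_fm q (fun=> 1) hT) ?size_tuple // fp.
(* In arity 1 the extra term contains the derivative of the constant 1. *)
case/tupleP: t fp => i t _; rewrite tuple0 /= (form_op1_fm q 1 (hT i)) derivC.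
by rewrite (linear_map0 (@fm_linear K _)) tens0r addr0.
Qed.

Lemma chit_cst (x : tensor L A) : chit (cstA x) = cstA (chiA x).
Proof.
move: x; apply: (@linear_tensor_eq _ _ _ _ (fun x => chit (cstA x))
  (fun x : tensor L A => cstA (chiA x))).
- exact: linear_comp (@chiA_linear K A Lt Mt _) (@cstA_linear K A L).
- exact: linear_comp (@cstA_linear K A M) (@chiA_linear K A L M chi).
by move=> v a; rewrite cstA_tens !chiA_tens cstA_tens /= form_map_tens.
Qed.

Lemma evA_chit c (x : tensor Lt A) : evA c (chit x) = chiA (evA c x).
Proof.
move: x; apply: (@linear_tensor_eq _ _ _ _ (fun x => evA c (chit x))
  (fun x : tensor Lt A => chiA (evA c x))).
- exact: linear_comp (evA_linear c) (@chiA_linear K A Lt Mt _).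
- exact: linear_comp (@chiA_linear K A L M chi) (evA_linear c).
move=> v a; rewrite chiA_tens !evA_tens chiA_tens; congr (tens _ _).
apply: (@form_eq _ _ (dgl_gr L) _ (fun v => form_eval c (form_map chi v))
  (fun v => chi (form_eval c v))).
- exact: linear_comp (@form_eval_linear K M c) (@form_map_linear K L M chi).
- exact: linear_comp (dgm_linear chi) (@form_eval_linear K L c).
move=> e j w p _; rewrite form_map_tens !form_eval_fm; case: e.
  by rewrite (linear_map0 (dgm_linear chi)).
by rewrite (linear_mapZ (dgm_linear chi)).
Qed.

Lemma cstA_gact (N : dgla K) (a y : tensor N A) : tfil 1 a ->
  cstA (gact a y) = gact (cstA a) (cstA y).
Proof. exact: chiA_gact. Qed.

Lemma MC_cone_iff x : tmem (homog (lf_gr g) 0) (@maxid K A) x ->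
  MC_set x <-> curv (lproj x) = 0 /\ gact (mproj x) (chiA (lproj x)) = 0.
Proof.
move=> hx; have hz := cst_cone_deg hx.
have hm : tfil 1 (mproj x) by exact: tdeg_fil (mproj_deg hx).
have cst_eq0 (N : dgla K) (y : tensor N A) : cstA y = 0 <-> y = 0.
  split=> [y0|->]; last exact: linear_map0 (@cstA_linear K A N).
  by rewrite -[y](evA_cst 0) y0 (linear_map0 (evA_linear 0)).
have -> : MC_set x <-> MC_set (cst_cone x).
  split=> -[_ hs]; split=> //.
    have := sums_to_linear cst_cone_linear hs; rewrite (linear_map0 cst_cone_linear) => -[N hN].
    exists N => n /hN E; rewrite -[RHS]E; apply: eq_bigr => i _.
    by rewrite (linear_mapZ cst_cone_linear) opA_cst.
  have [N hN] := hs; exists N => n /hN E; apply: cst_cone_inj; rewrite -[RHS]E.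
  rewrite (linear_map_sum _ _ _ cst_cone_linear); apply: eq_bigr => i _.
  by rewrite (linear_mapZ cst_cone_linear) opA_cst.
rewrite (MC_form_iff hz) lform_cst mform_cst chit_cst -cstA_gact // cst_eq0.
rewrite (_ : curv (cstA (lproj x)) = cstA (curv (lproj x))) ?cst_eq0 //.
exact/esym/chiA_curv.
Qed.

End MaurerCartan.

(** * The isomorphism *)

Section Isomorphism.
Variables (K : fieldType) (charK0 : [pchar K] =i pred0).
Variables (L M : dgla K) (chi : dgla_mor L M).
Local Notation C := (cone_space L M).
Local Notation g := (cone_linf chi).
Local Notation Lt := (form_dgla L).
Local Notation Mt := (form_dgla M).

Lemma MCchi_setP (A : art K) (l : tensor L A) (m : tensor M A) :
  MCchi_set chi (l, m) <->
  [/\ tdeg 1 1 l, tdeg 0 1 m, curv l = 0 & gact m (chiA chi l) = 0].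
Proof.
split=> -[hl hm cl gm].
  have hm1 : tdeg 0 1 m by exact/tdeg_maxid.
  split=> //; first exact/tdeg_maxid.
  exact/esym/(is_gaugeP _ _ (tdeg_fil hm1)).
split=> //; first exact/tdeg_maxid; first exact/tdeg_maxid.
exact/(is_gaugeP _ _ (tdeg_fil hm)).
Qed.

Fact cone_chi_subproof (A : art K) (x : MC g A) :
  MCchi_set chi (lproj (sval x), mproj (sval x)).
Proof.
case: x => x hx /=; have xm := hx.1; have [cl gm] := (MC_cone_iff charK0 xm).1 hx.
by apply/MCchi_setP; split=> //; [exact: lproj_deg | exact: mproj_deg].
Qed.

Definition cone_chi (A : art K) (x : MC g A) : MCchi chi A := exist _ _ (cone_chi_subproof x).

Fact chi_cone_subproof (A : art K) (p : MCchi chi A) :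
  MC_set (cpair chi (sval p).1 (sval p).2).
Proof.
case: p => -[l m] /= /MCchi_setP[hl hm cl gm].
apply/(MC_cone_iff charK0 (cpair_deg chi hl hm)).
by have [-> ->] := proj_cpair chi l m.
Qed.

Definition chi_cone (A : art K) (p : MCchi chi A) : MC g A := exist _ _ (chi_cone_subproof p).

Lemma cone_chiK (A : art K) : cancel (@cone_chi A) (@chi_cone A).
Proof. by move=> x; apply: MC_eq; exact: cpair_proj. Qed.

Lemma chi_coneK (A : art K) : cancel (@chi_cone A) (@cone_chi A).
Proof.
by move=> [[l m] h]; apply: MCchi_eq => /=; have [-> ->] := proj_cpair chi l m.
Qed.

Lemma lproj_eval (A : art K) c (z : tensor (form_linf g) A) :
  lproj (tmap (form_eval c : form_linf g -> g) id z) = evA c (lform z).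
Proof.
have el : linear (form_eval c : form_linf g -> g) by exact: form_eval_linear.
have tl := tmap_linear el (@linear_id K A).
have T1 := linear_comp (@lproj_linear K A L M chi) tl.
have T2 := linear_comp (@evA_linear K A L c) (@lform_linear K A L M chi).
move: z; apply: (linear_tensor_eq T1 T2) => w a; move: w.
apply: (@linear_tensor_eq _ _ _ _
  (fun w : form_linf g => lproj (tmap (form_eval c : form_linf g -> g) id (tens w a)))
  (fun w : form_linf g => evA c (lform (tens w a)))).
- exact: (linear_comp T1 ((tens_bilinear (form_linf g) A).2 a)).
- exact: (linear_comp T2 ((tens_bilinear (form_linf g) A).2 a)).
move=> v r; rewrite lform_tens evA_tens tmap_tens // lproj_tens.
by congr (tens _ _); rewrite /form_eval !tlift_tens //; exact: form_eval_bilinear.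
Qed.

Lemma mproj_eval (A : art K) c (z : tensor (form_linf g) A) :
  mproj (tmap (form_eval c : form_linf g -> g) id z) = evA c (mform z).
Proof.
have el : linear (form_eval c : form_linf g -> g) by exact: form_eval_linear.
have tl := tmap_linear el (@linear_id K A).
have T1 := linear_comp (@mproj_linear K A L M chi) tl.
have T2 := linear_comp (@evA_linear K A M c) (@mform_linear K A L M chi).
move: z; apply: (linear_tensor_eq T1 T2) => w a; move: w.
apply: (@linear_tensor_eq _ _ _ _
  (fun w : form_linf g => mproj (tmap (form_eval c : form_linf g -> g) id (tens w a)))
  (fun w : form_linf g => evA c (mform (tens w a)))).
- exact: (linear_comp T1 ((tens_bilinear (form_linf g) A).2 a)).
- exact: (linear_comp T2 ((tens_bilinear (form_linf g) A).2 a)).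
move=> v r; rewrite mform_tens evA_tens tmap_tens // mproj_tens.
by congr (tens _ _); rewrite /form_eval !tlift_tens //; exact: form_eval_bilinear.
Qed.

(** * Homotopies against gauge equivalences *)

Section Homotopies.
Variable A : art K.
Local Notation chit := (@chiA K Lt Mt (form_mor chi) A).
Local Notation chiA := (@chiA K L M chi A).
Implicit Types (N : dgla K).

Lemma evA_deg N c i k (x : tensor (form_dgla N) A) : tdeg i k x -> tdeg i k (evA c x).
Proof. exact: chiA_deg. Qed.

Lemma cstA_deg N i k (x : tensor N A) : tdeg i k x -> tdeg i k (cstA x).
Proof. exact: chiA_deg. Qed.

Lemma evA_gact N c (a y : tensor (form_dgla N) A) : tfil 1 a ->
  evA c (gact a y) = gact (evA c a) (evA c y).
Proof. exact: chiA_gact. Qed.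

Lemma evA_bch N c (x y : tensor (form_dgla N) A) : tfil 1 x -> tfil 1 y ->
  evA c (bch x y) = bch (evA c x) (evA c y).
Proof. exact: chiA_bch. Qed.

Lemma evAN N c (x : tensor (form_dgla N) A) : evA c (- x) = - evA c x.
Proof. exact: chiAN. Qed.

Lemma evA_dA N c (x : tensor (form_dgla N) A) : evA c (dA x) = dA (evA c x).
Proof. exact: chiA_dA. Qed.

Lemma tdegN N i k (x : tensor N A) : tdeg i k x -> tdeg i k (- x).
Proof. exact: (subspN (tdeg_subsp i k)). Qed.

Lemma tdeg0 N i k : tdeg i k (0 : tensor N A).
Proof. exact: (tdeg_subsp _ _).1. Qed.

Lemma gact_cancel N (a y : tensor N A) : tfil 1 a -> gact a y = 0 -> gact (- a) 0 = y.
Proof. by move=> ha <-; exact: (gactK charK0 _ ha). Qed.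

Lemma homotopic_gauge (x y : MC g A) : homotopic x y -> gauge_equiv (cone_chi x) (cone_chi y).
Proof.
move=> [[z hz] /= [zx zy]]; have zm := hz.1.
have [cl gm] := (MC_form_iff charK0 zm).1 hz.
have hl := lform_deg zm; have hm := mform_deg zm.
set l := lform z in cl gm hl; set m := mform z in gm hm.
have E0 : lproj (sval x) = evA 0 l by rewrite -zx lproj_eval.
have E1 : lproj (sval y) = evA 1 l by rewrite -zy lproj_eval.
have F0 : mproj (sval x) = evA 0 m by rewrite -zx mproj_eval.
have F1 : mproj (sval y) = evA 1 m by rewrite -zy mproj_eval.
have [p [hp p0 lE]] := MC_form_trivial charK0 hl cl.
set x0 := evA 0 l in lE; set a0 := evA 0 m.
have hx0 : tdeg 1 1 x0 := evA_deg 0 hl; have ha0 : tdeg 0 1 a0 := evA_deg 0 hm.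
have hx00 : tdeg 1 0 (cstA x0) by apply: cstA_deg; exact: tdegW hx0.
have hca : tdeg 0 1 (cstA a0) := cstA_deg ha0; have hNca := tdegN hca.
have hcp : tdeg 0 1 (chit p) := chiA_deg _ hp.
have hmp := bch_deg hm hcp.
pose w := bch (bch m (chit p)) (- cstA a0).
have hw : tdeg 0 1 w := bch_deg hmp hNca.
have g0 : gact a0 (chiA x0) = 0.
  have := congr1 (evA 0) gm; rewrite (evA_gact _ _ (tdeg_fil hm)) evA_chit.
  by rewrite (linear_map0 (evA_linear 0)).
(* Reading e^w from the right: e^(- a_0) takes 0 to chi(x_0), e^(chi(p)) takes this to chi(l), and
   e^m takes chi(l) to 0. *)
have w0 : gact w 0 = 0.
  rewrite (gact_bch charK0 hmp hNca (tdeg0 _ _ _)).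
  have -> : gact (- cstA a0) 0 = chit (cstA x0).
    apply: gact_cancel; first exact: (tdeg_fil hca).
    rewrite chit_cst -(cstA_gact _ (tdeg_fil ha0)) g0.
    exact: linear_map0 (@cstA_linear K A M).
  rewrite (gact_bch charK0 hm hcp); last exact: chiA_deg.
  by rewrite -(chiA_gact _ _ (tdeg_fil hp)) -lE.
have dw : dA w = 0.
  have := (gact_eq0 charK0 0 (tdeg_fil hw)).1 w0 => ->.
  exact: linear_map0 (pws_linear _ (nilop_opp (nilop_brA (tdeg_fil hw)))).
have evw c : evA c w = bch (bch (evA c m) (chiA (evA c p))) (- a0).
  rewrite /w (evA_bch _ (tdeg_fil hmp) (tdeg_fil hNca)) (evA_bch _ (tdeg_fil hm) (tdeg_fil hcp)).
  by rewrite evA_chit evAN evA_cst.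
have ha0' := tdegN ha0.
have w00 : evA 0 w = 0.
  rewrite evw p0 (linear_map0 (@chiA_linear K A L M chi)) -/a0 bch0r //.
  (* Writing a_0 as [bch 0 a0] makes e^(a_0) e^(- a_0) = 1 the case u = 0 of [bchK]. *)
  by rewrite -[X in bch X](bch0l charK0 ha0) (bchK charK0 (tdeg0 _ _ _) ha0).
(* For closed w, Stokes' formula reads 0 = w(1) - w(0) + d([IA w]), whence the sign. *)
pose b := - IA w.
have hb : tdeg (- 1) 1 b by apply: tdegN; have := IA_deg hw; rewrite add0r.
have dbE : dA b = evA 1 w.
  have := IA_dA charK0 hw; rewrite dw (linear_map0 (@IA_linear K A M)) w00 subr0 sg0 scale1r.
  by move=> /esym/eqP; rewrite addr_eq0 => /eqP ->; rewrite /b dAN.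
have hdb : tdeg 0 1 (dA b) by have := dA_deg hb; rewrite addNr.
pose a := evA 1 p; have ha : tdeg 0 1 a := evA_deg 1 hp.
have hca1 : tdeg 0 1 (chiA a) := chiA_deg _ ha.
have hm1 : tdeg 0 1 (evA 1 m) := evA_deg 1 hm.
exists a, b; split => /=; [exact/tdeg_maxid | exact/tdeg_maxid | |].
  rewrite E0 E1; apply/(is_gaugeP _ _ (tdeg_fil ha)).
  by rewrite [in LHS]lE (evA_gact _ _ (tdeg_fil hp)) evA_cst.
rewrite F0 F1; exists (bch (dA b) a0).
  exact: bch_expmul (tdeg_fil hdb) (tdeg_fil ha0).
apply/(is_expmulP _ (tdeg_fil (bch_deg hdb ha0)) (tdeg_fil (tdegN hca1))).
(* Two cancellations on the right: e^(w(1)) e^(a_0) = e^(m(1)) e^(chi(a)), and multiplying by e^(-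
   chi(a)) leaves e^(m(1)). *)
have U := bchK charK0 (bch_deg hm1 hca1) ha0'; rewrite opprK in U.
by rewrite dbE evw -/a U (bchK charK0 hm1 hca1).
Qed.

Lemma gauge_homotopic (p q : MCchi chi A) : gauge_equiv p q -> homotopic (chi_cone p) (chi_cone q).
Proof.
case: p q => [[x0 a0] hp0] [[x1 a1] hq0] [a [b []]] /=.
have [hx0 ha0 cx0 g0] := (MCchi_setP x0 a0).1 hp0.
have [hx1 ha1 _ _] := (MCchi_setP x1 a1).1 hq0.
move=> /tdeg_maxid ha /tdeg_maxid hb.
move=> /(is_gaugeP _ _ (tdeg_fil ha)) x1E [w hw hw'].
have hdb : tdeg 0 1 (dA b) by have := dA_deg hb; rewrite addNr.
have hca : tdeg 0 1 (chiA a) := chiA_deg _ ha; have hNca := tdegN hca.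
have {hw}wE := (is_expmulP _ (tdeg_fil hdb) (tdeg_fil ha0)).1 hw; subst w.
have {hw'}a1E := (is_expmulP _ (tdeg_fil (bch_deg hdb ha0)) (tdeg_fil hNca)).1 hw'.
(* Evaluation drops the dt-component of d(t b), so that W takes the value c db at t = c. *)
pose ta := tXA 1 a; pose W := dA (tXA 1 b).
have hta : tdeg 0 1 ta by exact: tXA_deg.
have hW : tdeg 0 1 W by have := dA_deg (tXA_deg 1 hb); rewrite addNr.
have hcta : tdeg 0 1 (chit ta) := chiA_deg _ hta; have hNcta := tdegN hcta.
have hcx0 : tdeg 1 1 (cstA x0) := cstA_deg hx0.
have hcx00 : tdeg 1 0 (cstA x0) := tdegW (leq0n 1) hcx0.
have hca0 : tdeg 0 1 (cstA a0) := cstA_deg ha0.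
pose l := gact ta (cstA x0); pose m := bch (bch W (cstA a0)) (- chit ta).
have hl : tdeg 1 1 l by exact: gact_deg.
have hWa := bch_deg hW hca0; have hm : tdeg 0 1 m := bch_deg hWa hNcta.
have cl : curv l = 0.
  have cc : cstA (curv x0) = curv (cstA x0) by exact: chiA_curv.
  by apply: curv_gact_eq0 => //; rewrite -cc cx0 (linear_map0 (@cstA_linear K A L)).
(* The factor e^(- chi(t a)) of e^m undoes the gauge transformation by t a, e^(a_0) sends chi(x_0)
   to 0, and e^W fixes 0 because W is closed. *)
have gm : gact m (chit l) = 0.
  rewrite (gact_bch charK0 hWa hNcta); last by apply: chiA_deg; exact: tdegW hl.
  rewrite /l (chiA_gact _ _ (tdeg_fil hta)) (gactK charK0 _ (tdeg_fil hcta)).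
  rewrite (gact_bch charK0 hW hca0); last exact: chiA_deg.
  rewrite chit_cst -(cstA_gact _ (tdeg_fil ha0)) g0 (linear_map0 (@cstA_linear K A M)).
  rewrite /gact brA0r /W dA_dA subrr add0r.
  exact: linear_map0 (pws_linear _ (nilop_brA (tdeg_fil hW))).
have zm := fpair_deg chi hl hm.
have hz : MC_set (fpair chi l m).
  by apply/(MC_form_iff charK0 zm); have [-> ->] := form_fpair chi l m.
have evz c : tmap (form_eval c : form_linf g -> g) id (fpair chi l m) =
    cpair chi (evA c l) (evA c m).
  rewrite -[LHS]cpair_proj lproj_eval mproj_eval.
  by have [-> ->] := form_fpair chi l m.
have evl c : evA c l = gact (c *: a) x0.
  by rewrite /l (evA_gact _ _ (tdeg_fil hta)) evA_tXA expr1 evA_cst.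
have evm c : evA c m = bch (bch (dA (c *: b)) a0) (- chiA (c *: a)).
  rewrite /m (evA_bch _ (tdeg_fil hWa) (tdeg_fil hNcta)) (evA_bch _ (tdeg_fil hW) (tdeg_fil hca0)).
  by rewrite /W evA_dA evA_tXA evA_cst evAN evA_chit evA_tXA !expr1.
exists (exist _ (fpair chi l m) hz) => /=; split; rewrite [LHS]evz evl evm.
  rewrite !scale0r gact0 dA0 (linear_map0 (@chiA_linear K A L M chi)) oppr0.
  by rewrite (bch0l charK0 ha0) (bch0r charK0 ha0).
by rewrite !scale1r -x1E -a1E.
Qed.

End Homotopies.

Lemma cone_chi_natural (A B : art K) (f : {lrmorphism A -> B}) (x : MC g A) :
  cone_chi (fmap f x) = fmap f (cone_chi x).
Proof.
by apply: MCchi_eq => /=; congr pair; apply/esym; exact: base_change_tmap.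
Qed.

End Isomorphism.

Theorem theorem2 (K : fieldType) (charK0 : [pchar K] =i pred0)
  (L M : dgla K) (chi : dgla_mor L M) :
  functor_iso (Def_linf (cone_linf chi)) (Def_chi chi).
Proof.
have hf A := @homotopic_gauge K charK0 L M chi A.
have hg A := @gauge_homotopic K charK0 L M chi A.
exists (fun A => quot_map (hf A)); split=> [A|A B f S].
  exists (quot_map (hg A)) => S; have [x ->] := qcls_surj S; rewrite !quot_map_cls.
    by rewrite cone_chiK.
  by rewrite chi_coneK.
have [x ->] := qcls_surj S; rewrite /= /quot_functor_map !quot_map_cls.
by rewrite cone_chi_natural.
Qed.
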